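(* Let $\mathcal{S}$ be the number of edges in the matching graph $M$, and let $c$ be any constant fixed in advance. There is a Monte Carlo algorithm that solves the reporting variant of Generalised Pattern Matching in $\mathcal{O}(\sqrt{\mathcal{S}}\, n\log m\sqrt{\log n})$ time. The error is one-sided (only false positives are allowed), and the error probability is at most $1/n^c$.
   Context: Generalised Pattern Matching (GPM): the input is a text $T\in\Sigma_T^n$, a pattern $P\in\Sigma_P^m$, and a matching relationship $M\subseteq\Sigma_T\times\Sigma_P$, viewed as a bipartite graph (the matching graph) on vertex set $\Sigma_T\cup\Sigma_P$ whose edges are the matching pairs. Reporting variant: output all $i\in[n-m+1]$ such that $T[i+j-1]$ matches $P[j]$ for all $j\in[m]$. The alphabet sizes are polynomial in $n$, and the matching graph is accessed through oracles answering in $\mathcal{O}(1)$ time: (1) whether $a\in\Sigma_T$ and $b\in\Sigma_P$ match; (2) the degree of a given character in $M$; (3) the $k$-th neighbour of a given $a\in\Sigma_T$ (for an arbitrary fixed order of neighbours). Word RAM model. *)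

(* Defs.v *)
From HB Require Import structures.
From mathcomp Require Import all_boot all_order all_algebra.
From mathcomp Require Import reals exp.

Set Implicit Arguments.
Unset Strict Implicit.
Unset Printing Implicit Defensive.

Import Order.TTheory GRing.Theory Num.Theory.

Local Open Scope nat_scope.

(** * A randomised word RAM with oracles

    Words are natural numbers below [2 ^ w].  A program is a fixed list of
    instructions, independent of the input and of [w]; every instruction costs
    one time unit.  Registers are the finitely many ones named by the program;
    memory is addressed by words. *)

Inductive binop :=
  | OpAdd | OpSub | OpMul | OpDiv | OpMod
  | OpAnd | OpOr | OpXor | OpShl | OpShr
  | OpLt | OpEq.

Definition eval_binop (w : nat) (o : binop) (x y : nat) : nat :=
  match o with
  | OpAdd => x + y
  | OpSub => x + 2 ^ w - y
  | OpMul => x * y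
  | OpDiv => x %/ y
  | OpMod => x %% y
  | OpAnd => Nat.land x y
  | OpOr => Nat.lor x y
  | OpXor => Nat.lxor x y
  | OpShl => x * 2 ^ y
  | OpShr => x %/ 2 ^ y
  | OpLt => x < y
  | OpEq => x == y
  end.

(** In each instruction the first argument is the destination register, except
    for [WriteMem p x] (writes register [x] at the address held by [p]),
    [Jz x l] (continues at instruction number [l] if register [x] is zero) and
    [Out x]. *)
Inductive instr :=
  | Const of nat & nat
  | Op of binop & nat & nat & nat
  | ReadMem of nat & nat
  | WriteMem of nat & nat
  | Jz of nat & nat
  | Rand of nat
  | AskMatch of nat & nat & nat
  | AskDegT of nat & nat
  | AskDegP of nat & nat
  | AskNbr of nat & nat & nat
  | Out of nat
  | Halt.

Definition program := seq instr.

Record oracle := Oracle {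
  match_q : nat -> nat -> nat;
  degT_q : nat -> nat;
  degP_q : nat -> nat;
  nbr_q : nat -> nat -> nat
}.

Record state := State {
  pc : nat;
  reg : nat -> nat;
  mem : nat -> nat;
  tape : seq nat;   (* random words not consumed yet *)
  out : seq nat     (* words reported so far *)
}.

Definition upd (f : nat -> nat) (a v : nat) : nat -> nat :=
  fun x => if x == a then v else f x.

(** Running past the end of the program halts. *)
Definition fetch (p : program) (s : state) : instr := nth Halt p (pc s).

Definition halted (p : program) (s : state) : bool :=
  if fetch p s is Halt then true else false.

Definition step (w : nat) (O : oracle) (p : program) (s : state) : state :=
  let: State l r h tp o := s in
  let set x v := State l.+1 (upd r x (v %% 2 ^ w)) h tp o in
  match fetch p s with
  | Const x v => set x v
  | Op f x y z => set x (eval_binop w f (r y) (r z))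
  | ReadMem x y => set x (h (r y))
  | WriteMem x y => State l.+1 r (upd h (r x) (r y)) tp o
  | Jz x l' => State (if r x == 0 then l' else l.+1) r h tp o
  | Rand x => State l.+1 (upd r x (head 0 tp %% 2 ^ w)) h (behead tp) o
  | AskMatch x y z => set x (match_q O (r y) (r z))
  | AskDegT x y => set x (degT_q O (r y))
  | AskDegP x y => set x (degP_q O (r y))
  | AskNbr x y z => set x (nbr_q O (r y) (r z))
  | Out x => State l.+1 r h tp (rcons o (r x))
  | Halt => s
  end.

(** * Generalised pattern matching

    The alphabets are ['I_sT] and ['I_sP]; positions are numbered from [0]. *)

Section GPM.
Variables (sT sP n m : nat).
Variables (T : n.-tuple 'I_sT) (P : m.-tuple 'I_sP).
Variable M : {set 'I_sT * 'I_sP}.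

Definition nbrs (a : 'I_sT) : {set 'I_sP} := [set b | (a, b) \in M].
Definition conbrs (b : 'I_sP) : {set 'I_sT} := [set a | (a, b) \in M].

(** [nb] lists the neighbours of each text character, in an arbitrary order. *)
Definition neighbour_order (nb : 'I_sT -> seq 'I_sP) : Prop :=
  forall a, perm_eq (nb a) (enum (nbrs a)).

Definition gpm_match_at (i : nat) : bool :=
  [forall s : 'I_n, forall j : 'I_m,
     (s == i + j :> nat) ==> ((tnth T s, tnth P j) \in M)].

Definition positions : seq nat := iota 0 (n - m + 1).

Definition occurrences : seq nat := [seq i <- positions | gpm_match_at i].

(** Queries about numbers that are not characters, or about neighbours beyond
    the degree, are answered by [0]. *)
Definition gpm_oracle (nb : 'I_sT -> seq 'I_sP) : oracle := {|
  match_q := fun a b =>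
    if insub a is Some a' then
      if insub b is Some b' then nat_of_bool ((a', b') \in M) else 0
    else 0;
  degT_q := fun a => if insub a is Some a' then #|nbrs a'| else 0;
  degP_q := fun b => if insub b is Some b' then #|conbrs b'| else 0;
  nbr_q := fun a k =>
    if insub a is Some a' then nth 0 [seq val b | b <- nb a'] k else 0
|}.

(** Registers 0 and 1 hold [n] and [m]; memory holds the text followed by the
    pattern; everything else is zero. *)
Definition gpm_init (w : nat) (r : seq nat) : state := {|
  pc := 0;
  reg := fun x => nth 0 [:: n; m] x %% 2 ^ w;
  mem := fun a =>
    nth 0 ([seq val c | c <- T] ++ [seq val c | c <- P]) a %% 2 ^ w;
  tape := r;
  out := [::]
|}.

Definition gpm_run (nb : 'I_sT -> seq 'I_sP) (p : program) (w t : nat)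
    (r : t.-tuple 'I_(2 ^ w)) : state :=
  iter t (step w (gpm_oracle nb) p) (gpm_init w [seq val x | x <- r]).

End GPM.

Local Open Scope ring_scope.

Definition uniform_prob (R : realType) (Omega : finType) (E : pred Omega) : R :=
  #|E|%:R / #|Omega|%:R.

(** Logarithms in asymptotic bounds are at least 1, and so is the number of
    edges: the literal expression vanishes for [m = 1], [n = 1] or an empty
    matching graph. *)
Definition log1 (R : realType) (x : nat) : R := Num.max 1 (ln x%:R).

Definition gpm_time (R : realType) (S n m : nat) : R :=
  Num.sqrt (maxn 1 S)%:R * n%:R * log1 R m * Num.sqrt (log1 R n).

(* Main.v *)
(** Call a text character heavy if its degree exceeds a threshold D, and light
    otherwise.  For each heavy character one boolean correlation, of its
    occurrences with the pattern positions it does not match, finds all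
    offsets with a mismatch at that character.  The light characters are
    handled together: colour the pattern alphabet at random with 4 D + 1
    colours and, for each colour r, correlate the light text positions whose
    character has no neighbour of colour r with the pattern positions of colour
    r.  Every hit is a true mismatch, and a given mismatch at a light character
    is missed only if the pattern character shares its colour with one of at
    most D neighbours, which has probability at most 1/2.  After O(log n)
    independent repetitions a union bound over the offsets gives the error
    bound.  If the degrees of the occurring text characters sum to S, there are
    fewer than S / D heavy characters against O(D log n) light rounds, so
    D ~ sqrt (S / log n) balances the two.

    A correlation takes O(n log m) time: the text is cut into blocks of about
    the length of the pattern, and each block is convolved with the pattern by a
    fast Fourier transform in fixed point arithmetic.  The convolution has
    integer entries and the scale is a large power of n, so that the rounding
    errors cannot hide whether an entry is zero.  The roots of unity come from
    the half angle formulas and integer square roots. *)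

Require Import Defs.
From HB Require Import structures.
From mathcomp Require Import all_boot all_order all_algebra.
From mathcomp Require Import reals exp.
From mathcomp Require Import complex.
From mathcomp Require Import zify ring lra.
From Stdlib Require Import FunctionalExtensionality.

Set Implicit Arguments.
Unset Strict Implicit.
Unset Printing Implicit Defensive.

Import Order.TTheory GRing.Theory Num.Theory.

(** * A structured language compiled to the word RAM *)

Local Open Scope nat_scope.

Inductive expr :=
  | Vr of nat
  | Cs of nat
  | Bi of binop & expr & expr
  | Rd of nat & expr
  | Rw of expr
  | QM of expr & expr
  | QD of expr
  | QN of expr & expr.

Inductive cmd :=
  | Skip
  | Asg of nat & expr
  | Wr of nat & expr & expr
  | Rnd of nat
  | Ou of expr
  | Sq of cmd & cmd
  | If of expr & cmd
  | For of nat & nat & cmd.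

(* Registers from [tmp] on hold intermediate results of compiled expressions. *)
Definition tmp := 64.

(* Array [id] < 32 is interleaved with the others: its cell [i] is at address
   [2 n + 32 i + id], above the input.  Since 32 divides [2 ^ w], cells of
   distinct arrays differ even if the index overflows. *)
Definition code_adr (d id : nat) : seq instr :=
  [:: Const d.+1 32; Op OpMul d d d.+1; Const d.+1 id; Op OpAdd d d d.+1;
      Op OpAdd d d 0; Op OpAdd d d 0].

Fixpoint code_expr (d : nat) (e : expr) : seq instr :=
  match e with
  | Vr x => [:: Op OpOr d x x]
  | Cs v => [:: Const d v]
  | Bi o a b => code_expr d a ++ code_expr d.+1 b ++ [:: Op o d d d.+1]
  | Rd id a => (code_expr d a ++ code_adr d id) ++ [:: ReadMem d d]
  | Rw a => code_expr d a ++ [:: ReadMem d d]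
  | QM a b => code_expr d a ++ code_expr d.+1 b ++ [:: AskMatch d d d.+1]
  | QD a => code_expr d a ++ [:: AskDegT d d]
  | QN a b => code_expr d a ++ code_expr d.+1 b ++ [:: AskNbr d d d.+1]
  end.

Fixpoint esz (e : expr) : nat :=
  match e with
  | Vr _ | Cs _ => 1
  | Bi _ a b | QM a b | QN a b => esz a + esz b + 1
  | Rd _ a => esz a + 7
  | Rw a | QD a => esz a + 1
  end.

Fixpoint csz (c : cmd) : nat :=
  match c with
  | Skip => 0
  | Asg _ e => esz e + 1
  | Wr _ a b => esz a + esz b + 7
  | Rnd _ => 1
  | Ou e => esz e + 1
  | Sq a b => csz a + csz b
  | If e c => esz e + 1 + csz c
  | For _ _ c => csz c + 6
  end.

Fixpoint code_cmd (l : nat) (c : cmd) : seq instr :=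
  match c with
  | Skip => [::]
  | Asg x e => code_expr tmp e ++ [:: Op OpOr x tmp tmp]
  | Wr id a b => (code_expr tmp a ++ code_adr tmp id) ++ code_expr tmp.+1 b ++
                 [:: WriteMem tmp tmp.+1]
  | Rnd x => [:: Rand x]
  | Ou e => code_expr tmp e ++ [:: Out tmp]
  | Sq a b => code_cmd l a ++ code_cmd (l + csz a) b
  | If e c => code_expr tmp e ++ [:: Jz tmp (l + esz e + 1 + csz c)] ++
              code_cmd (l + esz e + 1) c
  | For x y c => [:: Const x 0; Jz y (l + csz c + 6)] ++ code_cmd (l + 2) c ++
       [:: Const tmp 1; Op OpAdd x x tmp; Op OpEq tmp x y; Jz tmp (l + 2)]
  end.

Fixpoint ewf (e : expr) : bool :=
  match e with
  | Vr x => x < tmp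
  | Cs _ => true
  | Bi _ a b | QM a b | QN a b => ewf a && ewf b
  | Rd _ a | Rw a | QD a => ewf a
  end.

Fixpoint asg (c : cmd) : seq nat :=
  match c with
  | Asg x _ | Rnd x => [:: x]
  | Sq a b => asg a ++ asg b
  | If _ c => asg c
  | For x _ c => x :: asg c
  | _ => [::]
  end.

Fixpoint wrs (c : cmd) : seq nat :=
  match c with
  | Wr id _ _ => [:: id]
  | Sq a b => wrs a ++ wrs b
  | If _ c | For _ _ c => wrs c
  | _ => [::]
  end.

Fixpoint cwf (c : cmd) : bool :=
  match c with
  | Skip => true
  | Asg x e => [&& 0 < x, x < tmp & ewf e]
  | Wr id a b => [&& id < 32, ewf a & ewf b]
  | Rnd x => (0 < x) && (x < tmp)
  | Ou e => ewf e
  | Sq a b => cwf a && cwf b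
  | If e c => ewf e && cwf c
  | For x y c => [&& 0 < x, x < tmp, y < tmp, y != x, x \notin asg c,
                     y \notin asg c & cwf c]
  end.

Record hst := Hst {
  rg : nat -> nat; mm : nat -> nat; tp : seq nat; ou : seq nat; ck : nat }.

Definition setr (s : hst) (x v k : nat) : hst :=
  Hst (upd (rg s) x v) (mm s) (tp s) (ou s) (ck s + k).
Definition tick (s : hst) (k : nat) : hst :=
  Hst (rg s) (mm s) (tp s) (ou s) (ck s + k).

Arguments step : simpl never.

Section Semantics.
Variables (w n : nat) (O : oracle).
Local Notation W := (2 ^ w).

Definition adr (id i : nat) : nat := (i * 32 + id + n + n) %% W.
Arguments adr : simpl never.

Fixpoint ev (s : hst) (e : expr) : nat :=
  match e with
  | Vr x => rg s x
  | Cs v => v %% W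
  | Bi o a b => eval_binop w o (ev s a) (ev s b) %% W
  | Rd id a => mm s (adr id (ev s a))
  | Rw a => mm s (ev s a)
  | QM a b => match_q O (ev s a) (ev s b) %% W
  | QD a => degT_q O (ev s a) %% W
  | QN a b => nbr_q O (ev s a) (ev s b) %% W
  end.

Fixpoint den (c : cmd) (s : hst) : hst :=
  match c with
  | Skip => s
  | Asg x e => setr s x (ev s e) (esz e + 1)
  | Wr id a b => Hst (rg s) (upd (mm s) (adr id (ev s a)) (ev s b)) (tp s) (ou s)
                     (ck s + (esz a + esz b + 7))
  | Rnd x => Hst (upd (rg s) x (head 0 (tp s) %% W)) (mm s) (behead (tp s)) (ou s)
                 (ck s + 1)
  | Ou e => Hst (rg s) (mm s) (tp s) (rcons (ou s) (ev s e)) (ck s + (esz e + 1))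
  | Sq a b => den b (den a s)
  | If e c => let s' := tick s (esz e + 1) in
              if ev s e == 0 then s' else den c s'
  | For x y c => iter (rg s y) (fun s => let s' := den c s in
                     setr s' x (rg s' x).+1 4) (setr s x 0 2)
  end.

Definition okst (s : hst) : Prop :=
  (forall x, rg s x < W) /\ (forall a, mm s a < W).

Lemma den_rg c s x : x \notin asg c -> rg (den c s) x = rg s x.
Proof.
elim: c s => //= [y e|y|a IHa b IHb|e c IH|y z c IH] s.
- by rewrite inE /upd => /negbTE ->.
- by rewrite inE /upd => /negbTE ->.
- by rewrite mem_cat negb_or => /andP[Ha Hb]; rewrite IHb // IHa.
- by move=> H; case: eqP => // _; rewrite IH.
rewrite inE negb_or => /andP[/negbTE Hy Hc].
elim: (rg s z) => [|k IHk] /=; first by rewrite /upd Hy.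
by rewrite {1}/upd Hy IH.
Qed.

Section Exec.
Variable p : program.
Local Notation stp := (step w O p).

Definition codeat (l : nat) (c : seq instr) :=
  forall i, i < size c -> nth Halt p (l + i) = nth Halt c i.

Lemma codeat_cat l c1 c2 :
  codeat l (c1 ++ c2) -> codeat l c1 /\ codeat (l + size c1) c2.
Proof.
move=> H; split=> i Hi.
- by rewrite H ?nth_cat ?Hi // size_cat ltn_addr.
rewrite -addnA H ?size_cat ?ltn_add2l // nth_cat.
by rewrite ltnNge leq_addr /= addKn.
Qed.

Lemma codeat_cons l i c :
  codeat l (i :: c) -> nth Halt p l = i /\ codeat l.+1 c.
Proof.
move=> H; split; first by have := H 0 isT; rewrite addn0.
by move=> j Hj; rewrite addSnnS H.
Qed.

Definition sim (s : state) (t : hst) : Prop :=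
  [/\ forall x, x < tmp -> reg s x = rg t x, Defs.mem s = mm t, tape s = tp t,
      out s = ou t & reg s 0 = n %% W].

Lemma iter_comp k1 k2 s : iter (k1 + k2) stp s = iter k2 stp (iter k1 stp s).
Proof. by rewrite addnC iterD. Qed.

Lemma size_code_expr d e : size (code_expr d e) = esz e.
Proof.
by elim: e d => //= [o a IHa b IHb|id a IHa|a IHa|a IHa b IHb|a IHa|a IHa b IHb] d;
  rewrite !size_cat /= ?IHa ?IHb ?addnA -?addnA.
Qed.

Lemma size_code_cmd l c : size (code_cmd l c) = csz c.
Proof.
elim: c l => //= [x e|id a b|e|a IHa b IHb|e c IH|x y c IH] l;
  rewrite ?size_cat /= ?size_cat /= ?size_code_expr ?IH ?IHa ?IHb; lia.
Qed.

Definition eqbelow (d : nat) (s s' : state) :=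
  [/\ forall x, x < d -> reg s' x = reg s x, Defs.mem s' = Defs.mem s, tape s' = tape s
    & out s' = out s].

Lemma eqbelow_trans d d' s1 s2 s3 : d <= d' ->
  eqbelow d s1 s2 -> eqbelow d' s2 s3 -> eqbelow d s1 s3.
Proof.
move=> dd [h1 h2 h3 h4] [k1 k2 k3 k4]; split; last 3 first.
- by rewrite k2.
- by rewrite k3.
- by rewrite k4.
by move=> x xd; rewrite k1 ?h1 //; apply: leq_trans dd.
Qed.

Lemma eqbelow_sim s s' t d : tmp <= d -> eqbelow d s s' -> sim s t -> sim s' t.
Proof.
move=> dt [h1 h2 h3 h4] [k1 k2 k3 k4 k5]; split; rewrite ?h2 ?h3 ?h4 ?h1 //.
- by move=> x xd; rewrite h1 ?k1 //; apply: leq_trans dt.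
- exact: leq_trans dt.
Qed.

Definition eval_ok (d : nat) (c : seq instr) (s : state) (v : nat) :=
  let s' := iter (size c) stp s in
  [/\ pc s' = pc s + size c, reg s' d = v & eqbelow d s s'].

Lemma step_const l r h tpe o x v : nth Halt p l = Const x v ->
  stp (State l r h tpe o) = State l.+1 (upd r x (v %% W)) h tpe o.
Proof. by rewrite /step /fetch /= => ->. Qed.

Lemma step_op l r h tpe o f x y z : nth Halt p l = Op f x y z ->
  stp (State l r h tpe o) =
  State l.+1 (upd r x (eval_binop w f (r y) (r z) %% W)) h tpe o.
Proof. by rewrite /step /fetch /= => ->. Qed.

Lemma step_jz l r h tpe o x l' : nth Halt p l = Jz x l' ->
  stp (State l r h tpe o) = State (if r x == 0 then l' else l.+1) r h tpe o.
Proof. by rewrite /step /fetch /= => ->. Qed.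

Lemma code_adr_ok d id s : 0 < d -> reg s 0 = n %% W ->
  codeat (pc s) (code_adr d id) -> eval_ok d (code_adr d id) s (adr id (reg s d)).
Proof.
case: s => l r h tpe o; rewrite /= => d0 r0.
move=> /codeat_cons[e1 /codeat_cons[e2 /codeat_cons[e3 /codeat_cons[e4
       /codeat_cons[e5 /codeat_cons[e6 _]]]]]].
have d01 : (0 == d) = false by lia.
have d02 : (0 == d.+1) = false by lia.
have dd1 : (d == d.+1) = false by lia.
rewrite /eval_ok /code_adr [size _]/=.
rewrite !iterSr (step_const _ _ _ _ e1) (step_op _ _ _ _ e2).
rewrite (step_const _ _ _ _ e3) (step_op _ _ _ _ e4) (step_op _ _ _ _ e5).
rewrite (step_op _ _ _ _ e6) /=; split=> /=; first by rewrite addnC.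
- rewrite /upd !eqxx d01 d02 dd1 r0 /adr.
  rewrite !modnDmr !modnDml -!addnA -[LHS]modnDml modn_mod modnDml.
  by rewrite -addnA -[LHS]modnDml modnMmr modnDml.
split=> //= x xd; rewrite /upd.
have -> : (x == d) = false by lia.
by have -> : (x == d.+1) = false by lia.
Qed.

Lemma lor_diag x : Nat.lor x x = x.
Proof. exact: PeanoNat.Nat.lor_diag. Qed.

Lemma eval_ok_step d c1 (i : instr) s v v' :
  eval_ok d c1 s v -> codeat (pc s) (c1 ++ [:: i]) ->
  (forall s1, pc s1 = pc s + size c1 -> nth Halt p (pc s1) = i ->
     reg s1 d = v -> eqbelow d s s1 -> 
     let s2 := stp s1 in [/\ pc s2 = (pc s1).+1, reg s2 d = v' & eqbelow d s1 s2]) ->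
  eval_ok d (c1 ++ [:: i]) s v'.
Proof.
move=> [E1 E2 E3] /codeat_cat[_ /codeat_cons[Hi _]] H.
rewrite /eval_ok size_cat /= iter_comp /=.
have [|F1 F2 F3] := H _ E1 _ E2 E3; first by rewrite E1.
split=> //; first by rewrite F1 E1 addnA addn1.
exact: eqbelow_trans E3 F3.
Qed.

Lemma eval_ok_cat d d' c1 c2 s v v' :
  d <= d' ->
  codeat (pc s) (c1 ++ c2) ->
  eval_ok d c1 s v ->
  (forall s1, pc s1 = pc s + size c1 -> reg s1 d = v -> eqbelow d s s1 ->
     codeat (pc s1) c2 -> eval_ok d' c2 s1 v') ->
  let s' := iter (size (c1 ++ c2)) stp s in
  [/\ pc s' = pc s + size (c1 ++ c2), reg s' d' = v',
      (d < d' -> reg s' d = v) & eqbelow d s s'].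
Proof.
move=> dd /codeat_cat[_ H2] [E1 E2 E3] H.
rewrite size_cat iter_comp.
have [|F1 F2 F3] := H _ E1 E2 E3; first by rewrite E1.
split=> //; first by rewrite F1 E1 addnA.
- by case: F3 => F3 _ _ _ ?; rewrite F3.
- exact: eqbelow_trans E3 F3.
Qed.

Lemma ev_lt t e : okst t -> ev t e < W.
Proof.
case=> h1 h2; have W0 : 0 < W by rewrite expn_gt0.
by elim: e => //= *; rewrite ?ltn_pmod.
Qed.

Lemma code_expr_ok e d s t : tmp <= d -> ewf e -> okst t -> sim s t ->
  codeat (pc s) (code_expr d e) -> eval_ok d (code_expr d e) s (ev t e).
Proof.
move=> dt we ot; have W0 : 0 < W by rewrite expn_gt0.
have two : forall (i : instr) a b d s, tmp <= d -> ewf a -> ewf b -> sim s t ->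
  (forall d s, tmp <= d -> ewf a -> sim s t -> codeat (pc s) (code_expr d a) ->
    eval_ok d (code_expr d a) s (ev t a)) ->
  (forall d s, tmp <= d -> ewf b -> sim s t -> codeat (pc s) (code_expr d b) ->
    eval_ok d (code_expr d b) s (ev t b)) ->
  forall v, codeat (pc s) (code_expr d a ++ code_expr d.+1 b ++ [:: i]) ->
  (forall s1, nth Halt p (pc s1) = i ->
     reg s1 d = ev t a -> reg s1 d.+1 = ev t b ->
     let s2 := stp s1 in [/\ pc s2 = (pc s1).+1, reg s2 d = v & eqbelow d s1 s2]) ->
  eval_ok d (code_expr d a ++ code_expr d.+1 b ++ [:: i]) s v.
  move=> i a b {}d {}s {}dt wa wb st IHa IHb v; rewrite catA => Hc H.
  have /codeat_cat[Hc1 Hc2] := Hc; have /codeat_cat[Hca Hcb] := Hc1.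
  have [|F1 F2 F3 F4] := @eval_ok_cat d d.+1 _ _ s _ (ev t b) (leqnSn d) Hc1 (IHa d s dt wa st Hca).
    move=> s1 e1 e2 e3 e4; apply: IHb => //; first exact: leq_trans dt _.
    exact: eqbelow_sim e3 st.
  rewrite /eval_ok size_cat /= iter_comp /=.
  have [||G1 G2 G3] := H _ _ _ F2; last by
    split=> //; [rewrite G1 F1 addnA addn1 | exact: eqbelow_trans F4 G3].
  - by case/codeat_cons: Hc2 => <- _; rewrite F1.
  - exact: F3.
elim: e d s dt we => /= [x|v|o a IHa b IHb|id a IHa|a IHa|a IHa b IHb|a IHa|a IHa b IHb] d s dt we st.
- case: s st => l r h tpe o [h1 h2 h3 h4 h5] /codeat_cons[/= e1 _].
  rewrite /eval_ok /= /step /fetch /= e1 /=; split; rewrite ?addn1 //=.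
    by rewrite /upd eqxx lor_diag -h1 // modn_small // [X in X < _]h1 //; case: ot.
  by split=> //= y yd; rewrite /upd ltn_eqF.
- case: s st => l r h tpe o [h1 h2 h3 h4 h5] /codeat_cons[/= e1 _].
  rewrite /eval_ok /= /step /fetch /= e1 /=; split; rewrite ?addn1 //=.
    by rewrite /upd eqxx.
  by split=> //= y yd; rewrite /upd ltn_eqF.
- case/andP: we => wa wb; move=> Hc; apply: (two) => //.
  move=> [l r h tpe oo] /= e1 e2 e3; rewrite /step /fetch /= e1 /= /upd eqxx e2 e3.
  by split=> //; split=> //= y yd; rewrite ltn_eqF.
- move=> Hc; apply: (@eval_ok_step d _ _ s (adr id (ev t a)) _ _ Hc); last first.
    move=> [l r h tpe oo] /= _ e1 <- [_ e2 _ _]; rewrite /step /fetch /= e1 /= /upd eqxx.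
    split=> //; last by split=> //= y yd; rewrite ltn_eqF.
    rewrite modn_small; first by case: st => _ <- _ _ _; rewrite -e2.
    by case: ot => _; case: st => _ <- _ _ _; rewrite -e2; apply.
  have /codeat_cat[Hc1 Hc2] := Hc; have /codeat_cat[Hca Hcb] := Hc1.
  case: (@eval_ok_cat d d _ _ s _ (adr id (ev t a)) (leqnn d) Hc1 (IHa d s dt we st Hca)).
    move=> s1 e1 e2 e3 e4; rewrite -e2; apply: code_adr_ok => //.
      exact: leq_trans dt.
    by have [] := eqbelow_sim dt e3 st.
  by move=> F1 F2 _ F4.
- move=> Hc; apply: (@eval_ok_step d _ _ s (ev t a) _ _ Hc); last first.
    move=> [l r h tpe oo] /= _ e1 <- [_ e2 _ _]; rewrite /step /fetch /= e1 /= /upd eqxx.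
    split=> //; last by split=> //= y yd; rewrite ltn_eqF.
    rewrite modn_small; first by case: st => _ <- _ _ _; rewrite -e2.
    by case: ot => _; case: st => _ <- _ _ _; rewrite -e2; apply.
  by apply: IHa => //; case/codeat_cat: Hc.
- case/andP: we => wa wb; move=> Hc; apply: (two) => //.
  move=> [l r h tpe oo] /= e1 e2 e3; rewrite /step /fetch /= e1 /= /upd eqxx e2 e3.
  by split=> //; split=> //= y yd; rewrite ltn_eqF.
- move=> Hc; apply: (@eval_ok_step d _ _ s (ev t a) _ _ Hc); last first.
    move=> [l r h tpe oo] /= _ e1 <- _; rewrite /step /fetch /= e1 /= /upd eqxx.
    by split=> //; last by split=> //= y yd; rewrite ltn_eqF.
  by apply: IHa => //; case/codeat_cat: Hc.
- case/andP: we => wa wb; move=> Hc; apply: (two) => //.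
  move=> [l r h tpe oo] /= e1 e2 e3; rewrite /step /fetch /= e1 /= /upd eqxx e2 e3.
  by split=> //; split=> //= y yd; rewrite ltn_eqF.
Qed.

Lemma iter_for x y c t k : cwf (For x y c) ->
  let t' := iter k (fun s => let s' := den c s in
                     setr s' x (rg s' x).+1 4) (setr t x 0 2) in
  rg t' x = k /\ rg t' y = rg t y.
Proof.
case/and5P=> x0 xt yt /negbTE yx /and3P[xc yc wc].
elim: k => [|k [IH1 IH2]] /=; first by rewrite /upd eqxx yx.
by rewrite /upd eqxx yx !den_rg // IH1 IH2.
Qed.

Lemma okst_setr s x v k : okst s -> v < W -> okst (setr s x v k).
Proof. by case=> h1 h2 vW; split=> //= z; rewrite /upd; case: ifP. Qed.

Lemma den_ok c s : cwf c -> okst s -> okst (den c s).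
Proof.
have W0 : 0 < W by rewrite expn_gt0.
elim: c s => //= [x e|id a b|x|a IHa b IHb|e c IH|x y c IH] s.
- by move=> _ os; apply: okst_setr => //; apply: ev_lt.
- move=> _ [h1 h2]; split=> //= z; rewrite /upd; case: ifP => // _.
  exact: ev_lt.
- by move=> _ [h1 h2]; split=> //= z; rewrite /upd; case: ifP => // _; rewrite ltn_pmod.
- by case/andP=> wa wb os; apply: IHb => //; apply: IHa.
- by case/andP=> we wc [h1 h2]; case: ifP => _ //; apply: IH.
move=> wf os; have /and5P[_ _ _ _ /and3P[_ _ wc]] := wf.
have : rg s y <= rg s y by [].
move: {1 3}(rg s y) => N; elim: N => [_|k IHk kN] /=; first exact: okst_setr.
have {}IHk := IHk (ltnW kN).
apply: okst_setr; first exact: IH.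
have [E _] := iter_for s k wf; rewrite den_rg ?E; last by case/and5P: wf => _ _ _ _ /and3P[].
by case: os => h _; apply: leq_ltn_trans kN (h y).
Qed.

Lemma code_cmd_ok c s t : cwf c -> okst t -> sim s t ->
  codeat (pc s) (code_cmd (pc s) c) ->
  exists k, [/\ ck (den c t) = ck t + k, sim (iter k stp s) (den c t)
             & pc (iter k stp s) = pc s + csz c].
Proof.
elim: c s t => //= [|x e|id a b|x|e|a IHa b IHb|e c IH|x y c IH] s t.
- by move=> _ _ st _; exists 0; rewrite !addn0.
- case/and3P=> x0 xt we ot st Hc; have /codeat_cat[H1 /codeat_cons[H2 _]] := Hc.
  have [E1 E2 E3] := code_expr_ok (leqnn _) we ot st H1.
  have st' := eqbelow_sim (leqnn _) E3 st.
  exists (esz e + 1); rewrite iter_comp -(size_code_expr tmp e).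
  case: (iter _ stp s) E1 E2 st' => l r h tpe o /= -> E2 [h1 h2 h3 h4 h5].
  rewrite (step_op _ _ _ _ H2) /=; split; [by [] | | lia].
  split=> //=; last by rewrite /upd ltn_eqF.
  move=> z zt; rewrite /upd; case: eqP => // _; last exact: h1.
  by rewrite E2 lor_diag modn_small // ev_lt.
- case/and3P=> idt wa wb ot st Hc.
  have /codeat_cat[H1 H2] := Hc; have /codeat_cat[Ha _] := H1.
  have /codeat_cat[Hb /codeat_cons[Hw _]] := H2.
  have t0 : 0 < tmp by [].
  case: (@eval_ok_cat tmp tmp _ _ s _ (adr id (ev t a)) (leqnn tmp) H1
          (code_expr_ok (leqnn _) wa ot st Ha)).
    move=> s1 e1 e2 e3 e4; rewrite -e2; apply: code_adr_ok => //.
    by have [] := eqbelow_sim (leqnn _) e3 st.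
  rewrite size_cat size_code_expr -[size (code_adr _ _)]/6.
  set s1 := iter _ _ _ => P1 P2 _ P3.
  have st1 := eqbelow_sim (leqnn _) P3 st.
  have [|Q1 Q2 Q3] := code_expr_ok (leqnSn _) wb ot st1.
    by rewrite P1; move: Hb; rewrite size_cat size_code_expr.
  have st2 := eqbelow_sim (leqnSn _) Q3 st1.
  exists (esz a + 6 + (esz b + 1)); rewrite iter_comp -/s1 iter_comp.
  split; [by rewrite /= ; lia| |]; move: Q1 Q2 Q3 st2; rewrite size_code_expr /=;
    case: (iter (esz b) stp s1) => l r h tpe o /= Q1 Q2 [Q3 _ _ _] st2;
    have {}Q3 := Q3 tmp (leqnn _); rewrite /= P2 in Q3;
    (rewrite /step /fetch /= (_ : nth Halt p l = WriteMem tmp tmp.+1); last by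
      rewrite Q1 P1 -Hw; congr nth; rewrite size_cat !size_code_expr /=; lia).
  + by case: st2 => [h1 h2 h3 h4 h5]; split=> //=; rewrite Q2 Q3 -h2.
  + by rewrite /= Q1 P1; lia.
- case/andP=> x0 xt _ ; case: s => l r h tpe o [h1 h2 h3 h4 h5] /codeat_cons[/= H _].
  exists 1; rewrite /= /step /fetch /= H; split; rewrite ?addn1 //=.
  split=> //=; rewrite -?h3 //; last by rewrite /upd ltn_eqF.
  by move=> z zt; rewrite /upd; case: eqP => // _; apply: h1.
- move=> we ot st Hc; have /codeat_cat[H1 /codeat_cons[H2 _]] := Hc.
  have [E1 E2 E3] := code_expr_ok (leqnn _) we ot st H1.
  have st' := eqbelow_sim (leqnn _) E3 st.
  exists (esz e + 1); rewrite iter_comp -(size_code_expr tmp e).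
  case: (iter _ stp s) E1 E2 st' => l r h tpe o /= E1 E2 [h1 h2 h3 h4 h5].
  rewrite -E1 in H2.
  by rewrite /step /fetch /= H2 E1 E2; split; [by [] | split=> //=; rewrite -h4 | rewrite addn1 addnS].
- case/andP=> wa wb ot st /codeat_cat[Ha]; rewrite size_code_cmd => Hb.
  have [k1 [C1 S1 P1]] := IHa s t wa ot st Ha.
  have [|k2 [C2 S2 P2]] := IHb _ _ wb (den_ok wa ot) S1; first by rewrite P1.
  by exists (k1 + k2); rewrite iter_comp C2 C1 P2 P1 !addnA.
- case/andP=> we wc ot st Hc; have /codeat_cat[H1 /codeat_cons[H2 H3]] := Hc.
  have [E1 E2 E3] := code_expr_ok (leqnn _) we ot st H1.
  have st' := eqbelow_sim (leqnn _) E3 st.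
  rewrite size_code_expr in E1 E2 E3 H2 H3 st'.
  have E4 : iter (esz e + 1) stp s = 
    let s1 := iter (esz e) stp s in State (if ev t e == 0 then pc s + esz e + 1 + csz c
      else pc s + esz e + 1) (reg s1) (Defs.mem s1) (tape s1) (out s1).
    rewrite iter_comp /=; case: (iter _ _ _) E1 E2 => l r h tpe o /= -> E2.
    by rewrite (step_jz _ _ _ _ H2) E2 addn1.
  case: ifP E4 => _ E4.
    exists (esz e + 1); rewrite E4 /=; split=> //.
    lia.
  have [||k [C1 S1 P1]] := IH (iter (esz e + 1) stp s) (tick t (esz e + 1)) wc ot.
  + by rewrite E4; case: st' => *; split.
  + by rewrite E4 /=; move: H3; rewrite addn1.
  exists (esz e + 1 + k); rewrite iter_comp C1 P1; split=> //; first by rewrite /= -!addnA.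
  by rewrite E4 /= !addnA.
move=> wf ot st Hc; have /and5P[x0 xt yt yx /and3P[xc yc wc]] := wf.
have /codeat_cons[Hx /codeat_cons[Hj Hc']] := Hc.
have /codeat_cat[Hb] := Hc'; rewrite size_code_cmd.
case/codeat_cons=> G1 /codeat_cons[G2 /codeat_cons[G3 /codeat_cons[G4 _]]].
pose F t1 := setr (den c t1) x (rg (den c t1) x).+1 4; rewrite -/F; set t0 := setr t x 0 2.
have y0 : rg t0 y = rg t y by rewrite /= /upd (negbTE yx).
have ryt : reg s y = rg t y by case: st => h *; apply: h.
have st0 : let s0 := iter 2 stp s in sim s0 t0 /\
    pc s0 = if rg t y == 0 then pc s + csz c + 6 else pc s + 2.
  case: s st ryt Hx Hj {Hc Hb Hc' G1 G2 G3 G4} => l r h tpe o [h1 h2 h3 h4 h5] /= ryt Hx Hj.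
  rewrite (step_const _ _ _ _ Hx) (step_jz _ _ _ _ Hj) /=; split.
    split=> //=; last by rewrite /upd ltn_eqF.
    move=> z zt; rewrite /upd mod0n; case: eqP => // _; exact: h1.
  by rewrite /upd (negbTE yx) ryt addn2.
case: st0 => st0 ps0.
have [N0|N0] := eqVneq (rg t y) 0.
  by exists 2; rewrite N0 /= in ps0 *; split=> //; rewrite ps0 addnA.
have loop : forall j, j < rg t y -> exists k,
    [/\ ck (iter j.+1 F t0) = ck t0 + k, sim (iter k stp (iter 2 stp s)) (iter j.+1 F t0)
     & pc (iter k stp (iter 2 stp s)) =
       if j.+1 == rg t y then pc s + csz c + 6 else pc s + 2].
  have body : forall j s1, j < rg t y -> sim s1 (iter j F t0) -> pc s1 = pc s + 2 ->
     exists k, [/\ ck (iter j.+1 F t0) = ck (iter j F t0) + k,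
        sim (iter k stp s1) (iter j.+1 F t0)
      & pc (iter k stp s1) = if j.+1 == rg t y then pc s + csz c + 6 else pc s + 2].
    move=> j s1 jN S1 P1.
    have oj : okst (iter j F t0).
      elim: j {S1} jN => [|j IHj] jN; first by apply: okst_setr => //; rewrite expn_gt0.
      have [E _] := iter_for t j wf; rewrite /= /F.
      apply: okst_setr; first by apply: den_ok => //; apply: IHj; apply: ltnW.
      by rewrite den_rg // E; apply: ltn_trans jN _; case: ot.
    have [|k [C1 S2 P2]] := IH s1 _ wc oj S1.
      by rewrite P1 addn2; move: Hb; rewrite addn2.
    have [Ex Ey] := iter_for t j wf; rewrite -/F -/t0 in Ex Ey.
    have jW : j.+1 < W by apply: leq_ltn_trans jN _; case: ot.
    exists (k + 4); rewrite iter_comp.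
    case: (iter k stp s1) S2 P2 => l r h tpe o [/= h1 h2 h3 h4 h5]; rewrite P1 => P2.
    have {}G1 : nth Halt p l = Const tmp 1 by rewrite -G1 P2; congr nth; lia.
    have {}G2 : nth Halt p l.+1 = Op OpAdd x x tmp by rewrite -G2 P2; congr nth; lia.
    have {}G3 : nth Halt p l.+2 = Op OpEq tmp x y by rewrite -G3 P2; congr nth; lia.
    have {}G4 : nth Halt p l.+3 = Jz tmp (pc s + 2) by rewrite -G4 P2; congr nth; lia.
    rewrite (step_const _ _ _ _ G1) (step_op _ _ _ _ G2) (step_op _ _ _ _ G3).
    rewrite (step_jz _ _ _ _ G4) /=.
    have tx : (tmp == x) = false by rewrite gtn_eqF.
    have ty : (y == tmp) = false by rewrite ltn_eqF.
    have W1 : 1 < W by apply: leq_ltn_trans jW.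
    have rx : r x = j by rewrite h1 // den_rg.
    have ry : r y = rg t y by rewrite h1 // den_rg // Ey.
    split.
    + by rewrite C1; lia.
    + split=> //=; last by rewrite /upd; case: eqP => // _; rewrite !ltn_eqF.
      move=> z zt; rewrite /upd eqxx (ltn_eqF zt) [x == tmp]eq_sym tx den_rg // Ex.
      by rewrite rx (modn_small W1) addn1 modn_small //; case: eqP => // _; exact: h1.
    + rewrite /upd ?eqxx ?(ltn_eqF xt) ?tx ?ty ?(negbTE yx) ?eqxx ?ty /= rx ry.
      rewrite (modn_small W1) addn1 (modn_small jW).
      have := (modn_small W1); case: (j.+1 == rg t y) => /= H; first by rewrite H /= P2; lia.
      by rewrite mod0n.
  elim=> [|j IHj] jN.
    have [|k [K1 K2 K3]] := body 0 _ jN st0; first by rewrite ps0 (negbTE N0).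
    by exists k.
  have [k [K1 K2 K3]] := IHj (ltnW jN).
  have [|k' [L1 L2 L3]] := body j.+1 _ jN K2; first by rewrite K3 ltn_eqF.
  by exists (k + k'); rewrite L1 K1 iter_comp addnA.
have [|k [K1 K2 K3]] := loop (rg t y).-1; first by rewrite ltn_predL lt0n.
rewrite prednK ?lt0n // in K1 K2 K3.
exists (2 + k); rewrite iter_comp K1 K3 eqxx; split=> //=; lia.
Qed.
End Exec.
End Semantics.

(** * Radix-two transforms over an arbitrary ring *)

Definition bside (h i : nat) : bool := odd (i %/ h).
Definition bnode (h i : nat) : nat := i %/ h.*2.
Definition bi0 (h i : nat) : nat := i - bside h i * h.

Lemma bnode_lt h i k : i < k -> bnode h i < k.
Proof. exact: leq_ltn_trans (leq_div _ _). Qed.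

Lemma bnodeE h i : bnode h i = (i %/ h)./2.
Proof. by rewrite /bnode -muln2 divnMA divn2. Qed.

Lemma bside_node h v (s : bool) q : q < h ->
  let i := v * h.*2 + s * h + q in
  [/\ bside h i = s, bnode h i = v & bi0 h i = v * h.*2 + q].
Proof.
move=> qh /=; have h0 : 0 < h by apply: leq_ltn_trans qh.
have E : (v * h.*2 + s * h + q) %/ h = v.*2 + s.
  have -> : v * h.*2 + s * h + q = (v.*2 + s) * h + q by lia.
  by rewrite divnMDl // divn_small // addn0.
have S : bside h (v * h.*2 + s * h + q) = s.
  by rewrite /bside E oddD odd_double; case: (s).
split=> //; last by rewrite /bi0 S; lia.
by rewrite bnodeE E; case: (s) => /=; lia.
Qed.

Lemma bnode_decomp h i : i = bnode h i * h.*2 + bside h i * h + i %% h.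
Proof.
rewrite {1}(divn_eq i h) bnodeE /bside -{1}(odd_double_half (i %/ h)).
by rewrite mulnDl addnAC addnC -!muln2; lia.
Qed.

Lemma bi0_decomp h i : 0 < h -> bi0 h i = bnode h i * h.*2 + i %% h.
Proof.
move=> h0; have [_ _ ] := bside_node (bnode h i) (bside h i) (ltn_pmod i h0).
by rewrite -bnode_decomp.
Qed.

(* Iterates of [fwd] double the number of nodes: before the step with half
   size [h] the node [v] holds a polynomial modulo ['X^(2h) - u v ^+ 2] in the
   cells [2hv, 2h(v+1)), afterwards its residues modulo ['X^h - u v] and
   ['X^h + u v]. *)
Section Transform.
Local Open Scope ring_scope.
Variables (C : comNzRingType) (u ub : nat -> C).
Hypothesis u0 : u 0%N = 1.
Hypothesis usq : forall v (s : bool), u (v.*2 + s)%N ^+ 2 = (-1) ^+ s * u v.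
Hypothesis uub : forall v, u v * ub v = 1.

Definition fwd (h : nat) (x : nat -> C) (i : nat) : C :=
  x (bi0 h i) + (-1) ^+ bside h i * (u (bnode h i) * x (bi0 h i + h)%N).
Definition bwd (h : nat) (x : nat -> C) (i : nat) : C :=
  if bside h i then ub (bnode h i) * (x (bi0 h i) - x (bi0 h i + h)%N)
  else x (bi0 h i) + x (bi0 h i + h)%N.

Lemma bwd_fwd h x i : (0 < h)%N -> bwd h (fwd h x) i = x i *+ 2.
Proof.
move=> h0; have qh := ltn_pmod i h0.
rewrite [in RHS](bnode_decomp h i) /bwd bi0_decomp //.
set v := bnode h i; set q := (i %% h)%N in qh *.
have [] := bside_node v false qh; rewrite mul0n addn0 => s1 n1 i1.
have [] := bside_node v true qh; rewrite mul1n => s2 n2 i2.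
rewrite addnAC in s2 n2 i2.
rewrite /fwd s1 n1 i1 s2 n2 i2 expr0 expr1 mul1r mulN1r.
case: (bside h i); rewrite ?mul1n ?mul0n ?addn0; last by rewrite addrACA subrr addr0 mulr2n.
rewrite opprD opprK addrACA subrr add0r -mulr2n mulrnAr mulrA [ub v * _]mulrC uub mul1r.
by rewrite addnAC.
Qed.

Fixpoint fwds (l k : nat) (x : nat -> C) : nat -> C :=
  if k is k'.+1 then fwd (2 ^ (l - k)) (fwds l k' x) else x.
Fixpoint bwds (k : nat) (x : nat -> C) : nat -> C :=
  if k is k'.+1 then bwd (2 ^ k') (bwds k' x) else x.

Lemma bwd_scale h x y c i : (forall j, x j = c * y j) -> bwd h x i = c * bwd h y i.
Proof.
by move=> E; rewrite /bwd !E; case: ifP => _; rewrite -?mulrBr -?mulrDr // mulrCA.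
Qed.

Lemma bwds_fwds l x k i : (k <= l)%N ->
  bwds k (fwds l l x) i = (2 ^+ k) * fwds l (l - k) x i.
Proof.
elim: k i => [|k IH] i kl; first by rewrite subn0 expr0 mul1r.
rewrite /= (bwd_scale _ _ (fun j => IH j (ltnW kl))).
have -> : (l - k = (l - k.+1).+1)%N by lia.
rewrite /= (_ : l - (l - k.+1).+1 = k)%N; last by lia.
by rewrite bwd_fwd ?expn_gt0 // exprSr -mulrA mulr_natl.
Qed.

Lemma bi0_lt l h i : (i < 2 ^ l)%N -> (h.*2 %| 2 ^ l)%N -> (0 < h)%N ->
  (bi0 h i + h < 2 ^ l)%N.
Proof.
move=> il hd h0; have qh := ltn_pmod i h0.
have vl : (bnode h i < 2 ^ l %/ h.*2)%N by rewrite ltn_divRL // mulnC /bnode mulnC (leq_ltn_trans (leq_trunc_div _ _)).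
rewrite bi0_decomp // -(divnK hd).
by apply: leq_trans (_ : (bnode h i).+1 * h.*2 <= _)%N; [lia | rewrite leq_mul2r vl orbT].
Qed.

Lemma pow2_half l k : (k < l)%N -> ((2 ^ k).*2 %| 2 ^ l)%N.
Proof. by move=> kl; rewrite -mul2n -expnS dvdn_exp2l. Qed.

Lemma bwds_ext l x y k i : (k <= l)%N -> (forall j, (j < 2 ^ l)%N -> x j = y j) ->
  (i < 2 ^ l)%N -> bwds k x i = bwds k y i.
Proof.
move=> kl E; elim: k i kl => [|k IH] i kl il; first exact: E.
have H0 := bi0_lt il (pow2_half kl) (_ : 0 < 2 ^ k)%N; rewrite /= /bwd.
have H : (bi0 (2 ^ k) i + 2 ^ k < 2 ^ l)%N by apply: H0; rewrite expn_gt0.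
by rewrite !(IH _ (ltnW kl)) // (leq_ltn_trans _ H) // leq_addr.
Qed.

Definition leaf (v : nat) : C := (-1) ^+ odd v * u v./2.

Lemma leaf_pow v j : leaf v ^+ (2 ^ j) = (-1) ^+ odd (v %/ 2 ^ j) * u ((v %/ 2 ^ j)./2).
Proof.
elim: j => [|j IH]; first by rewrite expn0 divn1 expr1.
rewrite expnSr exprM IH exprMn sqrr_sign mul1r divnMA divn2.
set a := (v %/ 2 ^ j)./2.
by rewrite -{1}(odd_double_half a) addnC usq.
Qed.

Lemma leaf_pow1 l v : (v < 2 ^ l)%N -> leaf v ^+ (2 ^ l) = 1.
Proof. by move=> vl; rewrite leaf_pow divn_small //= u0 expr0 mulr1. Qed.

Lemma sum_double h (g : nat -> C) :
  \sum_(q < h.*2) g q = \sum_(q < h) (g q + g (q + h)%N).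
Proof.
rewrite big_split /= -addnn big_split_ord /=; congr (_ + _).
by apply: eq_bigr => i _; rewrite addnC.
Qed.

Lemma fwd_eval h x v (s : bool) (y : C) : y ^+ h = (-1) ^+ s * u v ->
  \sum_(q < h) fwd h x (v * h.*2 + s * h + q)%N * y ^+ q =
  \sum_(q < h.*2) x (v * h.*2 + q)%N * y ^+ q.
Proof.
move=> yh; rewrite (sum_double h (fun q => x (v * h.*2 + q)%N * y ^+ q)).
apply: eq_bigr => q _; have [E1 E2 E3] := bside_node v s (ltn_ord q).
rewrite /fwd E1 E2 E3 mulrDl exprD yh addnA; congr (_ + _).
by ring.
Qed.

Lemma fwds_eval l x v k : (v < 2 ^ l)%N -> (k <= l)%N ->
  \sum_(q < 2 ^ (l - k)) fwds l k x (v %/ 2 ^ (l - k) * 2 ^ (l - k) + q)%N * leaf v ^+ q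
  = \sum_(q < 2 ^ l) x q * leaf v ^+ q.
Proof.
move=> vl; elim: k => [|k IH] kl.
  by rewrite subn0 divn_small // mul0n.
rewrite -IH ?(ltnW kl) // {IH}.
move Ej : (l - k.+1)%N => j; rewrite (_ : l - k = j.+1)%N; last by lia.
have -> : (2 ^ j.+1 = (2 ^ j).*2)%N by rewrite expnS mul2n.
have -> : (v %/ (2 ^ j).*2 = (v %/ 2 ^ j)./2)%N by rewrite -muln2 divnMA divn2.
have E : (v %/ 2 ^ j * 2 ^ j
    = (v %/ 2 ^ j)./2 * (2 ^ j).*2 + odd (v %/ 2 ^ j) * 2 ^ j)%N.
  by rewrite -{1}(odd_double_half (v %/ 2 ^ j)) mulnDl addnC -!muln2; lia.
rewrite E -(fwd_eval _ (leaf_pow v j)) /= Ej.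
by [].
Qed.

Lemma fwds_leaf l x v : (v < 2 ^ l)%N ->
  fwds l l x v = \sum_(q < 2 ^ l) x q * leaf v ^+ q.
Proof.
move=> vl; rewrite -(fwds_eval x vl (leqnn l)) subnn expn0 divn1 muln1.
by rewrite big_ord1 expr0 mulr1 addn0.
Qed.

Definition cconv (l : nat) (x y : nat -> C) (e : nat) : C :=
  \sum_(p < 2 ^ l) \sum_(q < 2 ^ l | ((p + q) %% 2 ^ l == e)%N) x p * y q.

Lemma fwds_cconv l x y v : (v < 2 ^ l)%N ->
  fwds l l x v * fwds l l y v = fwds l l (cconv l x y) v.
Proof.
move=> vl; rewrite !fwds_leaf //; set z := leaf v.
rewrite /cconv; under [RHS]eq_bigr => e _ do rewrite mulr_suml.
rewrite exchange_big mulr_suml; apply: eq_bigr => p _ /=.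
under [RHS]eq_bigr => e _ do rewrite mulr_suml big_mkcond.
rewrite exchange_big mulr_sumr; apply: eq_bigr => q _ /=.
have N0 : (0 < 2 ^ l)%N by rewrite expn_gt0.
rewrite -big_mkcond /= (bigD1 (Ordinal (ltn_pmod (p + q) N0))) //= big1 ?addr0.
  suff -> : z ^+ ((p + q) %% 2 ^ l) = z ^+ (p + q) by rewrite exprD; ring.
  rewrite {2}(divn_eq (p + q) (2 ^ l)) exprD mulnC exprM.
  by rewrite leaf_pow1 // expr1n mul1r.
by move=> e /andP[/eqP E /eqP]; case; apply: val_inj.
Qed.

Lemma conv_transform l x y e : (e < 2 ^ l)%N ->
  bwds l (fun v => fwds l l x v * fwds l l y v) e = 2 ^+ l * cconv l x y e.
Proof.
move=> el; rewrite (bwds_ext (leqnn l) (fun j H => fwds_cconv x y H) el).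
by rewrite bwds_fwds // subnn.
Qed.
End Transform.

(** * Fixed point arithmetic *)

Local Open Scope ring_scope.

Section ExactRoots.
Variable R : rcfType.
Local Notation C := R[i].

Fixpoint zeta_cs (j : nat) : R * R :=
  if j is j'.+1 then
    let: (c, s) := zeta_cs j' in
    let c' := Num.sqrt ((1 + c) / 2) in (c', s / (2 * c'))
  else (0, 1).
Definition zeta (j : nat) : C := let: (c, s) := zeta_cs j in Complex c s.

Lemma zeta_csS j : zeta_cs j.+1 =
  (Num.sqrt ((1 + (zeta_cs j).1) / 2),
   (zeta_cs j).2 / (2 * Num.sqrt ((1 + (zeta_cs j).1) / 2))).
Proof. by rewrite /=; case: (zeta_cs j). Qed.

Lemma zeta_csP j : let: (c, s) := zeta_cs j in
  [/\ 0 <= c, 0 <= s & c ^+ 2 + s ^+ 2 = 1].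
Proof.
elim: j => [|j]; first by split; rewrite /= ?lexx ?ler01 // expr0n expr1n add0r.
rewrite zeta_csS; case: (zeta_cs j) => c s /= [c0 s0 cs1].
set g := Num.sqrt _; have g2 : g ^+ 2 = (1 + c) / 2 by rewrite sqr_sqrtr //; lra.
have g0 : 0 < g by rewrite sqrtr_gt0; lra.
split; [exact: ltW | by rewrite divr_ge0 // mulr_ge0 // ltW |].
rewrite expr_div_n exprMn g2 (_ : s ^+ 2 = (1 - c) * (1 + c)); last by nra.
by field; lra.
Qed.

Lemma zeta0 : zeta 0 ^+ 2 = -1.
Proof. by rewrite /zeta /= expr2; simpc. Qed.

Lemma zetaS j : zeta j.+1 ^+ 2 = zeta j.
Proof.
have := zeta_csP j; rewrite /zeta zeta_csS; case: (zeta_cs j) => c s /= [c0 s0 cs1].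
set g := Num.sqrt _; have g2 : g ^+ 2 = (1 + c) / 2 by rewrite sqr_sqrtr //; lra.
have g0 : 0 < g by rewrite sqrtr_gt0; lra.
rewrite expr2; simpc; congr Complex; last by field; lra.
rewrite -expr2 g2 -expr2 expr_div_n exprMn g2 (_ : s ^+ 2 = (1 - c) * (1 + c)); last by nra.
by field; lra.
Qed.

Lemma zeta_conj j : zeta j * (zeta j)^*%C = 1.
Proof.
have := zeta_csP j; rewrite /zeta; case: (zeta_cs j) => c s /= [_ _ cs1].
by simpc; congr Complex; [rewrite -!expr2 | ring].
Qed.

(* The angle of [uroot v] is pi times the binary fraction whose digits are
   those of [v] read from the lowest one. *)
Definition uroot (v : nat) : C := \prod_(j < v) zeta j ^+ odd (v %/ 2 ^ j).

Lemma uroot_widen v L : (v < 2 ^ L)%N ->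
  uroot v = \prod_(j < L) zeta j ^+ odd (v %/ 2 ^ j).
Proof.
have aux K L' : (K <= L')%N -> (v < 2 ^ K)%N ->
   \prod_(j < L') zeta j ^+ odd (v %/ 2 ^ j) = \prod_(j < K) zeta j ^+ odd (v %/ 2 ^ j).
  move=> KL vK; rewrite -(subnKC KL) big_split_ord /= [X in _ * X]big1 ?mulr1 //.
  move=> j _; rewrite divn_small //; apply: leq_trans vK _.
  by rewrite leq_exp2l // leq_addr.
move=> vL; rewrite /uroot; case: (leqP v L) => H; first by rewrite (aux v L) // ltn_expl.
by rewrite (aux L v) // ltnW.
Qed.

Lemma uroot0 : uroot 0 = 1.
Proof. by rewrite /uroot big_ord0. Qed.

Lemma uroot_double v (s : bool) : uroot (v.*2 + s) ^+ 2 = (-1) ^+ s * uroot v.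
Proof.
have vL : (v < 2 ^ v)%N by rewrite ltn_expl.
rewrite (@uroot_widen _ v.+1); last by rewrite expnS; case: (s); lia.
rewrite (uroot_widen vL) big_ord_recl /= expn0 divn1 oddD odd_double /=.
rewrite exprMn -exprM mulnC exprM zeta0; congr (_ * _); first by case: (s).
rewrite -prodrXl; apply: eq_bigr => j _.
rewrite -exprM mulnC exprM /bump /= add1n zetaS expnS divnMA divn2.
by congr (_ ^+ (odd (_ %/ _))); case: (s); lia.
Qed.

Lemma uroot_conj v : uroot v * (uroot v)^*%C = 1.
Proof.
rewrite /uroot rmorph_prod -big_split /= big1 // => j _.
by rewrite rmorphXn -exprMn zeta_conj expr1n.
Qed.

Lemma uroot_top v j : (v < 2 ^ j)%N -> uroot (2 ^ j + v) = uroot v * zeta j.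
Proof.
move=> vj; rewrite (@uroot_widen _ j.+1); last by rewrite expnS; lia.
rewrite big_ord_recr /= (uroot_widen vj); congr (_ * _); last first.
  by rewrite divnDl // divnn expn_gt0 divn_small.
apply: eq_bigr => i _; congr (_ ^+ nat_of_bool _).
have ij : (i < j)%N by [].
rewrite divnDl ?dvdn_exp2l ?(ltnW ij) // oddD.
have -> : (2 ^ j %/ 2 ^ i = (2 ^ (j - i.+1)).*2)%N.
  by rewrite -expnB ?(ltnW ij) // -mul2n -expnS; congr (2 ^ _)%N; lia.
by rewrite odd_double.
Qed.
End ExactRoots.

Definition zpair := (int * int)%type.
Definition padd (a b : zpair) : zpair := (a.1 + b.1, a.2 + b.2).
Definition psub (a b : zpair) : zpair := (a.1 - b.1, a.2 - b.2).
Definition pconj (a : zpair) : zpair := (a.1, - a.2).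
(* [X] is the scale of the fixed point representation; rounding is downwards. *)
Definition rnd (X : nat) (z : int) : int := (z %/ X%:Z)%Z.
Definition pmul (X : nat) (a b : zpair) : zpair :=
  (rnd X (a.1 * b.1 - a.2 * b.2), rnd X (a.1 * b.2 + a.2 * b.1)).

Section Approximation.
Variable R : rcfType.
Local Notation C := R[i].
Variable X : nat.
Hypothesis X0 : (0 < X)%N.
Local Notation XR := (X%:R : R).
Local Notation Re := (@complex.Re R).
Local Notation Im := (@complex.Im R).

Definition near (e : R) (a : zpair) (z : C) : Prop :=
  `|a.1%:~R - XR * Re z| <= e /\ `|a.2%:~R - XR * Im z| <= e.
Definition bounded (b : R) (z : C) : Prop := `|Re z| <= b /\ `|Im z| <= b.
Definition small (b : R) (a : zpair) : Prop :=
  `|a.1%:~R : R| <= XR * b /\ `|a.2%:~R : R| <= XR * b.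

Lemma XR_gt0 : 0 < XR. Proof. by rewrite ltr0n. Qed.

Lemma near_small e b a z : near e a z -> bounded b z -> e <= XR -> small (b + 1) a.
Proof.
case: z => x y [h1 h2] [/= k1 k2] eX; have := XR_gt0.
have aux (u v : R) : `|u - XR * v| <= e -> `|v| <= b -> `|u| <= XR * (b + 1).
  rewrite !ler_norml => /andP[? ?] /andP[? ?]; have := XR_gt0 => ?.
  by apply/andP; split; nra.
by move=> ?; split; apply: aux; eauto.
Qed.

Lemma near_le e e' a z : near e a z -> e <= e' -> near e' a z.
Proof. by case=> h1 h2 ee; split; apply: le_trans ee. Qed.

Lemma near_add e1 e2 a b x y : near e1 a x -> near e2 b y ->
  near (e1 + e2) (padd a b) (x + y).
Proof.
case: x y => [x1 x2] [y1 y2] [/= h1 h2] [/= k1 k2].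
have aux (u v x y : R) : `|u - XR * x| <= e1 -> `|v - XR * y| <= e2 ->
    `|u + v - XR * (x + y)| <= e1 + e2.
  by rewrite !ler_norml => /andP[? ?] /andP[? ?]; apply/andP; split; nra.
by split; rewrite /= intrD; apply: aux.
Qed.

Lemma near_opp e a x : near e a x -> near e (- a.1, - a.2) (- x).
Proof.
case: x => [x1 x2] [/= h1 h2].
by split; rewrite /= intrN mulrN -opprD normrN.
Qed.

Lemma near_sub e1 e2 a b x y : near e1 a x -> near e2 b y ->
  near (e1 + e2) (psub a b) (x - y).
Proof. by move=> h1 h2; apply: (near_add h1 (near_opp h2)). Qed.

Lemma near_conj e a z : near e a z -> near e (pconj a) z^*%C.
Proof.
case: z => [x y] [/= h1 h2]; split=> //=.
by rewrite intrN mulrN -opprD normrN.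
Qed.

Lemma rnd_bounds (z : int) :
  XR * (rnd X z)%:~R <= z%:~R :> R /\ z%:~R < XR * (rnd X z)%:~R + XR :> R.
Proof.
have XZ : X%:Z != 0 by rewrite -lt0n.
have Xp : (0 : int) < X%:Z by rewrite ltz_nat.
have E := divz_eq z X; have h1 := modz_ge0 z XZ; have h2 := ltz_pmod z Xp.
rewrite /rnd; set q := (z %/ X)%Z in E *; set r := (z %% X)%Z in E h1 h2.
have -> : XR = X%:Z%:~R by [].
by rewrite -intrM -intrD ler_int ltr_int E; split; lia.
Qed.

Lemma near_mul e1 e2 b1 b2 a b x y : 0 <= b1 -> 0 <= b2 -> 0 <= e1 -> 0 <= e2 ->
  near e1 a x -> near e2 b y -> bounded b1 x -> small b2 b ->
  near (2 * (e1 * b2 + b1 * e2) + 1) (pmul X a b) (x * y).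
Proof.
case: x y => [x1 x2] [y1 y2] p1 p2 p3 p4 [/= h1 h2] [/= k1 k2] [/= f1 f2] [/= g1 g2].
have Xp := XR_gt0.
have one (u v x y : R) : `|u - XR * x| <= e1 -> `|v - XR * y| <= e2 -> `|x| <= b1 ->
   `|v| <= XR * b2 -> `|u * v - XR * (XR * (x * y))| <= XR * (e1 * b2 + b1 * e2).
  move=> A1 A2 A3 A4.
  have -> : u * v - XR * (XR * (x * y)) = (u - XR * x) * v + XR * (x * (v - XR * y)) by ring.
  apply: le_trans (ler_normD _ _) _; rewrite !normrM (ger0_norm (ltW Xp)).
  rewrite mulrDr; apply: lerD; last by rewrite ler_pM2l // ler_pM.
  by rewrite mulrCA; apply: ler_pM.
have two (z : int) (t : R) K : `|z%:~R - XR * (XR * t)| <= XR * K ->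
    `|(rnd X z)%:~R - XR * t| <= K + 1.
  have [r1 r2] := rnd_bounds z; rewrite !ler_norml => /andP[A1 A2].
  have := r1; have := r2; set q : R := (rnd X z)%:~R => B1 B2.
  apply/andP; split; rewrite -(ler_pM2l Xp); nra.
have E K : 2 * K = K + K :> R by rewrite mulr_natl mulr2n.
split; rewrite /= ; apply: two; rewrite E (mulrDr XR (e1 * b2 + b1 * e2) (e1 * b2 + b1 * e2)) ?intrD ?intrN !intrM.
- have -> : forall p q r s : R, p - q - XR * (XR * (r - s)) =
      (p - XR * (XR * r)) - (q - XR * (XR * s)) by move=> *; ring.
  by apply: le_trans (ler_normB _ _) _; apply: lerD; apply: one.
- have -> : forall p q r s : R, p + q - XR * (XR * (r + s)) =
      (p - XR * (XR * r)) + (q - XR * (XR * s)) by move=> *; ring.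
  by apply: le_trans (ler_normD _ _) _; apply: lerD; apply: one.
Qed.

Lemma bounded_add b1 b2 x y : bounded b1 x -> bounded b2 y -> bounded (b1 + b2) (x + y).
Proof.
case: x y => [x1 x2] [y1 y2] [/= h1 h2] [/= k1 k2].
by split; apply: le_trans (ler_normD _ _) _; apply: lerD.
Qed.

Lemma bounded_opp b x : bounded b x -> bounded b (- x).
Proof. by case: x => [x1 x2] [/= h1 h2]; split; rewrite /= normrN. Qed.

Lemma bounded_mul b1 b2 x y : bounded b1 x -> bounded b2 y ->
  bounded (2 * (b1 * b2)) (x * y).
Proof.
case: x y => [x1 x2] [y1 y2] [/= h1 h2] [/= k1 k2].
have E K : 2 * K = K + K :> R by rewrite mulr_natl mulr2n.
split; rewrite /= E; [apply: le_trans (ler_normB _ _) _ | apply: le_trans (ler_normD _ _) _];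
  by rewrite !normrM; apply: lerD; apply: ler_pM.
Qed.

Lemma bounded_conj b x : bounded b x -> bounded b x^*%C.
Proof. by case: x => [x1 x2] [/= h1 h2]; split; rewrite //= normrN. Qed.

Lemma bounded_uroot v : bounded 1 (uroot R v).
Proof.
have := uroot_conj R v; case: (uroot R v) => x y; rewrite /bounded /=; simpc.
case=> E _; have : x ^+ 2 + y ^+ 2 = 1 by rewrite -E; ring.
move=> H; have hx : x ^+ 2 <= 1 by have := sqr_ge0 y; lra.
have hy : y ^+ 2 <= 1 by have := sqr_ge0 x; lra.
by split; rewrite ler_norml; apply/andP; split; nra.
Qed.

Section Levels.
Variable U : nat -> zpair.
Variable l : nat.

Definition zfwd (h : nat) (x : nat -> zpair) (i : nat) : zpair :=
  let t := pmul X (U (bnode h i)) (x (bi0 h i + h)%N) in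
  if bside h i then psub (x (bi0 h i)) t else padd (x (bi0 h i)) t.
Definition zbwd (h : nat) (x : nat -> zpair) (i : nat) : zpair :=
  let y := x (bi0 h i) in let z := x (bi0 h i + h)%N in
  if bside h i then pmul X (pconj (U (bnode h i))) (psub y z) else padd y z.
Fixpoint zfwds (k : nat) (x : nat -> zpair) : nat -> zpair :=
  if k is k'.+1 then zfwd (2 ^ (l - k)) (zfwds k' x) else x.
Fixpoint zbwds (k : nat) (x : nat -> zpair) : nat -> zpair :=
  if k is k'.+1 then zbwd (2 ^ k') (zbwds k' x) else x.

Local Notation N := (2 ^ l)%N.
Local Notation u := (uroot R).
Local Notation ub := (fun v => (uroot R v)^*%C).

Variable d : R.
Hypothesis d1 : 1 <= d.
Hypothesis U_near : forall v, (v < N)%N -> near d (U v) (u v).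

Lemma half_dvd k : (k < l)%N -> ((2 ^ (l - k.+1)).*2 %| N)%N.
Proof. by move=> kl; apply: pow2_half; lia. Qed.

Definition fwd_bound (k : nat) : R := 3 ^+ k.
Definition fwd_err (k : nat) : R := 5 * d * 4 ^+ k.

Lemma zfwds_near x y k : (k <= l)%N ->
  (forall i, (i < N)%N -> near 0 (x i) (y i) /\ bounded 1 (y i)) ->
  fwd_err l <= XR ->
  forall i, (i < N)%N -> near (fwd_err k) (zfwds k x i) (fwds u l k y i) /\
    bounded (fwd_bound k) (fwds u l k y i).
Proof.
move=> kl xy eX; have dp := d1; elim: k kl => [|k IH] kl i iN.
  have [h1 h2] := xy i iN; rewrite /fwd_bound expr0; split=> //=.
  by apply: near_le h1 _; rewrite /fwd_err expr0; lra.
have H := bi0_lt iN (half_dvd kl) (_ : 0 < 2 ^ (l - k.+1))%N.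
have {}H : (bi0 (2 ^ (l - k.+1)) i + 2 ^ (l - k.+1) < N)%N by apply: H; rewrite expn_gt0.
have Hv : (bnode (2 ^ (l - k.+1)) i < N)%N by apply: bnode_lt.
have [n0 b0] := IH (ltnW kl) _ (leq_ltn_trans (leq_addr _ _) H).
have [n1 b1] := IH (ltnW kl) _ H.
have e_le : fwd_err k <= XR.
  apply: le_trans eX; rewrite /fwd_err ler_pM2l; last by lra.
  by rewrite ler_eXn2l // ?ltr1n // ltnW.
have p3 : 1 <= fwd_bound k by rewrite /fwd_bound exprn_ege1 // ler1n.
have p4 : 1 <= (4 : R) ^+ k by rewrite exprn_ege1 // ler1n.
have p34 : fwd_bound k <= 4 ^+ k by rewrite /fwd_bound lerXn2r ?nnegrE ?ler_nat.
have d0 : 0 <= d by apply: le_trans dp; exact: ler01.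
have e0 : 0 <= fwd_err k by rewrite /fwd_err !mulr_ge0 ?(le_trans ler01 p4).
have s1 := near_small n1 b1 e_le.
have br := bounded_uroot (bnode (2 ^ (l - k.+1)) i).
have nm := near_mul ler01 (_ : 0 <= fwd_bound k + 1) (_ : 0 <= d) e0 (U_near Hv) n1 br s1.
have {}nm : near (2 * (d * (fwd_bound k + 1) + 1 * fwd_err k) + 1) 
   (pmul X (U (bnode (2 ^ (l - k.+1)) i)) (zfwds k x (bi0 (2 ^ (l - k.+1)) i + 2 ^ (l - k.+1))%N))
   (u (bnode (2 ^ (l - k.+1)) i) * fwds u l k y (bi0 (2 ^ (l - k.+1)) i + 2 ^ (l - k.+1))%N).
  by apply: nm; lra.
have bm := bounded_mul br b1.
have E1 : fwd_err k + (2 * (d * (fwd_bound k + 1) + 1 * fwd_err k) + 1) <= fwd_err k.+1.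
  move: p3 p4 p34; rewrite /fwd_err exprS; set f := fwd_bound k; set g := 4 ^+ k.
  move=> f1 g1 fg; have q1 : d * f <= d * g by rewrite ler_wpM2l.
  have q2 : d * 1 <= d * g by rewrite ler_wpM2l.
  by lra.
have E2 : fwd_bound k + 2 * (1 * fwd_bound k) = fwd_bound k.+1.
  by rewrite /fwd_bound exprS; ring.
rewrite /= /zfwd /fwd; case: (bside _ i).
  rewrite expr1 mulN1r -E2; split; last by apply: bounded_add => //; apply: bounded_opp.
  by apply: near_le E1; apply: near_sub.
rewrite expr0 mul1r -E2; split; last exact: bounded_add.
by apply: near_le E1; apply: near_add.
Qed.

Lemma zbwds_near x y k e b : (k <= l)%N -> 1 <= b -> 4 * d * b + 2 * d + 1 <= 4 * e ->
  (forall i, (i < N)%N -> near e (x i) (y i) /\ bounded b (y i)) ->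
  2 * e * 8 ^+ l <= XR ->
  forall i, (i < N)%N -> near (e * 8 ^+ k) (zbwds k x i) (bwds ub k y i) /\
    bounded (b * 4 ^+ k) (bwds ub k y i).
Proof.
move=> kl b1 eb xy eX; have dp := d1; have d0 : 0 <= d by lra.
have db0 : 0 <= d * b by rewrite mulr_ge0 //; lra.
have e0 : 0 < e by lra.
elim: k kl => [|k IH] kl i iN; first by rewrite !expr0 !mulr1; apply: xy.
have H := bi0_lt iN (pow2_half kl) (_ : 0 < 2 ^ k)%N.
have {}H : (bi0 (2 ^ k) i + 2 ^ k < N)%N by apply: H; rewrite expn_gt0.
have Hv : (bnode (2 ^ k) i < N)%N by apply: bnode_lt.
have [n0 b0] := IH (ltnW kl) _ (leq_ltn_trans (leq_addr _ _) H).
have [n1 b1'] := IH (ltnW kl) _ H.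
have p4 : 1 <= (4 : R) ^+ k by rewrite exprn_ege1 // ler1n.
have p8 : 1 <= (8 : R) ^+ k by rewrite exprn_ege1 // ler1n.
have p48 : 4 ^+ k <= (8 : R) ^+ k by rewrite lerXn2r ?nnegrE ?ler_nat.
have e_le : 2 * (e * 8 ^+ k) <= XR.
  apply: le_trans eX; rewrite mulrA ler_pM2l; last by lra.
  by rewrite ler_eXn2l // ?ltr1n // ltnW.
have nd := near_sub n0 n1; have bd := bounded_add b0 (bounded_opp b1').
have EE (K : R) : K + K = 2 * K by rewrite mulr_natl mulr2n.
have := near_small nd bd; rewrite !EE => /(_ e_le) s1.
rewrite !EE in nd bd.
have br := bounded_conj (bounded_uroot (bnode (2 ^ k) i)).
have := near_mul ler01 _ _ _ (near_conj (U_near Hv)) nd br s1 => nm.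
move: p4 p8 p48 e_le nd bd s1 nm n0 n1 b0 b1'; rewrite ![_ ^+ k.+1]exprS.
set f : R := 4 ^+ k; set g : R := 8 ^+ k.
move=> p4 p8 p48 e_le nd bd s1 nm n0 n1 b0 b1'.
have bf0 : 0 <= b * f by rewrite mulr_ge0 //; lra.
have eg0 : 0 <= e * g by rewrite mulr_ge0 //; lra.
rewrite /= /zbwd /bwd; case: (bside _ i).
  split; last first.
    have -> : b * (4 * f) = 2 * (1 * (2 * (b * f))) by ring.
    exact: bounded_mul.
  apply: near_le; first by apply: nm; lra.
  have q1 : (4 * d * b + 2 * d + 1) * g <= 4 * e * g by rewrite ler_wpM2r //; lra.
  have q2 : d * b * f <= d * b * g by rewrite ler_wpM2l.
  have q3 : d * 1 <= d * g by rewrite ler_wpM2l.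
  by lra.
split; last first.
  have [q1 q2] := bounded_add b0 b1'.
  by split; [apply: le_trans q1 _ | apply: le_trans q2 _]; lra.
by apply: near_le (near_add n0 n1) _; lra.
Qed.
End Levels.
End Approximation.

Lemma sqrt_bounds (a : nat) : let s := Nat.sqrt a in (s * s <= a < s.+1 * s.+1)%N.
Proof. by have := PeanoNat.Nat.sqrt_spec a (PeanoNat.Nat.le_0_l a); lia. Qed.

Fixpoint seed (X j : nat) : nat * nat :=
  if j is j'.+1 then
    let c := Nat.sqrt ((X * X + X * (seed X j').1) %/ 2) in
    (c, (((seed X j').2 * X) %/ (c + c))%N)
  else (0%N, X).
Definition zseed (X j : nat) : zpair := ((seed X j).1%:Z, (seed X j).2%:Z).

Fixpoint tab (X L v : nat) : zpair :=
  if L is L'.+1 then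
    if (2 ^ L' <= v)%N then pmul X (tab X L' (v - 2 ^ L')) (zseed X L')
    else tab X L' v
  else (X%:Z, 0).

Definition zbits (X : nat) (a : nat -> bool) (i : nat) : zpair := ((X * a i)%N%:Z, 0).
Definition zconv (X l : nat) (x y : nat -> zpair) : nat -> zpair :=
  zbwds X (tab X l) l (fun v => pmul X (zfwds X (tab X l) l l x v)
                                       (zfwds X (tab X l) l l y v)).
Definition hits (l : nat) (a b : nat -> bool) (e : nat) : nat :=
  (\sum_(p < 2 ^ l) \sum_(q < 2 ^ l | (p + q) %% 2 ^ l == e) a p && b q)%N.

Lemma seed1_lt X j : (0 < X)%N -> ((seed X j).1 < X)%N.
Proof.
move=> X0; elim: j => [//|j IH] /=.
have := sqrt_bounds ((X * X + X * (seed X j).1) %/ 2); set c := Nat.sqrt _ => /=.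
have : ((X * X + X * (seed X j).1) %/ 2 < X * X)%N.
  by rewrite ltn_divLR //; nia.
by move=> H1 H2; rewrite ltnNge; apply/negP => H3; nia.
Qed.

Section Seeds.
Variable R : rcfType.
Variable X : nat.
Hypothesis X1000 : (1000 <= X)%N.
Local Notation XR := (X%:R : R).

Lemma seed_near j : near X 60 (zseed X j) (zeta R j).
Proof.
have X0 : (0 < X)%N by apply: leq_trans X1000.
have Xr : 1000 <= XR by rewrite ler_nat.
rewrite /zeta /zseed.
suff : let: (c, s) := zeta_cs R j in
   `|(seed X j).1%:R - XR * c| <= 12 /\ `|(seed X j).2%:R - XR * s| <= 60.
  case: (zeta_cs R j) => c s [h1 h2]; split=> //=.
  by apply: le_trans h1 _; rewrite ler_nat.
elim: j => [|j]; first by rewrite /= mulr0 mulr1 !subrr normr0; split; rewrite ler0n.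
have := zeta_csP R j; rewrite zeta_csS; case: (zeta_cs R j) => c s /= [c0 s0 cs1].
set g := Num.sqrt _; have g2 : g ^+ 2 = (1 + c) / 2 by rewrite sqr_sqrtr //; lra.
have g0 : 0 < g by rewrite sqrtr_gt0; lra.
set zc := (seed X j).1; set zs := (seed X j).2 => -[IHc IHs].
have := sqrt_bounds ((X * X + X * zc) %/ 2); set c' := Nat.sqrt _ => /= Hc'.
have s1 : s <= 1 by nra.
have c1 : c <= 1 by nra.
have Hc : (2 * (c' * c') <= X * X + X * zc < 2 * (c'.+1 * c'.+1))%N.
  have := divn_eq (X * X + X * zc) 2; have := ltn_pmod (X * X + X * zc) (isT : 0 < 2)%N.
  move: Hc'; move: (_ %/ 2)%N (_ %% 2)%N => a m /andP[h1 h2] hm ->.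
  by apply/andP; split; move: h1 h2 hm; clear; lia.
have [Hc1 Hc2] : 2 * (c'%:R * c'%:R) <= XR * XR + XR * zc%:R /\
     XR * XR + XR * zc%:R < 2 * ((c'%:R + 1) * (c'%:R + 1) : R).
  case/andP: Hc => h1 h2; rewrite natr1 -!natrM -!natrD ler_nat ltr_nat.
  by split.
pose G := XR * g.
have G7 : 7 * XR <= 10 * G.
  rewrite leNgt; apply/negP => H.
  have : 7 < 10 * g \/ 10 * g <= 7 by case: (leP (10 * g) 7); auto.
  by case=> H'; [rewrite /G in H; nra | nra].
have G2 : 2 * (G * G) = XR * XR + XR * (XR * c).
  by rewrite /G; have := g2; rewrite expr2 => E; rewrite mulrACA E; field.
have {}IHc : -12 <= zc%:R - XR * c <= 12 by rewrite -ler_norml.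
case/andP: IHc => IHc1 IHc2.
have cc0 : 0 <= c'%:R :> R by rewrite ler0n.
have E1 : `|c'%:R - G| <= 12.
  rewrite ler_norml; apply/andP; split; rewrite leNgt; apply/negP => H.
    have : (c'%:R + 1) * (c'%:R + 1) <= (G - 11) * (G - 11) by apply: ler_pM; lra.
    have : XR * (zc%:R - XR * c) >= XR * -12 by rewrite ler_pM2l //; lra.
    nra.
  have : (G + 12) * (G + 12) <= c'%:R * c'%:R by apply: ler_pM; lra.
  have : XR * (zc%:R - XR * c) <= XR * 12 by rewrite ler_pM2l //; lra.
  nra.
split=> //.
have {}E1 := E1; rewrite ler_norml in E1; case/andP: E1 => E1 E2.
have c'0 : (0 < c' + c')%N by rewrite addn_gt0 -(ltr0n R) ; lra.
have Hd := divn_eq (zs * X) (c' + c'); have Hm := ltn_pmod (zs * X) c'0.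
set q := ((zs * X) %/ (c' + c'))%N in Hd *.
have cc2 : 2 * c'%:R = (c' + c')%N%:R :> R by rewrite natrD; ring.
have Hd1 : q%:R * (2 * c'%:R) <= zs%:R * XR :> R.
  by rewrite cc2 -!natrM ler_nat Hd leq_addr.
have Hd2 : zs%:R * XR < (q%:R + 1) * (2 * c'%:R) :> R.
  by rewrite cc2 natr1 -!natrM ltr_nat [X in (X < _)%N]Hd mulSn addnC ltn_add2r.
pose S' := XR * (s / (2 * g)).
have S'E : S' * (2 * G) = XR * (XR * s) by rewrite /S' /G; field; lra.
have S'0 : 0 <= S' by rewrite /S' mulr_ge0 ?ler0n // divr_ge0 //; lra.
have S'1 : 10 * S' <= 72 / 10 * XR.
  rewrite leNgt; apply/negP => H.
  have : S' * (2 * G) > XR * XR by nra.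
  by rewrite S'E; nra.
rewrite ler_norml in IHs; case/andP: IHs => IHs1 IHs2.
have A1 : XR * -60 <= XR * (zs%:R - XR * s) by rewrite ler_pM2l //; lra.
have A2 : XR * (zs%:R - XR * s) <= XR * 60 by rewrite ler_pM2l //; lra.
rewrite -/S' ler_norml; apply/andP; split; rewrite leNgt; apply/negP => H.
- have B1 : (q%:R + 1) * (2 * c'%:R) <= (S' - 59) * (2 * c'%:R).
    by rewrite ler_wpM2r //; lra.
  have B2 : S' * (2 * c'%:R) <= S' * (2 * (G + 12)) by rewrite ler_wpM2l //; lra.
  by lra.
- have B1 : (S' + 60) * (2 * c'%:R) <= q%:R * (2 * c'%:R).
    by rewrite ler_wpM2r //; lra.
  have B2 : S' * (2 * (G - 12)) <= S' * (2 * c'%:R) by rewrite ler_wpM2l //; lra.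
  by lra.
Qed.
End Seeds.

Section Convolution.
Variable R : rcfType.
Variables X l : nat.
Hypothesis l0 : (0 < l)%N.
Hypothesis XN : ((2 ^ l) ^ 40 <= X)%N.
Local Notation XR := (X%:R : R).
Local Notation n := ((2 : R) ^+ l).
Local Notation N := (2 ^ l)%N.

Lemma n_ge2 : 2 <= n.
Proof. by rewrite -natrX ler_nat -{1}(expn1 2) leq_exp2l. Qed.

Lemma n_pow_le j k : (j <= k)%N -> n ^+ j <= n ^+ k.
Proof. by move=> jk; rewrite ler_weXn2l // (le_trans _ n_ge2) // ler1n. Qed.

Lemma XN_real : n ^+ 40 <= XR.
Proof. by rewrite -!natrX ler_nat. Qed.

Lemma X_big : (1000 <= X)%N.
Proof.
apply: leq_trans XN; apply: (@leq_trans (2 ^ 10)) => //.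
apply: leq_trans (_ : N ^ 10 <= _)%N; last by rewrite leq_pexp2l ?expn_gt0.
by rewrite leq_exp2r // -{1}(expn1 2) leq_exp2l.
Qed.

Let X0 : (0 < X)%N := leq_trans (isT : 0 < 1000)%N X_big.

(* Constants are absorbed by powers of [n >= 2]. *)
Lemma const_le c j k : c <= 2 ^+ j -> (j + k <= 40)%N -> c * n ^+ k <= XR.
Proof.
move=> cj jk; have n2 := n_ge2.
apply: le_trans XN_real; apply: le_trans (n_pow_le jk); rewrite exprD.
rewrite ler_wpM2r ?exprn_ge0 ?(le_trans _ n2) //; apply: le_trans cj _.
by rewrite lerXn2r ?nnegrE ?ler0n ?exprn_ge0.
Qed.

Lemma pow4 : (4 : R) ^+ l = n ^+ 2.
Proof. by rewrite -exprM mulnC exprM; congr (_ ^+ _); rewrite -natrX. Qed.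

Lemma pow8 : (8 : R) ^+ l = n ^+ 3.
Proof. by rewrite -exprM mulnC exprM; congr (_ ^+ _); rewrite -natrX. Qed.

Lemma tab_near L v : (L <= l)%N -> (v < 2 ^ L)%N ->
  near X (41 * (4 ^+ L - 1)) (tab X L v) (uroot R v).
Proof.
elim: L v => [|L IH] v Ll vL.
  have -> : v = 0%N by move: vL; rewrite expn0; case: v.
  rewrite expr0 subrr mulr0 uroot0; split=> /=.
    by rewrite mulr1 subrr normr0.
  by rewrite mulr0 subrr normr0.
have p4 : 1 <= (4 : R) ^+ L by rewrite exprn_ege1 // ler1n.
rewrite /=; case: leqP => vL'; last first.
  by apply: near_le (IH _ (ltnW Ll) vL') _; rewrite exprS; lra.
have vv : (v - 2 ^ L < 2 ^ L)%N by move: vL; rewrite expnS; lia.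
rewrite -{2}(subnKC vL') uroot_top //.
have sn := seed_near R X_big L.
have X60 : 60 <= XR by rewrite ler_nat (leq_trans _ X_big).
have bz : bounded 1 (zeta R L).
  have := zeta_csP R L; rewrite /zeta; case: (zeta_cs R L) => a b [a0 b0 ab].
  by split; rewrite /= ler_norml; apply/andP; split; nra.
have sm := near_small X0 sn bz X60.
have Ea : 0 <= 41 * ((4 : R) ^+ L - 1) by lra.
have nm := near_mul X0 ler01 (_ : 0 <= 1 + 1) Ea (_ : 0 <= 60)
  (IH _ (ltnW Ll) vv) sn (bounded_uroot R _) sm.
by apply: near_le (nm _ _) _; rewrite ?exprS //; lra.
Qed.

Let d : R := 41 * 4 ^+ l.

Lemma d_ge1 : 1 <= d.
Proof. have : 1 <= (4 : R) ^+ l by rewrite exprn_ege1 // ler1n.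
by rewrite /d; lra. Qed.

Lemma d_le : d <= XR.
Proof. by rewrite /d pow4; apply: (@const_le _ 6) => //; rewrite -natrX ler_nat. Qed.

Lemma tab_near_d v : (v < N)%N -> near X d (tab X l v) (uroot R v).
Proof. by move=> vN; apply: near_le (tab_near (leqnn l) vN) _; rewrite /d; lra. Qed.

Definition exact_bits (a : nat -> bool) (i : nat) : R[i] := (a i)%:R.

Lemma bits_near a i : near X 0 (zbits X a i) (exact_bits a i) /\
  bounded (1 : R) (exact_bits a i).
Proof.
rewrite /exact_bits /zbits /near /bounded.
case: (a i) => /=; rewrite ?muln1 ?muln0 ?mulr1 ?mulr0 ?subrr ?normr0 ?normr1;
  by split; rewrite ?ler01.
Qed.

Lemma fwd_err_le : fwd_err d l <= 205 * n ^+ 4.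
Proof. by rewrite /fwd_err /d pow4 (exprD n 2 2); lra. Qed.

Lemma fwd_err_X : fwd_err d l <= XR.
Proof.
apply: le_trans fwd_err_le _; apply: (@const_le _ 8) => //.
by rewrite -natrX ler_nat.
Qed.

Lemma fwd_near a k i : (k <= l)%N -> (i < N)%N ->
  near X (fwd_err d k) (zfwds X (tab X l) l k (zbits X a) i)
                       (fwds (uroot R) l k (exact_bits a) i) /\
  bounded (fwd_bound R k) (fwds (uroot R) l k (exact_bits a) i).
Proof.
move=> kl; apply: (zfwds_near X0 d_ge1 tab_near_d kl) => [j _|]; first exact: bits_near.
exact: fwd_err_X.
Qed.

Let e0 : R := 1300 * n ^+ 6.
Let b0 : R := 2 * n ^+ 4.

Lemma prod_near a b i : (i < N)%N ->
  near X e0 (pmul X (zfwds X (tab X l) l l (zbits X a) i) (zfwds X (tab X l) l l (zbits X b) i))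
    (fwds (uroot R) l l (exact_bits a) i * fwds (uroot R) l l (exact_bits b) i) /\
  bounded b0 (fwds (uroot R) l l (exact_bits a) i * fwds (uroot R) l l (exact_bits b) i).
Proof.
move=> iN; have [na ba] := fwd_near a (leqnn l) iN; have [nb bb] := fwd_near b (leqnn l) iN.
have B3 : fwd_bound R l <= n ^+ 2 by rewrite /fwd_bound -pow4 lerXn2r ?nnegrE ?ler_nat.
have B0 : 0 <= fwd_bound R l by rewrite /fwd_bound exprn_ge0.
have n2 := n_ge2; have nn : 4 <= n ^+ 2 by rewrite expr2; nra.
have E0 : 0 <= fwd_err d l.
  by rewrite /fwd_err !mulr_ge0 ?exprn_ge0 // (le_trans ler01 d_ge1).
have sb := near_small X0 nb bb fwd_err_X.
have nm := near_mul X0 B0 (addr_ge0 B0 ler01) E0 E0 na nb ba sb.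
split; last first.
  have [q1 q2] := bounded_mul ba bb.
  have : 2 * (fwd_bound R l * fwd_bound R l) <= b0.
    by rewrite /b0 ler_pM2l // (exprD n 2 2); apply: ler_pM.
  by move=> ?; split; [apply: le_trans q1 _ | apply: le_trans q2 _].
apply: near_le nm _; have E1 := fwd_err_le.
set E := fwd_err d l in E0 E1 *; set B := fwd_bound R l in B0 B3 *.
have -> : 2 * (E * (B + 1) + B * E) + 1 = E * (4 * B + 2) + 1 by ring.
have H : E * (4 * B + 2) <= (205 * n ^+ 4) * (5 * n ^+ 2) by apply: ler_pM; lra.
apply: le_trans (_ : (205 * n ^+ 4) * (5 * n ^+ 2) + 1 <= _); first by lra.
have -> : (205 * n ^+ 4) * (5 * n ^+ 2) = 1025 * n ^+ 6.
  by rewrite (exprD n 4 2); ring.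
rewrite /e0; have : 1 <= n ^+ 6 by rewrite exprn_ege1 // (le_trans _ n2) // ler1n.
by lra.
Qed.

Lemma bwd_near a b k i : (k <= l)%N -> (i < N)%N ->
  let x v := pmul X (zfwds X (tab X l) l l (zbits X a) v)
                    (zfwds X (tab X l) l l (zbits X b) v) in
  let y v := fwds (uroot R) l l (exact_bits a) v * fwds (uroot R) l l (exact_bits b) v in
  near X (e0 * 8 ^+ k) (zbwds X (tab X l) k x i)
    (bwds (fun v => (uroot R v)^*%C) k y i) /\
  bounded (b0 * 4 ^+ k) (bwds (fun v => (uroot R v)^*%C) k y i).
Proof.
have n2 := n_ge2.
have n6 : n ^+ 6 = n ^+ 2 * n ^+ 4 by rewrite -exprD.
have q1 : 1 <= n ^+ 4 by rewrite exprn_ege1 // (le_trans _ n2) // ler1n.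
have q2 : 1 <= n ^+ 2 by rewrite exprn_ege1 // (le_trans _ n2) // ler1n.
move=> kl iN x y; have H := zbwds_near X0 d_ge1 tab_near_d (x := x) (y := y) (e := e0) (b := b0) kl.
apply: H => //.
- by rewrite /b0; lra.
- rewrite /e0 /b0 /d pow4 n6.
  have : n ^+ 2 * 1 <= n ^+ 2 * n ^+ 4 by rewrite ler_wpM2l //; lra.
  by lra.
- by move=> j jN; apply: prod_near.
- rewrite pow8 /e0 (_ : 2 * _ * _ = 2600 * n ^+ 9); last by rewrite (exprD n 6 3); ring.
  by apply: (@const_le _ 12) => //; rewrite -natrX ler_nat.
Qed.

Definition small_int (a : zpair) : Prop :=
  `|a.1| <= (X * N ^ 8)%N%:Z /\ `|a.2| <= (X * N ^ 8)%N%:Z.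

Lemma small_small_int b a : small X b a -> b <= n ^+ 8 -> small_int a.
Proof.
case=> h1 h2 bn; split; rewrite -(ler_int R) intr_norm -pmulrn natrM !natrX;
  [apply: le_trans h1 _ | apply: le_trans h2 _]; by rewrite ler_wpM2l.
Qed.

Lemma tab_small v : (v < N)%N -> `|(tab X l v).1| <= (2 * X)%N%:Z /\ `|(tab X l v).2| <= (2 * X)%N%:Z.
Proof.
move=> vN; have [h1 h2] := near_small X0 (tab_near_d vN) (bounded_uroot R v) d_le.
by split; rewrite -(ler_int R) intr_norm -pmulrn natrM mulrC.
Qed.

Lemma fwd_small a k i : (k <= l)%N -> (i < N)%N ->
  small_int (zfwds X (tab X l) l k (zbits X a) i).
Proof.
move=> kl iN; have [na ba] := fwd_near a kl iN.
have e : fwd_err d k <= XR.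
  apply: le_trans fwd_err_X; rewrite /fwd_err ler_pM2l; last by have := d_ge1; lra.
  by rewrite ler_weXn2l // ler1n.
apply: (small_small_int (near_small X0 na ba e)).
have : fwd_bound R k <= 4 ^+ k by rewrite /fwd_bound lerXn2r ?nnegrE ?ler_nat.
have : (4 : R) ^+ k <= 4 ^+ l by rewrite ler_weXn2l // ler1n.
rewrite pow4; have := n_ge2 => n2; have : n ^+ 3 <= n ^+ 8 by apply: n_pow_le.
have : 4 <= n ^+ 2 by rewrite expr2; nra.
by rewrite (exprS n 2); set t := n ^+ 2 => *; nra.
Qed.

Lemma bwd_small a b k i : (k <= l)%N -> (i < N)%N ->
  small_int (zbwds X (tab X l) k (fun v => pmul X (zfwds X (tab X l) l l (zbits X a) v)
                    (zfwds X (tab X l) l l (zbits X b) v)) i).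
Proof.
move=> kl iN; have [na ba] := bwd_near a b kl iN.
have e : e0 * 8 ^+ k <= XR.
  apply: le_trans (_ : e0 * 8 ^+ l <= _).
    by rewrite ler_wpM2l ?ler_weXn2l ?ler1n // /e0 mulr_ge0 ?exprn_ge0.
  rewrite pow8 /e0 -mulrA -exprD.
  by apply: (@const_le _ 11) => //; rewrite -natrX ler_nat.
apply: (small_small_int (near_small X0 na ba e)).
have H : b0 * 4 ^+ k <= b0 * n ^+ 2.
  by rewrite -pow4 ler_wpM2l ?ler_weXn2l ?ler1n // /b0 mulr_ge0 ?exprn_ge0.
apply: le_trans (_ : b0 * n ^+ 2 + 1 <= _); first by lra.
rewrite /b0 -mulrA -exprD; have n2 := n_ge2.
have nn : 4 <= n ^+ 2 by rewrite expr2; nra.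
have : 1 <= n ^+ 6 by rewrite exprn_ege1 // (le_trans _ n2) // ler1n.
by rewrite (exprD n 2 6); set t := n ^+ 2 in nn *; set s := n ^+ 6; nra.
Qed.

Lemma cconv_hits a b e :
  cconv l (exact_bits a) (exact_bits b) e = (hits l a b e)%:R.
Proof.
rewrite /cconv /hits natr_sum; apply: eq_bigr => p _.
rewrite natr_sum; apply: eq_bigr => q _.
by rewrite /exact_bits -natrM mulnb.
Qed.

Lemma zconv_hits a b e : (e < N)%N ->
  4 * `|(zconv X l (zbits X a) (zbits X b) e).1 - (X * N * hits l a b e)%N%:Z|
    < (N * X)%N%:Z.
Proof.
move=> eN; have [[h _] _] := bwd_near a b (leqnn l) eN.
have uroot0' := uroot0 R; have rd := uroot_double R; have rc := uroot_conj R.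
have E := conv_transform uroot0' rd rc (exact_bits a) (exact_bits b) eN.
rewrite E cconv_hits -natrX -natrM in h.
have Re_nat k : complex.Re (k%:R : R[i]) = k%:R by rewrite -[k%:R]/(k%:R : R[i]) raddfMn.
rewrite Re_nat -natrM mulnA in h.
rewrite -(ltr_int R) intrM intr_norm intrB -!pmulrn.
apply: le_lt_trans (_ : 4 * (e0 * 8 ^+ l) < _); first by rewrite ler_pM2l.
rewrite pow8 /e0 natrM natrX -[X in X < _]mulr1.
have n2 := n_ge2.
have -> : 4 * (1300 * n ^+ 6 * n ^+ 3) * 1 = n * (5200 * n ^+ 8).
  by rewrite (exprD n 6 2) [n ^+ 3]exprS; ring.
rewrite ltr_pM2l; last by lra.
have p : 0 < n ^+ 8 by rewrite exprn_gt0 //; lra.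
apply: lt_le_trans (_ : 8192 * n ^+ 8 <= _); first by lra.
by apply: (@const_le _ 13) => //; rewrite -natrX ler_nat.
Qed.
End Convolution.

(** * Reasoning about structured programs *)

Local Open Scope nat_scope.
Local Notation "k %:Z" := (Posz k) (only parsing) : nat_scope.

Fixpoint rnds (c : cmd) : bool :=
  match c with
  | Rnd _ => true | Sq a b => rnds a || rnds b | If _ c | For _ _ c => rnds c
  | _ => false end.
Fixpoint outs (c : cmd) : bool :=
  match c with
  | Ou _ => true | Sq a b => outs a || outs b | If _ c | For _ _ c => outs c
  | _ => false end.
Fixpoint evars (e : expr) : seq nat :=
  match e with
  | Vr x => [:: x] | Cs _ => [::]
  | Bi _ a b | QM a b | QN a b => evars a ++ evars b
  | Rd _ a | Rw a | QD a => evars a end.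
Fixpoint earrs (e : expr) : seq nat :=
  match e with
  | Vr _ | Cs _ => [::]
  | Bi _ a b | QM a b | QN a b => earrs a ++ earrs b
  | Rd id a => id :: earrs a | Rw a | QD a => earrs a end.
Fixpoint noraw (e : expr) : bool :=
  match e with
  | Vr _ | Cs _ => true
  | Bi _ a b | QM a b | QN a b => noraw a && noraw b
  | Rd id a => (id < 32) && noraw a | QD a => noraw a | Rw _ => false end.

Definition fill (i y id : nat) (b e : expr) : cmd := For i y (Wr id (Bi OpAdd b (Vr i)) e).

Section Logic.
Variables (w n : nat) (O : oracle).
Local Notation W := (2 ^ w).
Local Notation adr := (adr w n).
Local Notation ev := (ev w n O).
Local Notation den := (den w n O).
Variable Lm : nat.
Hypothesis w5 : 5 <= w.
Hypothesis LmW : Lm * 32 + 32 + n + n <= W.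

Definition ar (s : hst) (id i : nat) : nat := mm s (adr id i).

Arguments ar : simpl never.

Lemma W_gt0 : 0 < W. Proof. by rewrite expn_gt0. Qed.
Lemma W_ge32 : 32 <= W. Proof. by rewrite (@leq_exp2l 2 5). Qed.
Lemma W_gt1 : 1 < W. Proof. exact: leq_trans W_ge32. Qed.

Lemma adr_id id id' i j : id < 32 -> id' < 32 -> adr id i = adr id' j -> id = id'.
Proof.
move=> h h' /(congr1 (modn^~ 32)); have d : 32 %| W by apply: (@dvdn_exp2l 2 5).
rewrite /adr !modn_dvdm // => /eqP; rewrite !eqn_modDr !modnMDl !modn_small //.
by move/eqP.
Qed.

Lemma adr_val id i : id < 32 -> i < Lm -> adr id i = i * 32 + id + n + n.
Proof. by move=> h1 h2; rewrite /adr modn_small //; lia. Qed.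

Lemma adr_eq id id' i j : id < 32 -> id' < 32 -> i < Lm -> j < Lm ->
  (adr id i == adr id' j) = (id == id') && (i == j).
Proof.
move=> h h' hi hj; apply/eqP/andP => [E|[/eqP -> /eqP ->] //].
have Ed := adr_id h h' E; split; first exact/eqP.
by move: E; rewrite !adr_val // Ed; lia.
Qed.

Lemma ar_wr r h id i v t o k id' j : id < 32 -> id' < 32 -> i < Lm -> j < Lm ->
  ar (Hst r (upd h (adr id i) v) t o k) id' j =
  if (id' == id) && (j == i) then v else h (adr id' j).
Proof. by move=> *; rewrite /ar /= /upd adr_eq. Qed.

Lemma ar_wr_ne r h id i v t o k id' j : id < 32 -> id' < 32 -> id' != id ->
  ar (Hst r (upd h (adr id i) v) t o k) id' j = h (adr id' j).
Proof.
by move=> h1 h2 ne; rewrite /ar /= /upd; case: eqP => // /(adr_id h2 h1) E; rewrite E eqxx in ne.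
Qed.

Lemma den_ar c s id i : cwf c -> id < 32 -> id \notin wrs c ->
  ar (den c s) id i = ar s id i.
Proof.
move=> + idl; elim: c s => //= [id' a b|a IHa b IHb|e c IH|x y c IH] s.
- by case/and3P=> h _ _; rewrite inE => ne; rewrite ar_wr_ne.
- by case/andP=> wa wb; rewrite mem_cat negb_or => /andP[Ha Hb]; rewrite IHb // IHa.
- by case/andP=> _ wc nc; case: eqP => // _; rewrite IH.
- case/and5P=> _ _ _ _ /and3P[_ _ wc] nc.
  by elim: (rg s y) => [//|k IHk]; rewrite iterS -[LHS]/(ar (den c _) id i) IH.
Qed.

Lemma den_tp c s : ~~ rnds c -> tp (den c s) = tp s.
Proof.
elim: c s => //= [a IHa b IHb|e c IH|x y c IH] s.
- by rewrite negb_or => /andP[ha hb]; rewrite IHb // IHa.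
- by move=> h; case: eqP => // _; rewrite IH.
- by move=> h; elim: (rg s y) => [//|k IHk] /=; rewrite IH.
Qed.

Lemma den_ou c s : ~~ outs c -> ou (den c s) = ou s.
Proof.
elim: c s => //= [a IHa b IHb|e c IH|x y c IH] s.
- by rewrite negb_or => /andP[ha hb]; rewrite IHb // IHa.
- by move=> h; case: eqP => // _; rewrite IH.
- by move=> h; elim: (rg s y) => [//|k IHk] /=; rewrite IH.
Qed.

Lemma ev_ext s s' e : noraw e ->
  (forall x, x \in evars e -> rg s x = rg s' x) ->
  (forall id i, id < 32 -> id \in earrs e -> ar s id i = ar s' id i) -> ev s e = ev s' e.
Proof.
elim: e => //= [x _ h _|o a IHa b IHb|id a IHa|a IHa b IHb|a IHa|a IHa b IHb].
- by rewrite h ?inE.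
- case/andP=> na nb h1 h2; rewrite IHa ?IHb // => [x hx|id i hi hx|x hx|id i hi hx];
    by rewrite ?h1 ?h2 // mem_cat hx ?orbT.
- case/andP=> hid na h1 h2; rewrite -!/(ar _ _ _) (h2 id) ?inE ?eqxx // IHa //.
  by move=> id' i hi hx; rewrite h2 // inE hx orbT.
- case/andP=> na nb h1 h2; rewrite IHa ?IHb // => [x hx|id i hi hx|x hx|id i hi hx];
    by rewrite ?h1 ?h2 // mem_cat hx ?orbT.
- by move=> na h1 h2; rewrite IHa.
- case/andP=> na nb h1 h2; rewrite IHa ?IHb // => [x hx|id i hi hx|x hx|id i hi hx];
    by rewrite ?h1 ?h2 // mem_cat hx ?orbT.
Qed.

Lemma for_ind x y c s (I : nat -> hst -> Prop) : cwf (For x y c) ->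
  I 0 (setr s x 0 2) ->
  (forall k t, k < rg s y -> rg t x = k -> rg t y = rg s y -> I k t ->
     I k.+1 (setr (den c t) x k.+1 4)) ->
  I (rg s y) (den (For x y c) s).
Proof.
move=> wf I0 IS /=; have : rg s y <= rg s y by [].
move: {1 3 4}(rg s y) => k; elim: k => [|k IH] kN //=.
have [E1 E2] := iter_for w n O s k wf; rewrite /= in E1 E2.
have := IS k _ kN E1 E2 (IH (ltnW kN)).
rewrite [rg (den c _) x]den_rg ?E1 //.
by case/and5P: wf => _ _ _ _ /and3P[].
Qed.

Lemma for_frame x y c s (I : nat -> hst -> Prop) : cwf (For x y c) ->
  I 0 (setr s x 0 2) ->
  (forall k t, k < rg s y -> rg t x = k ->
     (forall z, z \notin asg (For x y c) -> rg t z = rg s z) ->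
     (forall id i, id < 32 -> id \notin wrs c -> ar t id i = ar s id i) ->
     I k t -> I k.+1 (setr (den c t) x k.+1 4)) ->
  I (rg s y) (den (For x y c) s).
Proof.
move=> wf I0 IS; have /and5P[_ _ _ /negbTE yx /and3P[_ yc wc]] := wf.
pose J k t := [/\ I k t, forall z, z \notin asg (For x y c) -> rg t z = rg s z
  & forall id i, id < 32 -> id \notin wrs c -> ar t id i = ar s id i].
suff [] : J (rg s y) (den (For x y c) s) by [].
apply: for_ind => //.
  by split=> // z /=; rewrite inE negb_or => /andP[/negbTE zx _]; rewrite /upd zx.
move=> k t kN tx _ [Jt fr fa]; split; first exact: IS.
- move=> z /[dup] zc /=; rewrite inE negb_or => /andP[/negbTE zx zc'].
  by rewrite /upd zx den_rg // fr.
- by move=> id i h1 h2; rewrite -[LHS]/(ar (den c t) id i) den_ar // fa.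
Qed.

Lemma fill_spec i y id b e s B f :
  cwf (fill i y id b e) -> noraw b -> noraw e -> id \notin earrs b -> id \notin earrs e ->
  (forall j, j < rg s y -> ev (setr s i j 0) b = B /\ ev (setr s i j 0) e = f j) ->
  B + rg s y <= Lm ->
  let s' := den (fill i y id b e) s in
  [/\ forall k, k < Lm -> ar s' id k = if B <= k < B + rg s y then f (k - B) else ar s id k,
      rg s' i = rg s y &
      ck s' = ck s + 2 + rg s y * (esz b + esz e + 13)].
Proof.
move=> wf nb ne ib ie H BL /=.
have idl : id < 32 by case/and5P: wf => _ _ _ _ /and3P[_ _ /and3P[]].
pose I (k : nat) (t : hst) := [/\ forall x, x != i -> rg t x = rg s x,
  forall id' j, id' != id -> id' < 32 -> ar t id' j = ar s id' j,
  forall j, j < Lm -> ar t id j = if B <= j < B + k then f (j - B) else ar s id j,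
  rg t i = k & ck t = ck s + 2 + k * (esz b + esz e + 13)].
suff [_ _ h3 h4 h5] : I (rg s y) (den (fill i y id b e) s) by split.
apply: for_ind => //.
  split=> //=; last 2 first.
  - by rewrite /upd eqxx.
  - by rewrite addn0.
  - by move=> x /negbTE xi; rewrite /upd xi.
  by move=> j jL; rewrite addn0; case: ifP => // ?; lia.
move=> k t kN ti ty [t1 t2 t3 t4 t5].
have [E1 E2] := H _ kN.
have sub e' : noraw e' -> id \notin earrs e' -> ev t e' = ev (setr s i k 0) e'.
  move=> h1 h2; apply: ev_ext => // [x _|id' j hj h].
    by rewrite /= /upd; case: eqP => [->|/eqP /t1].
  by rewrite t2 //; apply: contraNneq h2 => <-.
have Ei : (B + k) %% W = B + k by rewrite modn_small //; lia.
rewrite /= sub // (sub e) // E1 E2 ti Ei; split=> //=.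
- by move=> x /negbTE xi; rewrite /upd xi t1 // xi.
- by move=> id' j nq hid; rewrite ar_wr_ne // -/(ar t id' j) t2.
- move=> j jL; rewrite ar_wr //; last by lia.
  rewrite eqxx -/(ar t id j) t3 //=; case: eqP => [->|nq].
    by rewrite addKn leq_addr ltn_add2l ltnSn.
  by congr (if _ then _ else _); lia.
- by rewrite /upd eqxx.
- by rewrite t5; lia.
Qed.

Definition wd (z : int) : nat := `|(z %% W%:Z)%Z|%N.

Lemma wd_nat k : k < W -> wd k%:Z = k.
Proof. by move=> kW; rewrite /wd modz_small ?absz_nat // lez_nat ltz_nat. Qed.

Lemma wdP z : (wd z)%:Z = (z %% W%:Z)%Z.
Proof. by rewrite /wd gez0_abs // modz_ge0 // -lt0n W_gt0. Qed.

Lemma wd_lt z : wd z < W.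
Proof. by rewrite -ltz_nat wdP ltz_pmod // ltz_nat W_gt0. Qed.

Lemma wd_eq k z : k < W -> (k%:Z = z %[mod W%:Z])%Z -> k = wd z.
Proof.
by move=> kW E; apply/eqP; rewrite -eqz_nat wdP -E modz_small // lez_nat ltz_nat.
Qed.

Lemma ev_addz s a b x y : ev s a = wd x -> ev s b = wd y ->
  ev s (Bi OpAdd a b) = wd (x + y).
Proof.
move=> /= -> ->; apply: wd_eq; first by rewrite ltn_pmod ?W_gt0.
by rewrite -modz_nat modz_mod PoszD !wdP modzDm.
Qed.

Lemma ev_mulz s a b x y : ev s a = wd x -> ev s b = wd y ->
  ev s (Bi OpMul a b) = wd (x * y).
Proof.
move=> /= -> ->; apply: wd_eq; first by rewrite ltn_pmod ?W_gt0.
by rewrite -modz_nat modz_mod PoszM !wdP modzMm.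
Qed.

Lemma ev_subz s a b x y : ev s a = wd x -> ev s b = wd y ->
  ev s (Bi OpSub a b) = wd (x - y).
Proof.
move=> /= -> ->; apply: wd_eq; first by rewrite ltn_pmod ?W_gt0.
have := wd_lt y => h; rewrite -modz_nat modz_mod -addnBA ?(ltnW h) // addnC.
rewrite PoszD -subzn ?(ltnW h) // !wdP.
rewrite (_ : _ + _ = (x %% W)%Z - (y %% W)%Z + W%:Z)%R; last by ring.
by rewrite modzDr -modzDmr modzNm modzDmr modzDml.
Qed.

Lemma ev_addn s a b x y : ev s a = x -> ev s b = y -> x + y < W ->
  ev s (Bi OpAdd a b) = x + y.
Proof. by move=> /= -> -> h; rewrite modn_small. Qed.

Lemma ev_muln s a b x y : ev s a = x -> ev s b = y -> x * y < W ->
  ev s (Bi OpMul a b) = x * y.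
Proof. by move=> /= -> -> h; rewrite modn_small. Qed.

Lemma ev_subn s a b x y : ev s a = x -> ev s b = y -> y <= x < W ->
  ev s (Bi OpSub a b) = x - y.
Proof.
move=> /= -> -> /andP[h1 h2].
by rewrite -addnBAC // modnDr modn_small // (leq_ltn_trans _ h2) // leq_subr.
Qed.

Lemma ev_divn s a b x y : ev s a = x -> ev s b = y -> x < W ->
  ev s (Bi OpDiv a b) = x %/ y.
Proof. by move=> /= -> -> h; rewrite modn_small // (leq_ltn_trans (leq_div _ _) h). Qed.

Lemma ev_modn s a b x y : ev s a = x -> ev s b = y -> x < W ->
  ev s (Bi OpMod a b) = x %% y.
Proof. by move=> /= -> -> h; rewrite modn_small // (leq_ltn_trans (leq_mod _ _) h). Qed.

Lemma ev_ltn s a b x y : ev s a = x -> ev s b = y -> ev s (Bi OpLt a b) = (x < y).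
Proof. by move=> /= -> ->; rewrite modn_small // (leq_ltn_trans (leq_b1 _) W_gt1). Qed.

Lemma ev_eqn s a b x y : ev s a = x -> ev s b = y -> ev s (Bi OpEq a b) = (x == y).
Proof. by move=> /= -> ->; rewrite modn_small // (leq_ltn_trans (leq_b1 _) W_gt1). Qed.

Lemma ev_cst s v : v < W -> ev s (Cs v) = v.
Proof. by move=> h; rewrite /= modn_small. Qed.

Lemma ev_vr s x v : rg s x = v -> ev s (Vr x) = v.
Proof. by []. Qed.

Lemma ev_rd s id a k v : ev s a = k -> ar s id k = v -> ev s (Rd id a) = v.
Proof. by rewrite /ar /= => -> ->. Qed.

Lemma ev_rnd s e x y o z X OFF : ev s e = wd z -> rg s x = X -> rg s y = OFF ->
  rg s o = X * OFF -> 0 < X -> OFF < W -> X * OFF + X * OFF <= W -> (`|z| < (X * OFF)%N%:Z)%R ->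
  ev s (Bi OpSub (Bi OpDiv (Bi OpAdd e (Vr o)) (Vr x)) (Vr y)) = wd (z %/ X%:Z)%Z.
Proof.
move=> Ee Ex Ey Eo X0 OW XW zb.
have h1 : (0 <= z + (X * OFF)%N%:Z)%R by lia.
pose k := `|(z + (X * OFF)%N%:Z)%R|%N.
have Ek : k%:Z = (z + (X * OFF)%N%:Z)%R by rewrite /k gez0_abs.
have kW : k < W by rewrite -ltz_nat Ek; lia.
have Ea : ev s (Bi OpAdd e (Vr o)) = k.
  have Eo' : ev s (Vr o) = wd (X * OFF)%N%:Z by rewrite wd_nat //; lia.
  by rewrite (ev_addz Ee Eo') -Ek wd_nat.
have Ed : ev s (Bi OpDiv (Bi OpAdd e (Vr o)) (Vr x)) = k %/ X by apply: ev_divn.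
have kd : k %/ X < W by apply: leq_ltn_trans (leq_div _ _) kW.
rewrite -(wd_nat kd) in Ed; rewrite (ev_subz (y := OFF%:Z) Ed); last by rewrite /= Ey wd_nat.
congr wd; rewrite -divz_nat Ek (addrC z) PoszM (mulrC X%:Z%R) divzMDl -?lt0n //.
by rewrite addrAC subrr add0r.
Qed.
End Logic.

(** * The program *)

Declare Scope ram_scope.
Delimit Scope ram_scope with ram.
Bind Scope ram_scope with expr cmd.
Notation "a [+] b" := (Bi OpAdd a b) (at level 50, left associativity) : ram_scope.
Notation "a [-] b" := (Bi OpSub a b) (at level 50, left associativity) : ram_scope.
Notation "a [*] b" := (Bi OpMul a b) (at level 40, left associativity) : ram_scope.
Notation "a [/] b" := (Bi OpDiv a b) (at level 40, left associativity) : ram_scope.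
Notation "a [%] b" := (Bi OpMod a b) (at level 40, left associativity) : ram_scope.
Notation "a [<] b" := (Bi OpLt a b) (at level 70, no associativity) : ram_scope.
Notation "a [=] b" := (Bi OpEq a b) (at level 70, no associativity) : ram_scope.
Notation "x <-- e" := (Asg x e) (at level 85) : ram_scope.
Notation "c1 ;; c2" := (Sq c1 c2) (at level 90, right associativity) : ram_scope.
Coercion Vr : nat >-> expr.

(* [rX] holds the scale [X] of the fixed point numbers; adding [rXO] (that is
   [X ^ 3]) before a division by [X] and subtracting [rOFF] (that is [X ^ 2])
   after it makes the unsigned division round signed numbers down. *)
Notation rn := 0 (only parsing).
Notation rm := 1 (only parsing).
Notation rN := 2 (only parsing).
Notation rl := 3 (only parsing).
Notation rLn := 4 (only parsing).
Notation rY := 5 (only parsing).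
Notation rX := 6 (only parsing).
Notation rOFF := 7 (only parsing).
Notation rXO := 8 (only parsing).
Notation rhN := 9 (only parsing).
Notation rnb := 10 (only parsing).
Notation rD := 11 (only parsing).
Notation rK := 12 (only parsing).
Notation rreps := 13 (only parsing).
Notation rS := 14 (only parsing).
Notation rHALF := 15 (only parsing).
Notation rNX := 16 (only parsing).
Notation rm1 := 17 (only parsing).
Notation rK1 := 18 (only parsing).
Notation ri := 20 (only parsing).
Notation rt := 21 (only parsing).
Notation rh := 22 (only parsing).
Notation rb := 23 (only parsing).
Notation rs := 24 (only parsing).
Notation rrep := 25 (only parsing).
Notation rr := 26 (only parsing).
Notation rp := 27 (only parsing).
Notation rj := 28 (only parsing).
Notation rdeg := 29 (only parsing).
Notation ra := 30 (only parsing).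
Notation rx := 31 (only parsing).
Notation ru := 32 (only parsing).
Notation rq := 33 (only parsing).
Notation rbit := 34 (only parsing).
Notation rarg := 35 (only parsing).
Notation riq := 36 (only parsing).
Notation rBt := 37 (only parsing).
Notation rzc := 38 (only parsing).
Notation rzs := 39 (only parsing).
Notation rpw := 40 (only parsing).
(* [aHC] holds the colours of the pattern characters and [aBAD] the mismatches
   found.  A cell of [aF] is set iff it holds the number of the current
   repetition, which saves clearing the array. *)
Notation aT := 0 (only parsing).
Notation aP := 1 (only parsing).
Notation aXR := 2 (only parsing).
Notation aXI := 3 (only parsing).
Notation aYR := 4 (only parsing).
Notation aYI := 5 (only parsing).
Notation aBR := 6 (only parsing).
Notation aBI := 7 (only parsing).
Notation aUR := 8 (only parsing).
Notation aUI := 9 (only parsing).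
Notation aA := 10 (only parsing).
Notation aB := 11 (only parsing).
Notation aBAD := 12 (only parsing).
Notation aHC := 13 (only parsing).
Notation aF := 14 (only parsing).
Notation aFO := 15 (only parsing).
Notation aSEEN := 16 (only parsing).

Definition rndE (e : expr) : expr := ((e [+] rXO) [/] rX [-] rOFF)%ram.
Definition mulre (ar ai br bi : expr) : expr := rndE (ar [*] br [-] ai [*] bi)%ram.
Definition mulim (ar ai br bi : expr) : expr := rndE (ar [*] bi [+] ai [*] br)%ram.

Definition fill2 (b : expr) (y xr xi : nat) (er ei : expr) : cmd :=
  (fill ri y aYR (Cs 0) er ;; fill ri y aYI (Cs 0) ei ;;
   fill ri y xr b (Rd aYR ri) ;; fill ri y xi b (Rd aYI ri))%ram.

Arguments fill2 : simpl never.

Definition sideE : expr := ((ri [/] rh) [%] Cs 2)%ram.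
Definition nodeE : expr := (ri [/] (rh [+] rh))%ram.
Definition i0E : expr := (ri [-] sideE [*] rh)%ram.
Definition i1E : expr := (i0E [+] rh)%ram.

Definition fwdE (z : expr) (p : expr) : expr :=
  (z [+] (Cs 1 [-] Cs 2 [*] sideE) [*] p)%ram.
Definition fwdRe (xr xi : nat) : expr :=
  fwdE (Rd xr i0E) (mulre (Rd aUR nodeE) (Rd aUI nodeE) (Rd xr i1E) (Rd xi i1E)).
Definition fwdIm (xr xi : nat) : expr :=
  fwdE (Rd xi i0E) (mulim (Rd aUR nodeE) (Rd aUI nodeE) (Rd xr i1E) (Rd xi i1E)).
Definition fwdC (xr xi : nat) : cmd :=
  (rh <-- rN ;;
   For rt rl (
     rh <-- rh [/] Cs 2 ;;
     fill2 (Cs 0) rN xr xi (fwdRe xr xi) (fwdIm xr xi)))%ram.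

Definition bwdE (p q : expr) : expr :=
  (sideE [*] p [+] (Cs 1 [-] sideE) [*] q)%ram.
Definition bwdRe (xr xi : nat) : expr :=
  bwdE (mulre (Rd aUR nodeE) (Cs 0 [-] Rd aUI nodeE)
              (Rd xr i0E [-] Rd xr i1E) (Rd xi i0E [-] Rd xi i1E))
       (Rd xr i0E [+] Rd xr i1E).
Definition bwdIm (xr xi : nat) : expr :=
  bwdE (mulim (Rd aUR nodeE) (Cs 0 [-] Rd aUI nodeE)
              (Rd xr i0E [-] Rd xr i1E) (Rd xi i0E [-] Rd xi i1E))
       (Rd xi i0E [+] Rd xi i1E).
Definition bwdC (xr xi : nat) : cmd :=
  (rh <-- Cs 1 ;;
   For rt rl (
     fill2 (Cs 0) rN xr xi (bwdRe xr xi) (bwdIm xr xi) ;;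
     rh <-- rh [+] rh))%ram.

Definition blockC : cmd :=
  (fill ri rN aXR (Cs 0) (rX [*] Rd aA (rs [+] ri)) ;;
   fill ri rN aXI (Cs 0) (Cs 0) ;;
   fwdC aXR aXI ;;
   fill2 (Cs 0) rN aXR aXI
     (mulre (Rd aXR ri) (Rd aXI ri) (Rd aBR ri) (Rd aBI ri))
     (mulim (Rd aXR ri) (Rd aXI ri) (Rd aBR ri) (Rd aBI ri)) ;;
   bwdC aXR aXI ;;
   fill ri rhN aYR (Cs 0)
     (Cs 0 [<] Rd aBAD (rs [+] ri) [+] (((Rd aXR (ri [+] rm1) [+] rHALF) [<] rNX) [=] Cs 0)) ;;
   fill ri rhN aBAD rs (Rd aYR ri))%ram.

(* Sets the cell [i] of [aBAD] if [aA] and [aB], of which the latter holds a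
   reversed pattern, have a common bit at offset [i]. *)
Definition convC : cmd :=
  (fill ri rN aBR (Cs 0) (rX [*] Rd aB ri) ;;
   fill ri rN aBI (Cs 0) (Cs 0) ;;
   fwdC aBR aBI ;;
   rs <-- Cs 0 ;;
   For rb rnb (blockC ;; rs <-- rs [+] rhN))%ram.

Definition notE (e : expr) : expr := (e [=] Cs 0)%ram.

Definition drawC : cmd :=
  For rj rm (Rnd rx ;; Wr aHC (Rd aP rj) (rx [%] rK [+] Cs 1))%ram.
Definition markC : cmd :=
  For rp rn (rdeg <-- QD (Rd aT rp) ;;
    If (notE (rD [<] rdeg))
      (For rj rdeg (Wr aF (rp [*] rK1 [+] Rd aHC (QN (Rd aT rp) rj)) (rrep [+] Cs 1))))%ram.
Definition lightA : expr :=
  (notE (rD [<] QD (Rd aT ri)) [*]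
   notE (Rd aF (ri [*] rK1 [+] (rr [+] Cs 1)) [=] (rrep [+] Cs 1)))%ram.
Definition lightB : expr := (Rd aHC (Rd aP (rm1 [-] ri)) [=] (rr [+] Cs 1))%ram.
Definition heavyA : expr := (Rd aT ri [=] ra)%ram.
Definition heavyB : expr := notE (QM ra (Rd aP (rm1 [-] ri))%ram).
Definition roundC (ea eb : expr) : cmd :=
  (fill ri rn aA (Cs 0) ea ;; fill ri rm aB (Cs 0) eb ;; convC)%ram.
Definition classC : cmd := For rr rK (roundC lightA lightB).
Definition lightC : cmd := For rrep rreps (drawC ;; markC ;; classC)%ram.
Definition heavyC : cmd :=
  For rp rn (If (Rd aFO rp) (If (rD [<] QD (Rd aT rp)) (
    ra <-- Rd aT rp ;; roundC heavyA heavyB)))%ram.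
Definition outC : cmd :=
  (ru <-- rn [-] rm [+] Cs 1 ;;
   For rp ru (If (notE (Rd aBAD rp)) (Ou rp)))%ram.

Definition logC (x lx z : nat) : cmd :=
  (x <-- Cs 1 ;; lx <-- Cs 0 ;;
   For riq rn (If (x [<] (z [+] z)) (x <-- x [+] x ;; lx <-- lx [+] Cs 1)))%ram.

Fixpoint powE (e : nat) : expr :=
  if e is e'.+1 then (powE e' [*] rY)%ram else Cs 1.

Definition isqrtC : cmd :=
  (rq <-- Cs 0 ;; rbit <-- rX ;;
   For riq rBt (
     rbit <-- rbit [/] Cs 2 ;; ru <-- rq [+] rbit ;;
     If (notE (rarg [<] (ru [*] ru))) (rq <-- ru)))%ram.

Definition copyC : cmd :=
  (For ri rn (Wr aT ri (Rw ri)) ;; For ri rm (Wr aP ri (Rw (rn [+] ri))))%ram.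

Definition constC (e : nat) : cmd :=
  (logC rN rl rm ;; logC rY rLn rn ;;
   rX <-- powE e ;; rBt <-- Cs e [*] rLn ;; rOFF <-- rX [*] rX ;; rXO <-- rX [*] rOFF ;;
   rhN <-- rN [/] Cs 2 ;; rnb <-- rn [/] rhN [+] Cs 1 ;; rHALF <-- rhN [*] rX ;;
   rNX <-- rN [*] rX ;; rm1 <-- rm [-] Cs 1)%ram.

Definition firstC : cmd :=
  For rp rn (If (notE (Rd aSEEN (Rd aT rp))) (
    Wr aSEEN (Rd aT rp) (Cs 1) ;; Wr aFO rp (Cs 1) ;; rS <-- rS [+] QD (Rd aT rp)))%ram.

Definition paramC (cc : nat) : cmd :=
  (rS <-- Cs 0 ;; firstC ;; rarg <-- rS [/] rLn ;; isqrtC ;; rD <-- rq ;;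
   rK <-- Cs 4 [*] rD [+] Cs 1 ;; rK1 <-- rK [+] Cs 1 ;; rreps <-- Cs 1 ;;
   If rD (rreps <-- Cs cc [*] rLn))%ram.

Definition seedC : cmd :=
  (rarg <-- (rX [*] rX [+] rX [*] rzc) [/] Cs 2 ;; isqrtC ;;
   rzs <-- (rzs [*] rX) [/] (rq [+] rq) ;; rzc <-- rq ;; rpw <-- rpw [+] rpw)%ram.

Definition tableC : cmd :=
  (rzc <-- Cs 0 ;; rzs <-- rX ;; rpw <-- Cs 1 ;; Wr aUR (Cs 0) rX ;; Wr aUI (Cs 0) (Cs 0) ;;
   For rt rl (
     fill2 rpw rpw aUR aUI (mulre (Rd aUR ri) (Rd aUI ri) rzc rzs)
                           (mulim (Rd aUR ri) (Rd aUI ri) rzc rzs) ;;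
     seedC))%ram.

Definition gpmC (e cc : nat) : cmd :=
  (copyC ;; constC e ;; paramC cc ;; tableC ;; lightC ;; heavyC ;; outC)%ram.

Section FillPair.
Variables (w n : nat) (O : oracle) (Lm : nat).
Local Notation W := (2 ^ w).
Hypothesis w5 : 5 <= w.
Hypothesis LmW : Lm * 32 + 32 + n + n <= W.
Local Notation ev := (ev w n O).
Local Notation den := (den w n O).
Local Notation ar := (ar w n).
Local Notation wd := (wd w).

Lemma ar_setr s x v k id i : ar (setr s x v k) id i = ar s id i.
Proof. by []. Qed.

Lemma rg_setr s x v k : rg (setr s x v k) x = v.
Proof. by rewrite /= /upd eqxx. Qed.

Lemma ev_fr s s1 i j e : (forall x, x != i -> rg s1 x = rg s x) ->
  (forall id k, id < 32 -> id \in earrs e -> ar s1 id k = ar s id k) -> noraw e ->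
  ev (setr s1 i j 0) e = ev (setr s i j 0) e.
Proof.
move=> h1 h2 ne; apply: (ev_ext O ne) => [x _|id k hid hx].
  by rewrite /= /upd; case: eqP => [//|/eqP /h1].
by rewrite !ar_setr h2.
Qed.

Lemma fill_frame y id b e s B f :
  cwf (fill ri y id b e) -> noraw b -> noraw e -> id \notin earrs b -> id \notin earrs e ->
  (forall j, j < rg s y -> ev (setr s ri j 0) b = B /\ ev (setr s ri j 0) e = f j) ->
  B + rg s y <= Lm ->
  exists s', [/\ s' = den (fill ri y id b e) s,
     forall x, x != ri -> rg s' x = rg s x,
     forall id' k, id' < 32 -> id' != id -> ar s' id' k = ar s id' k,
     forall k, k < Lm -> ar s' id k = if B <= k < B + rg s y then f (k - B) else ar s id k &
     ck s' = ck s + 2 + rg s y * (esz b + esz e + 13)].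
Proof.
move=> wf h1 h2 h3 h4 h5 h6.
have [a1 _ a3] := fill_spec w5 LmW wf h1 h2 h3 h4 h5 h6.
exists (den (fill ri y id b e) s); split=> // [x xi|id' k hid ne].
  by rewrite den_rg //= inE.
by rewrite den_ar //= inE.
Qed.

Lemma fill2_spec b y xr xi er ei s B c fre fim :
  cwf (fill2 b y xr xi er ei) -> noraw b -> noraw er -> noraw ei ->
  earrs b = [::] -> 
  [&& aYR \notin earrs er, aYR \notin earrs ei & aYI \notin earrs ei] ->
  [&& xr != xi, aYR != xr, aYR != xi, aYI != xr & aYI != xi] ->
  rg s y = c -> c <= Lm -> B + c <= Lm ->
  (forall j, j < c -> [/\ ev (setr s ri j 0) b = B, ev (setr s ri j 0) er = fre j
                        & ev (setr s ri j 0) ei = fim j]) ->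
  let s' := den (fill2 b y xr xi er ei) s in
  [/\ forall k, k < Lm -> ar s' xr k = if B <= k < B + c then fre (k - B) else ar s xr k,
      forall k, k < Lm -> ar s' xi k = if B <= k < B + c then fim (k - B) else ar s xi k &
      ck s' = ck s + 8 + c * (esz er + esz ei + 2 * esz b + 70)].
Proof.
case/and4P=> w1 w2 w3 w4 nb nr ni eb /and3P[q1 q2 q3] /and5P[p1 p2 p3 p4 p5].
move=> yc cL BL H.
have W0 : 0 < 2 ^ w by rewrite expn_gt0.
have yi : y != ri by case/and5P: w1.
have z0 s0 : ev s0 (Cs 0) = 0 by rewrite /= mod0n.
have xr32 : xr < 32 by case/and5P: w3 => _ _ _ _ /and3P[_ _ /and3P[]].
have xi32 : xi < 32 by case/and5P: w4 => _ _ _ _ /and3P[_ _ /and3P[]].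
have [||s1 [E1 r1 o1 a1 k1]] := @fill_frame y aYR (Cs 0) er s 0 fre w1 isT nr isT q1 _ _.
- by move=> j; rewrite yc => /H[_ h _]; split; [exact: z0|].
- by rewrite yc.
have y1 : rg s1 y = c by rewrite r1.
have [||s2 [E2 r2 o2 a2 k2]] := @fill_frame y aYI (Cs 0) ei s1 0 fim w2 isT ni isT q3 _ _.
- move=> j; rewrite y1 => /H[_ _ hi]; split; first exact: z0.
  rewrite (ev_fr j r1) // => id k h1 h2; rewrite o1 //.
  by apply/eqP => E; move: q2; rewrite -E h2.
- by rewrite y1.
have y2 : rg s2 y = c by rewrite r2.
have b2 j : ev (setr s2 ri j 0) b = ev (setr s ri j 0) b.
  by rewrite (ev_fr j r2) ?eb // (ev_fr j r1) ?eb.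
have [||||s3 [E3 r3 o3 a3 k3]] := @fill_frame y xr b (Rd aYR (Vr ri)) s2 B fre w3 nb isT _ _ _ _.
- by rewrite eb.
- by rewrite inE eq_sym.
- move=> j; rewrite y2 => jc; split; first by rewrite b2; case: (H _ jc).
  apply: (ev_rd (@ev_vr w n O _ _ _ (rg_setr s2 ri j 0))); rewrite ar_setr o2 // a1; last exact: leq_trans cL.
  by rewrite yc add0n jc subn0.
- by rewrite y2.
have y3 : rg s3 y = c by rewrite r3.
have [||||s4 [E4 r4 o4 a4 k4]] := @fill_frame y xi b (Rd aYI (Vr ri)) s3 B fim w4 nb isT _ _ _ _.
- by rewrite eb.
- by rewrite inE eq_sym.
- move=> j; rewrite y3 => jc; split; first by rewrite (ev_fr j r3) ?eb // b2; case: (H _ jc).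
  apply: (ev_rd (@ev_vr w n O _ _ _ (rg_setr s3 ri j 0))); rewrite ar_setr o3 // a2; last exact: leq_trans cL.
  by rewrite y1 add0n jc subn0.
- by rewrite y3.
have -> : den (fill2 b y xr xi er ei) s = s4 by rewrite E4 E3 E2 E1.
split.
- move=> k kL; rewrite o4 // a3 // y2; case: ifP => // _.
  by rewrite o2 1?eq_sym // o1 1?eq_sym.
- move=> k kL; rewrite a4 // y3; case: ifP => // _.
  by rewrite o3 1?eq_sym // o2 1?eq_sym // o1 1?eq_sym.
- by rewrite k4 k3 k2 k1 yc y1 y2 y3 /=; move: (esz er) (esz ei) (esz b) (ck s) => p q r t; clear; lia.
Qed.
End FillPair.

(** * One correlation *)

Section Crossing.
Variables (l m : nat).
Local Notation N := (2 ^ l).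
Local Notation hN := (2 ^ l.-1).
Hypothesis l0 : 0 < l.
Hypothesis m0 : 0 < m.
Hypothesis mN : m <= hN.

Lemma N_half : N = hN + hN. Proof. by rewrite addnn -mul2n -expnS prednK. Qed.

Definition crossing (a b : nat -> bool) (p : nat) : bool :=
  [exists j : 'I_m, a (p + j) && b (m.-1 - j)].

Lemma hits_crossing (a b : nat -> bool) e : (forall q, b q -> q < m) -> e < hN ->
  (0 < hits l a b (e + m.-1)) = crossing a b e.
Proof.
move=> bm eh; have Nh := N_half; rewrite lt0n /hits sum_nat_eq0 negb_forall.
apply/existsP/existsP => [[p]|[j /andP[aj bj]]].
  rewrite sum_nat_eq0 negb_forall => /existsP[q]; rewrite negb_imply => /andP[/eqP E].
  rewrite eqb0 negbK => /andP[ap bq]; have qm := bm _ bq.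
  have pE : p + q = e + m.-1 :> nat.
    have pN := ltn_ord p; have : p + q < N + N by rewrite -addSn leq_add // ltnW.
    case: (ltnP (p + q) N) => H1; first by rewrite modn_small in E.
    move=> H2; move: E; rewrite -(subnK H1) modnDr modn_small; last by lia.
    by lia.
  have jm : m.-1 - q < m by lia.
  exists (Ordinal jm) => /=.
  have -> : e + (m.-1 - q) = p by lia.
  have -> : m.-1 - (m.-1 - q) = q by lia.
  by rewrite ap bq.
have pN : e + j < N by have := ltn_ord j; lia.
have qN : m.-1 - j < N by lia.
exists (Ordinal pN); rewrite sum_nat_eq0 negb_forall; apply/existsP.
exists (Ordinal qN); rewrite negb_imply /= aj bj andbT; apply/eqP.
by have := ltn_ord j => jm; rewrite modn_small; lia.
Qed.

End Crossing.

Section Conv.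
Variables (w n : nat) (O : oracle) (Lm : nat).
Local Notation W := (2 ^ w).
Hypothesis w5 : 5 <= w.
Hypothesis LmW : Lm * 32 + 32 + n + n <= W.
Local Notation ev := (ev w n O).
Local Notation den := (den w n O).
Local Notation ar := (ar w n).
Local Notation wd := (wd w).
Variable R : rcfType.
Variables (X l m nb : nat).
Local Notation N := (2 ^ l).
Local Notation hN := (2 ^ l.-1).
Hypothesis l0 : 0 < l.
Hypothesis XN : N ^ 40 <= X.
Hypothesis XW : 4 * (X * (X * X)) <= W.
Hypothesis NL : nb * hN + N <= Lm.
Hypothesis m0 : 0 < m.
Hypothesis mN : m <= hN.

Record consts (s : hst) : Prop := Consts {
  c_N : rg s rN = N; c_l : rg s rl = l; c_X : rg s rX = X; c_OFF : rg s rOFF = X * X;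
  c_XO : rg s rXO = X * (X * X); c_hN : rg s rhN = hN; c_nb : rg s rnb = nb;
  c_HALF : rg s rHALF = hN * X; c_NX : rg s rNX = N * X; c_m1 : rg s rm1 = m.-1 }.

Definition parr (s : hst) (xr xi : nat) (x : nat -> zpair) : Prop :=
  forall i, i < N -> ar s xr i = wd (x i).1 /\ ar s xi i = wd (x i).2.

Definition cregs := [:: rN; rl; rX; rOFF; rXO; rhN; rnb; rHALF; rNX; rm1].

Lemma consts_frame s t : (forall x, x \in cregs -> rg t x = rg s x) -> consts s -> consts t.
Proof. by move=> H; case=> *; split; rewrite H. Qed.

Lemma parr_frame s t xr xi x : (forall i, ar t xr i = ar s xr i) ->
  (forall i, ar t xi i = ar s xi i) -> parr s xr xi x -> parr t xr xi x.
Proof. by move=> h1 h2 H i iN; rewrite h1 h2; apply: H. Qed.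

Lemma X_ge1000 : 1000 <= X. Proof. exact: X_big l0 XN. Qed.

Lemma N_ge2 : 2 <= N. Proof. by rewrite -{1}(expn1 2) leq_exp2l. Qed.

Lemma X_pow j k : j + k <= 40 -> 2 ^ j * N ^ k <= X.
Proof.
move=> jk; apply: leq_trans XN.
apply: (@leq_trans (N ^ (j + k))); last by rewrite leq_pexp2l ?expn_gt0.
rewrite expnD leq_mul2r; apply/orP; right.
by case: j jk => // j _; rewrite leq_exp2r // N_ge2.
Qed.

Lemma X_lt_W k : k <= X * X -> k < W.
Proof.
move=> kX; apply: leq_trans XW; apply: leq_ltn_trans kX _.
have := X_ge1000; move: X => x; clear; nia.
Qed.

Lemma N_le_X : N <= X. Proof. by have := @X_pow 0 1 isT; rewrite mul1n expn1. Qed.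

Definition small2 (a : zpair) : Prop :=
  (`|a.1| <= (2 * (X * N ^ 8))%N%:Z /\ `|a.2| <= (2 * (X * N ^ 8))%N%:Z)%R.

Lemma small_small2 a : small_int X l a -> small2 a.
Proof. by case=> h1 h2; split; [apply: le_trans h1 _ | apply: le_trans h2 _]; lia. Qed.

Lemma small_sub a b : small_int X l a -> small_int X l b -> small2 (psub a b).
Proof.
case=> h1 h2 [k1 k2]; rewrite /small2 /=; move: h1 h2 k1 k2.
move: (X * N ^ 8) => B; case: a b => [a1 a2] [b1 b2] /=; clear; lia.
Qed.

Lemma tab_small_int v : v < N -> small_int X l (tab X l v).
Proof.
move=> vN; have [h1 h2] := tab_small R l0 XN vN.
have : 2 * X <= X * N ^ 8.
  rewrite mulnC leq_mul2l; apply/orP; right; apply: leq_trans N_ge2 _.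
  by rewrite -{1}(expn1 N) leq_pexp2l ?expn_gt0.
by move=> h; split; [apply: le_trans h1 _ | apply: le_trans h2 _]; rewrite lez_nat.
Qed.

Lemma mul_bound (x y z t : int) : (`|x| <= (X * N ^ 8)%N%:Z)%R -> (`|z| <= (X * N ^ 8)%N%:Z)%R ->
  (`|y| <= (2 * (X * N ^ 8))%N%:Z)%R -> (`|t| <= (2 * (X * N ^ 8))%N%:Z)%R ->
  (`|x * y + z * t| < (X * (X * X))%N%:Z)%R.
Proof.
have H : 8 * (N ^ 8 * N ^ 8) <= X by rewrite -expnD (@X_pow 3 16).
have X0 : 0 < X by apply: leq_trans X_ge1000.
move=> h1 h2 h3 h4; apply: le_lt_trans (ler_normD _ _) _; rewrite !normrM.
apply: (@le_lt_trans _ _ ((X * N ^ 8) * (2 * (X * N ^ 8)) + (X * N ^ 8) * (2 * (X * N ^ 8)))%N%:Z).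
  by rewrite PoszD !PoszM; apply: lerD; apply: ler_pM => //; rewrite -?PoszM.
rewrite ltz_nat; move: (N ^ 8) H => B H.
have -> : X * B * (2 * (X * B)) + X * B * (2 * (X * B)) = X * (X * (4 * (B * B))) by ring.
by rewrite !ltn_pmul2l //; move: (B * B) H X0; clear; lia.
Qed.

Lemma ev_mulre s ea eb ec ed a b : consts s ->
  ev s ea = wd a.1 -> ev s eb = wd a.2 -> ev s ec = wd b.1 -> ev s ed = wd b.2 ->
  small_int X l a -> small2 b ->
  ev s (mulre ea eb ec ed) = wd (pmul X a b).1.
Proof.
move=> cs h1 h2 h3 h4 [a1 a2] [b1 b2].
apply: (ev_rnd w5 LmW _ (c_X cs) (c_OFF cs) (c_XO cs)).
- exact: ev_subz (ev_mulz h1 h3) (ev_mulz h2 h4).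
- exact: leq_trans X_ge1000.
- exact: X_lt_W.
- by apply: leq_trans XW; move: (X * _); clear; lia.
- by rewrite -mulNr; apply: mul_bound; rewrite ?normrN.
Qed.

Lemma ev_mulim s ea eb ec ed a b : consts s ->
  ev s ea = wd a.1 -> ev s eb = wd a.2 -> ev s ec = wd b.1 -> ev s ed = wd b.2 ->
  small_int X l a -> small2 b ->
  ev s (mulim ea eb ec ed) = wd (pmul X a b).2.
Proof.
move=> cs h1 h2 h3 h4 [a1 a2] [b1 b2].
apply: (ev_rnd w5 LmW _ (c_X cs) (c_OFF cs) (c_XO cs)).
- exact: ev_addz (ev_mulz h1 h4) (ev_mulz h2 h3).
- exact: leq_trans X_ge1000.
- exact: X_lt_W.
- by apply: leq_trans XW; move: (X * _); clear; lia.
- exact: mul_bound.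
Qed.

Lemma ev_index s j h : rg s ri = j -> rg s rh = h -> 0 < h -> h <= N -> j < N ->
  bi0 h j + h < N ->
  [/\ ev s sideE = bside h j, ev s nodeE = bnode h j, ev s i0E = bi0 h j
    & ev s i1E = bi0 h j + h].
Proof.
move=> e1 e2 h0 hN' jN bN; have NX := N_le_X.
have NW k : k <= N + N -> k < W.
  by move=> kN; apply: X_lt_W; have := X_ge1000; move: NX kN; clear; nia.
have E1 : ev s sideE = bside h j.
  rewrite /bside -modn2; apply: ev_modn; last by apply: NW; have := leq_div j h; lia.
    by apply: ev_divn => //; apply: NW; lia.
  by apply: ev_cst; apply: NW; have := N_ge2; lia.
have E2 : ev s i0E = bi0 h j.
  have hj : bside h j * h <= j.
    by rewrite (leq_trans _ (leq_trunc_div j h)) // leq_mul2r; apply/orP; right;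
      rewrite /bside -modn2 leq_mod.
  apply: ev_subn => //; last by rewrite hj NW //; lia.
  by apply: ev_muln => //; apply: NW; lia.
split=> //.
- rewrite /bnode -addnn; apply: ev_divn => //; last by apply: NW; lia.
  by apply: ev_addn => //; apply: NW; lia.
- by apply: ev_addn => //; apply: NW; lia.
Qed.

Lemma ev_cstz s k : k <= X -> ev s (Cs k) = wd k%:Z.
Proof.
move=> kX; have kW : k < W by apply: X_lt_W; have := X_ge1000; move: kX; clear; nia.
by rewrite wd_nat // ev_cst.
Qed.

Lemma X_ge2 : 2 <= X. Proof. exact: leq_trans X_ge1000. Qed.

Lemma wd_bool (b : bool) : (b : nat) = wd (b : nat)%:Z.
Proof.
by rewrite wd_nat //; apply: X_lt_W; apply: leq_trans (leq_b1 _) _; rewrite muln_gt0 (ltnW X_ge2).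
Qed.

Lemma ev_fwdE s h j z p a q : ev s sideE = bside h j -> ev s z = wd a -> ev s p = wd q ->
  ev s (fwdE z p) = wd (a + (if bside h j then - q else q))%R.
Proof.
move=> E1 E2 E3; rewrite wd_bool in E1.
have one := ev_cstz s (ltnW X_ge2); have two := ev_cstz s X_ge2.
rewrite (ev_addz E2 (ev_mulz (ev_subz one (ev_mulz two E1)) E3)).
by congr wd; case: (bside h j) => /=; ring.
Qed.

Lemma ev_bwdE s h j p q a b : ev s sideE = bside h j -> ev s p = wd a -> ev s q = wd b ->
  ev s (bwdE p q) = wd (if bside h j then a else b).
Proof.
move=> E1 E2 E3; rewrite wd_bool in E1; have one := ev_cstz s (ltnW X_ge2).
rewrite (ev_addz (ev_mulz E1 E2) (ev_mulz (ev_subz one E1) E3)).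
by congr wd; case: (bside h j) => /=; ring.
Qed.

Lemma bi0_bound h k j : h = 2 ^ k -> k < l -> j < N -> bi0 h j + h < N.
Proof. by move=> -> kl jN; apply: bi0_lt => //; [apply: pow2_half | rewrite expn_gt0]. Qed.

Lemma ev_fwd s xr xi x j k : consts s -> parr s xr xi x ->
  parr s aUR aUI (tab X l) ->
  (forall i, i < N -> small_int X l (x i)) -> k < l -> rg s rh = 2 ^ k -> j < N -> rg s ri = j ->
  ev s (fwdRe xr xi) = wd (zfwd X (tab X l) (2 ^ k) x j).1 /\
  ev s (fwdIm xr xi) = wd (zfwd X (tab X l) (2 ^ k) x j).2.
Proof.
move=> cs px pU sx kl eh jN ej.
have B := bi0_bound erefl kl jN; have B0 : bi0 (2 ^ k) j < N by apply: leq_ltn_trans B; apply: leq_addr.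
have Bn := @bnode_lt (2 ^ k) j N jN.
have kN : 2 ^ k <= N by rewrite leq_exp2l // ltnW.
have [E1 E2 E3 E4] := ev_index ej eh (expn_gt0 2 k) kN jN B.
have [x0r x0i] := px _ B0; have [x1r x1i] := px _ B; have [ur ui] := pU _ Bn.
have sU := tab_small_int Bn; have s1 := small_small2 (sx _ B).
have M1 := ev_mulre cs (ev_rd E2 ur) (ev_rd E2 ui) (ev_rd E4 x1r) (ev_rd E4 x1i) sU s1.
have M2 := ev_mulim cs (ev_rd E2 ur) (ev_rd E2 ui) (ev_rd E4 x1r) (ev_rd E4 x1i) sU s1.
rewrite (ev_fwdE E1 (ev_rd E3 x0r) M1) (ev_fwdE E1 (ev_rd E3 x0i) M2).
by rewrite /zfwd; case: (bside _ j).
Qed.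

Lemma ev_bwd s xr xi x j k : consts s -> parr s xr xi x ->
  parr s aUR aUI (tab X l) ->
  (forall i, i < N -> small_int X l (x i)) -> k < l -> rg s rh = 2 ^ k -> j < N -> rg s ri = j ->
  ev s (bwdRe xr xi) = wd (zbwd X (tab X l) (2 ^ k) x j).1 /\
  ev s (bwdIm xr xi) = wd (zbwd X (tab X l) (2 ^ k) x j).2.
Proof.
move=> cs px pU sx kl eh jN ej.
have B := bi0_bound erefl kl jN; have B0 : bi0 (2 ^ k) j < N by apply: leq_ltn_trans B; apply: leq_addr.
have Bn := @bnode_lt (2 ^ k) j N jN.
have kN : 2 ^ k <= N by rewrite leq_exp2l // ltnW.
have [E1 E2 E3 E4] := ev_index ej eh (expn_gt0 2 k) kN jN B.
have [x0r x0i] := px _ B0; have [x1r x1i] := px _ B; have [ur ui] := pU _ Bn.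
have sU : small_int X l (pconj (tab X l (bnode (2 ^ k) j))).
  by have [h1 h2] := tab_small_int Bn; split; rewrite /= ?normrN.
have s1 := small_sub (sx _ B0) (sx _ B).
have zero : ev s (Cs 0) = wd 0 by apply: ev_cstz.
have ui' := ev_subz zero (ev_rd E2 ui); rewrite sub0r in ui'.
have dr := ev_subz (ev_rd E3 x0r) (ev_rd E4 x1r); have di := ev_subz (ev_rd E3 x0i) (ev_rd E4 x1i).
have M1 := @ev_mulre s _ _ _ _ (pconj (tab X l (bnode (2 ^ k) j))) (psub (x (bi0 (2 ^ k) j)) (x (bi0 (2 ^ k) j + 2 ^ k))) cs (ev_rd E2 ur) ui' dr di sU s1.
have M2 := @ev_mulim s _ _ _ _ (pconj (tab X l (bnode (2 ^ k) j))) (psub (x (bi0 (2 ^ k) j)) (x (bi0 (2 ^ k) j + 2 ^ k))) cs (ev_rd E2 ur) ui' dr di sU s1.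
rewrite (ev_bwdE E1 M1 (ev_addz (ev_rd E3 x0r) (ev_rd E4 x1r))).
rewrite (ev_bwdE E1 M2 (ev_addz (ev_rd E3 x0i) (ev_rd E4 x1i))).
by rewrite /zbwd; case: (bside _ j).
Qed.

Definition fft_arrays (xr xi : nat) : bool :=
  ((xr == aXR) && (xi == aXI)) || ((xr == aBR) && (xi == aBI)).

Lemma N_le_Lm : N <= Lm. Proof. exact: leq_trans (leq_addl _ _) NL. Qed.

Lemma consts_setr s x v k : x \notin cregs -> consts s -> consts (setr s x v k).
Proof.
move=> xc; apply: consts_frame => z zc /=; rewrite /upd; case: eqP => // E.
by rewrite -E zc in xc.
Qed.

Lemma fwd_pass xr xi t k x : fft_arrays xr xi -> consts t -> parr t aUR aUI (tab X l) ->
  parr t xr xi x -> (forall i, i < N -> small_int X l (x i)) ->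
  k < l -> rg t rh = 2 ^ k ->
  let t' := den (fill2 (Cs 0) rN xr xi (fwdRe xr xi) (fwdIm xr xi)) t in
  parr t' xr xi (zfwd X (tab X l) (2 ^ k) x) /\ ck t' = ck t + 8 + N * 264.
Proof.
move=> fa cs pU px sx kl eh.
have NL' := N_le_Lm.
have H j : j < N -> _ /\ _ := fun jN => @ev_fwd (setr t ri j 0) xr xi x j k
  (@consts_setr t ri j 0 isT cs) px pU sx kl eh jN (rg_setr t ri j 0).
have cN := c_N cs.
have z j : ev (setr t ri j 0) (Cs 0) = 0 by rewrite /= mod0n.
have := @fill2_spec w n O Lm w5 LmW (Cs 0) rN xr xi (fwdRe xr xi) (fwdIm xr xi)
   t 0 N (fun j => wd (zfwd X (tab X l) (2 ^ k) x j).1) (fun j => wd (zfwd X (tab X l) (2 ^ k) x j).2).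
have K j (jN : j < N) := And3 (z j) (proj1 (H j jN)) (proj2 (H j jN)).
case/orP: fa => /andP[/eqP exr /eqP exi]; subst xr xi.
  case=> // a1 a2 a3; split=> [i iN|]; last by rewrite a3.
  by rewrite a1 ?a2 ?(leq_trans iN) //= subn0.
case=> // a1 a2 a3; split=> [i iN|]; last by rewrite a3.
by rewrite a1 ?a2 ?(leq_trans iN) //= subn0.
Qed.

Lemma bwd_pass xr xi t k x : fft_arrays xr xi -> consts t -> parr t aUR aUI (tab X l) ->
  parr t xr xi x -> (forall i, i < N -> small_int X l (x i)) ->
  k < l -> rg t rh = 2 ^ k ->
  let t' := den (fill2 (Cs 0) rN xr xi (bwdRe xr xi) (bwdIm xr xi)) t in
  parr t' xr xi (zbwd X (tab X l) (2 ^ k) x) /\ ck t' <= ck t + 8 + N * 700.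
Proof.
move=> fa cs pU px sx kl eh.
have NL' := N_le_Lm.
have H j : j < N -> _ /\ _ := fun jN => @ev_bwd (setr t ri j 0) xr xi x j k
  (@consts_setr t ri j 0 isT cs) px pU sx kl eh jN (rg_setr t ri j 0).
have cN := c_N cs.
have z j : ev (setr t ri j 0) (Cs 0) = 0 by rewrite /= mod0n.
have := @fill2_spec w n O Lm w5 LmW (Cs 0) rN xr xi (bwdRe xr xi) (bwdIm xr xi)
   t 0 N (fun j => wd (zbwd X (tab X l) (2 ^ k) x j).1) (fun j => wd (zbwd X (tab X l) (2 ^ k) x j).2).
have K j (jN : j < N) := And3 (z j) (proj1 (H j jN)) (proj2 (H j jN)).
case/orP: fa => /andP[/eqP exr /eqP exi]; subst xr xi.
  case=> // a1 a2 a3; split=> [i iN|]; last by rewrite a3 leq_add2l leq_mul2l /= orbT.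
  by rewrite a1 ?a2 ?(leq_trans iN) //= subn0.
case=> // a1 a2 a3; split=> [i iN|]; last by rewrite a3 leq_add2l leq_mul2l /= orbT.
by rewrite a1 ?a2 ?(leq_trans iN) //= subn0.
Qed.

Lemma consts_den c s : cwf c -> ~~ has (mem (asg c)) cregs -> consts s -> consts (den c s).
Proof.
move=> wc /hasPn h; apply: consts_frame => x xc; rewrite den_rg //; exact: h.
Qed.

Lemma parr_den c s xr xi x : cwf c -> xr < 32 -> xi < 32 -> xr \notin wrs c -> xi \notin wrs c ->
  parr s xr xi x -> parr (den c s) xr xi x.
Proof.
by move=> wc h1 h2 h3 h4; apply: parr_frame => i; rewrite (den_ar n O w5).
Qed.

Lemma fwdC_spec xr xi s x : fft_arrays xr xi -> consts s -> parr s aUR aUI (tab X l) ->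
  parr s xr xi x ->
  (forall k i, k <= l -> i < N -> small_int X l (zfwds X (tab X l) l k x i)) ->
  let s' := den (fwdC xr xi) s in
  parr s' xr xi (zfwds X (tab X l) l l x) /\ ck s' <= ck s + 4 + l * (16 + N * 264).
Proof.
move=> fa cs pU px sx.
pose c := (For rt rl (rh <-- rh [/] Cs 2 ;; fill2 (Cs 0) rN xr xi (fwdRe xr xi) (fwdIm xr xi)))%ram; pose s0 := setr s rh N 2.
have -> : den (fwdC xr xi) s = den c s0 by rewrite /s0 -(c_N cs).
have wc : cwf c by rewrite /c; case/orP: fa => /andP[/eqP -> /eqP ->].
have eql : rg s0 rl = l by rewrite -(c_l cs).
pose I k t := [/\ parr t xr xi (zfwds X (tab X l) l k x), rg t rh = 2 ^ (l - k)
   & ck t <= ck s + 4 + k * (16 + N * 264)].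
suff : I l (den c s0) by case.
rewrite -{1}eql; apply: (for_frame w5 wc) => [|k t kl tx fr fa' [I1 I2 I3]].
  by split; rewrite ?subn0 //= mul0n addn0 -addnA.
rewrite eql in kl.
have cs0 : consts s0 by apply: consts_setr.
have ct : consts t.
  by apply: consts_frame cs0 => z zc; apply: fr; move: zc; rewrite !inE; do ![case/orP => [/eqP -> //|]]; move/eqP->.
have fa2 : forall id i, id < 32 -> id \notin [:: aYR; aYI; xr; xi] -> ar t id i = ar s id i by [].
have pUt : parr t aUR aUI (tab X l).
  by apply: parr_frame pU => i; rewrite fa2 //; case/orP: fa => /andP[/eqP -> /eqP ->].
pose t1 := setr t rh (2 ^ (l - k.+1)) 4.
have E1 : den (rh <-- rh [/] Cs 2)%ram t = t1.
  rewrite /t1 /= I2; congr setr.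
  have -> : 2 %% 2 ^ w = 2 by rewrite modn_small //; apply: (leq_trans _ (W_ge32 w5)).
  rewrite (_ : l - k = (l - k.+1).+1); last by lia.
  rewrite expnS mulKn // modn_small //; apply: X_lt_W.
  have : 2 ^ (l - k.+1) <= N by rewrite leq_exp2l //; lia.
  have := N_le_X; have := X_ge1000; move: (2 ^ (l - k.+1)) N X; clear; nia.
have := @fwd_pass xr xi t1 (l - k.+1) (zfwds X (tab X l) l k x) fa.
case=> //; first exact: consts_setr.
- by move=> i iN; apply: sx => //; apply: ltnW.
- by lia.
move=> P1 P2; rewrite -E1 in P1 P2.
split.
- exact: P1.
- rewrite -[LHS]/(rg (den (fill2 (Cs 0) rN xr xi (fwdRe xr xi) (fwdIm xr xi)) (den (rh <-- rh [/] Cs 2)%ram t)) rh).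
  by rewrite den_rg // E1 rg_setr.
- rewrite -[ck _]/(ck (den (fill2 (Cs 0) rN xr xi (fwdRe xr xi) (fwdIm xr xi)) (den (rh <-- rh [/] Cs 2)%ram t)) + 4).
  rewrite P2 E1 [ck t1]/=; move: I3; rewrite mulSn; move: (2 ^ l) => M; clear; lia.
Qed.

Lemma cregs_frame c s t : ~~ has (mem (asg c)) cregs ->
  (forall z, z \notin asg c -> rg t z = rg s z) -> consts s -> consts t.
Proof. by move=> /hasPn h fr; apply: consts_frame => z zc; apply: fr; apply: h. Qed.

Lemma bwdC_spec xr xi s x : fft_arrays xr xi -> consts s -> parr s aUR aUI (tab X l) ->
  parr s xr xi x ->
  (forall k i, k <= l -> i < N -> small_int X l (zbwds X (tab X l) k x i)) ->
  let s' := den (bwdC xr xi) s in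
  parr s' xr xi (zbwds X (tab X l) l x) /\ ck s' <= ck s + 4 + l * (16 + N * 700).
Proof.
move=> fa cs pU px sx.
pose b1 := fill2 (Cs 0) rN xr xi (bwdRe xr xi) (bwdIm xr xi).
pose c := (For rt rl (b1 ;; rh <-- rh [+] rh))%ram; pose s0 := setr s rh 1 2.
have -> : den (bwdC xr xi) s = den c s0.
  have -> : s0 = setr s rh (ev s (Cs 1)) 2 by rewrite (ev_cst n O s (W_gt1 w5)).
  by [].
have wc : cwf c by rewrite /c /b1; case/orP: fa => /andP[/eqP -> /eqP ->].
have eql : rg s0 rl = l by rewrite -(c_l cs).
pose I k t := [/\ parr t xr xi (zbwds X (tab X l) k x), rg t rh = 2 ^ k
   & ck t <= ck s + 4 + k * (16 + N * 700)].
suff : I l (den c s0) by case.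
rewrite -{1}eql; apply: (for_frame w5 wc) => [|k t kl tx fr fa' [I1 I2 I3]].
  by split; rewrite ?subn0 //= mul0n addn0 -addnA.
rewrite eql in kl.
have cs0 : consts s0 by apply: consts_setr.
have ct : consts t by apply: (cregs_frame _ fr cs0).
have fa2 : forall id i, id < 32 -> id \notin [:: aYR; aYI; xr; xi] -> ar t id i = ar s id i by [].
have pUt : parr t aUR aUI (tab X l).
  by apply: parr_frame pU => i; rewrite fa2 //; case/orP: fa => /andP[/eqP -> /eqP ->].
have := @bwd_pass xr xi t k (zbwds X (tab X l) k x) fa.
case=> //; first by move=> i iN; apply: sx => //; apply: ltnW.
rewrite -/b1; move E1 : (den b1 t) => t1 P1 P2.
have e1 : rg t1 rh = 2 ^ k by rewrite -E1 den_rg.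
have E2 : den (b1 ;; rh <-- rh [+] rh)%ram t = setr t1 rh (2 ^ k.+1) 4.
  rewrite -[LHS]/(setr (den b1 t) rh (ev (den b1 t) (Vr rh [+] Vr rh)%ram) 4) E1.
  congr setr; rewrite /= e1 addnn -mul2n -expnS modn_small //; apply: X_lt_W.
  have : 2 ^ k.+1 <= N by rewrite leq_exp2l.
  have := N_le_X; have := X_ge1000; move: (2 ^ k.+1) N X; clear; nia.
rewrite E2; split.
- exact: P1.
- by [].
- rewrite [ck _]/=; move: I3 P2; rewrite mulSn; move: (2 ^ l) => M; clear; lia.
Qed.

Lemma ev_zbits s (a : nat -> bool) id e i j : consts s -> ev s e = i -> ar s id i = a j ->
  ev s (rX [*] Rd id e)%ram = wd (zbits X a j).1.
Proof.
move=> cs h1 h2; have -> : (zbits X a j).1 = (X%:Z * (a j : nat)%:Z)%R by rewrite /zbits PoszM.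
have hX : ev s rX = wd X.
  by rewrite wd_nat; [apply: c_X cs | apply: X_lt_W; have := X_ge1000; move: X; clear; nia].
apply: ev_mulz hX _; rewrite -wd_bool; exact: ev_rd h1 h2.
Qed.

Lemma ev0 s : ev s (Cs 0) = wd 0. Proof. exact: ev_cstz. Qed.

Lemma wd0 : wd 0 = 0. Proof. by rewrite wd_nat ?W_gt0. Qed.

(* Concrete registers and arrays let frame conditions be decided by computation. *)
Lemma load_spec s xr xi id e (a : nat -> bool) :
  fft_arrays xr xi -> consts s ->
  (e = rs [+] ri /\ id = aA \/ e = Vr ri /\ id = aB)%ram ->
  (forall j, j < N -> exists i, ev (setr s ri j 0) e = i /\ ar s id i = a j) ->
  let s' := den (fill ri rN xr (Cs 0) (rX [*] Rd id e) ;; fill ri rN xi (Cs 0) (Cs 0))%ram s in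
  parr s' xr xi (zbits X a) /\ ck s' <= ck s + 4 + N * 100.
Proof.
move=> fa cs he H.
have NL' := N_le_Lm.
have z j : ev (setr s ri j 0) (Cs 0) = 0 by rewrite ev0 wd0.
have [||||||| s1 [E1 r1 o1 a1 k1]] := @fill_frame w n O Lm w5 LmW rN xr (Cs 0) (rX [*] Rd id e)%ram s 0
  (fun j => wd (zbits X a j).1).
- by case/orP: fa => /andP[/eqP ? /eqP ?]; subst xr xi; case: he => -[? ?]; subst e id.
- by [].
- by case: he => -[? ?]; subst e id.
- by [].
- by case/orP: fa => /andP[/eqP ? /eqP ?]; subst xr xi; case: he => -[? ?]; subst e id.
- move=> j; rewrite (c_N cs) => jN; split=> //; have [i [h1 h2]] := H j jN.
  by apply: (ev_zbits (i := i)) => //; apply: consts_setr.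
- by rewrite (c_N cs).
have N1 : rg s1 rN = N by rewrite r1 // (c_N cs).
have [||||||| s2 [E2 r2 o2 a2 k2]] := @fill_frame w n O Lm w5 LmW rN xi (Cs 0) (Cs 0) s1 0 (fun j => 0).
- by case/orP: fa => /andP[/eqP ? /eqP ?]; subst xr xi.
- by [].
- by [].
- by [].
- by [].
- by move=> j _; rewrite ev0 wd0.
- by rewrite N1.
have -> : den (fill ri rN xr (Cs 0) (rX [*] Rd id e) ;; fill ri rN xi (Cs 0) (Cs 0))%ram s = s2.
  by rewrite E2 E1.
split.
  move=> i iN; have iL := leq_trans iN NL'; rewrite a2 // o2; first last.
  - by case/orP: fa => /andP[/eqP ? /eqP ?]; subst xr xi.
  - by case/orP: fa => /andP[/eqP ? /eqP ?]; subst xr xi.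
  by rewrite a1 // N1 (c_N cs) /= add0n iN subn0 wd0.
rewrite k2 k1 N1 (c_N cs); case: he => -[-> _] /=; move: (2 ^ l) => M; clear; lia.
Qed.

Lemma ev_mulre_arr s (x y : nat -> zpair) j : consts s -> parr s aXR aXI x -> parr s aBR aBI y ->
  j < N -> rg s ri = j -> small_int X l (x j) -> small_int X l (y j) ->
  ev s (mulre (Rd aXR ri) (Rd aXI ri) (Rd aBR ri) (Rd aBI ri)) = wd (pmul X (x j) (y j)).1 /\
  ev s (mulim (Rd aXR ri) (Rd aXI ri) (Rd aBR ri) (Rd aBI ri)) = wd (pmul X (x j) (y j)).2.
Proof.
move=> cs px py jN ej sx sy; have [xr xi] := px j jN; have [yr yi] := py j jN.
have sy2 := small_small2 sy; have e : ev s ri = j by [].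
split; [apply: ev_mulre|apply: ev_mulim]=> //; exact: ev_rd e _.
Qed.

Lemma hit_test (z : int) (c : nat) :
  (4 * `|z - (X * N * c)%N%:Z| < (N * X)%N%:Z)%R -> (`|z| <= (X * N ^ 8)%N%:Z)%R ->
  forall s e, consts s -> ev s e = wd z ->
  ev s (((e [+] rHALF) [<] rNX) [=] Cs 0)%ram = (0 < c).
Proof.
move=> H sz s e cs Ee.
have HX : 2 * (hN * X) = N * X by rewrite mulnA mul2n -addnn -(N_half l0).
have NX1 : N * X <= X * X by rewrite leq_mul2r N_le_X orbT.
have NX8 : X * N ^ 8 <= X * X.
  by rewrite leq_mul2l; apply/orP; right; have := @X_pow 0 8 isT; rewrite mul1n.
have lo : (0 <= z + (hN * X)%N%:Z)%R.
  move: H; move: HX; clear; case: c => [|c].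
    by rewrite muln0; move: (N * X) (hN * X) => p q; lia.
  rewrite mulnS [X * N]mulnC; move: (N * X) (hN * X) => p q; move: (p * c) => r; lia.
pose k := `|(z + (hN * X)%N%:Z)%R|%N.
have Ek : k%:Z = (z + (hN * X)%N%:Z)%R by rewrite /k gez0_abs.
have kW : k < W.
  apply: leq_trans XW; have := X_ge1000; have : k <= X * X + X * X.
    move: Ek sz NX8 NX1 HX; clear; move: (X * N ^ 8) (N * X) (X * X) (hN * X) => p q r t; lia.
  move=> h1 h2; apply: leq_ltn_trans h1 _; move: h2; move: (X) => x; clear; nia.
have hXW : hN * X < W.
  by apply: X_lt_W; move: HX NX1; clear; move: (N * X) (X * X) (hN * X) => q r t; lia.
have E1 : ev s (e [+] rHALF)%ram = k.
  have h : ev s rHALF = wd (hN * X)%N by rewrite wd_nat // -(c_HALF cs).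
  by rewrite (ev_addz Ee h) -Ek wd_nat.
have E2 : ev s rNX = N * X by apply: c_NX.
have E3 : ev s (Cs 0) = 0 by rewrite ev0 wd0.
rewrite (ev_eqn w5 (ev_ltn w5 E1 E2) E3) eqb0 -leqNgt; congr nat_of_bool.
move: H HX Ek; clear; case: c => [|c].
  rewrite muln0; move: (N * X) (hN * X) => p q; lia.
rewrite mulnS [X * N]mulnC; move: (N * X) (hN * X) => p q; move: (p * c) => r; lia.
Qed.

Definition shiftb (a : nat -> bool) (d i : nat) : bool := a (d + i).

Lemma blockC_spec s (a b bd : nat -> bool) d : consts s -> parr s aUR aUI (tab X l) ->
  (forall q, b q -> q < m) ->
  parr s aBR aBI (zfwds X (tab X l) l l (zbits X b)) ->
  (forall i, i < Lm -> ar s aA i = a i) -> (forall i, i < Lm -> ar s aBAD i = bd i) ->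
  rg s rs = d -> d + N <= Lm ->
  let s' := den blockC s in
  (forall p, p < Lm -> ar s' aBAD p =
     bd p || ((d <= p < d + hN) && crossing m a b p)) /\
  ck s' <= ck s + l.+1 * (N * 1500).
Proof.
move=> cs pU bm pB pA pD es dL.
have NL' := N_le_Lm; have Nh := N_half l0.
have dW i : i <= N -> d + i < W.
  by move=> iN; apply: leq_trans LmW; move: dL iN; clear; move: N => M; lia.
pose a' := shiftb a d.
set c1 := (fill ri rN aXR (Cs 0) (rX [*] Rd aA (rs [+] ri)) ;; fill ri rN aXI (Cs 0) (Cs 0))%ram.
have [|P1 K1] := @load_spec s aXR aXI aA (rs [+] ri)%ram a' isT cs (or_introl (conj erefl erefl)).
  move=> j jN; exists (d + j); split; last by rewrite pA //; apply: leq_trans dL; rewrite ltn_add2l.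
  by apply: ev_addn; [exact: es | exact: (rg_setr s ri j 0) | apply: dW; apply: ltnW].
move: P1 K1; rewrite -/c1; move E1 : (den c1 s) => s1 P1 K1.
have w1 : cwf c1 by [].
have cs1 : consts s1 by rewrite -E1; apply: consts_den.
have pU1 : parr s1 aUR aUI (tab X l) by rewrite -E1; apply: parr_den.
have [|P2 K2] := @fwdC_spec aXR aXI s1 (zbits X a') isT cs1 pU1 P1.
  by move=> k i kl iN; apply: fwd_small.
move: P2 K2; move E2 : (den (fwdC aXR aXI) s1) => s2 P2 K2.
have w2 : cwf (fwdC aXR aXI) by [].
have cs2 : consts s2 by rewrite -E2; apply: consts_den.
have pU2 : parr s2 aUR aUI (tab X l) by rewrite -E2; apply: parr_den.
have pB2 : parr s2 aBR aBI (zfwds X (tab X l) l l (zbits X b)).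
  by rewrite -E2; apply: parr_den => //; rewrite -E1; apply: parr_den.
set c3 := fill2 (Cs 0) rN aXR aXI (mulre (Rd aXR ri) (Rd aXI ri) (Rd aBR ri) (Rd aBI ri))
     (mulim (Rd aXR ri) (Rd aXI ri) (Rd aBR ri) (Rd aBI ri)).
pose prod v := pmul X (zfwds X (tab X l) l l (zbits X a') v) (zfwds X (tab X l) l l (zbits X b) v).
have H3 j : j < N -> _ /\ _ := fun jN => @ev_mulre_arr (setr s2 ri j 0) _ _ j
  (@consts_setr s2 ri j 0 isT cs2) P2 pB2 jN (rg_setr s2 ri j 0)
  (fwd_small R l0 XN a' (leqnn l) jN) (fwd_small R l0 XN b (leqnn l) jN).
have := @fill2_spec w n O Lm w5 LmW (Cs 0) rN aXR aXI
   (mulre (Rd aXR ri) (Rd aXI ri) (Rd aBR ri) (Rd aBI ri))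
   (mulim (Rd aXR ri) (Rd aXI ri) (Rd aBR ri) (Rd aBI ri)) s2 0 N
   (fun j => wd (prod j).1) (fun j => wd (prod j).2) isT isT isT isT erefl isT isT (c_N cs2) NL' NL'.
case=> [j jN|A1 A2 K3].
  have [h1 h2] := H3 j jN; split; [by rewrite ev0 wd0|exact: h1|exact: h2].
move: A1 A2 K3; rewrite -/c3; move E3 : (den c3 s2) => s3 A1 A2 K3.
have w3 : cwf c3 by [].
have cs3 : consts s3 by rewrite -E3; apply: consts_den.
have pU3 : parr s3 aUR aUI (tab X l) by rewrite -E3; apply: parr_den.
have P3 : parr s3 aXR aXI prod.
  by move=> i iN; rewrite A1 ?A2 ?(leq_trans iN) //= subn0.
have [|P4 K4] := @bwdC_spec aXR aXI s3 prod isT cs3 pU3 P3.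
  by move=> k i kl iN; apply: bwd_small.
move: P4 K4; move E4 : (den (bwdC aXR aXI) s3) => s4 P4 K4.
have w4 : cwf (bwdC aXR aXI) by [].
have cs4 : consts s4 by rewrite -E4; apply: consts_den.
have rs4 : rg s4 rs = d by rewrite -E4 den_rg // -E3 den_rg // -E2 den_rg // -E1 den_rg.
have D4 i : i < Lm -> ar s4 aBAD i = bd i.
  by move=> iL; rewrite -E4 (den_ar n O w5) // -E3 (den_ar n O w5) // -E2 (den_ar n O w5) // -E1 (den_ar n O w5) // pD.
pose f j : nat := bd (d + j) || crossing m a b (d + j).
have hNL : hN <= Lm by apply: leq_trans NL'; rewrite Nh leq_addr.
have [|||||||s5 [E5 r5 o5 a5 K5]] := @fill_frame w n O Lm w5 LmW rhN aYR (Cs 0)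
  (Cs 0 [<] Rd aBAD (rs [+] ri) [+] (((Rd aXR (ri [+] rm1) [+] rHALF) [<] rNX) [=] Cs 0))%ram s4 0 f.
- by [].
- by [].
- by [].
- by [].
- by [].
- move=> j; rewrite (c_hN cs4) => jh; split; first by rewrite ev0 wd0.
  have csj := @consts_setr s4 ri j 0 isT cs4.
  have jN : j < N by rewrite Nh ltn_addr.
  have emN : j + m.-1 < N by rewrite Nh; move: jh mN m0; clear; move: hN => h; lia.
  have NW k : k <= N -> k < W by move=> kN; apply: leq_ltn_trans (dW k kN); apply: leq_addl.
  have Ei : ev (setr s4 ri j 0) (ri [+] rm1)%ram = j + m.-1.
    by apply: ev_addn; [exact: (rg_setr s4 ri j 0)|exact: c_m1 csj|apply: NW; apply: ltnW].
  have [hr _] := P4 _ emN.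
  have T := hit_test (zconv_hits R l0 XN a' b emN) (proj1 (bwd_small R l0 XN a' b (leqnn l) emN)) csj (ev_rd Ei hr).
  have Ed : ev (setr s4 ri j 0) (Rd aBAD (rs [+] ri))%ram = bd (d + j).
    apply: (ev_rd (k := d + j)); last by rewrite ar_setr D4 //; apply: leq_trans dL; rewrite ltn_add2l.
    by apply: ev_addn; [exact: rs4|exact: (rg_setr s4 ri j 0)|apply: dW; apply: ltnW].
  have E0 : ev (setr s4 ri j 0) (Cs 0) = 0 by rewrite ev0 wd0.
  rewrite (ev_ltn w5 E0 (ev_addn Ed T _)); last first.
    by apply: leq_trans (W_ge32 w5); case: (bd _); case: (0 < _).
  rewrite /f (hits_crossing l0 m0 mN) // addn_gt0 !lt0b; congr (nat_of_bool (_ || _)).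
  by apply: eq_existsb => q; rewrite /a' /shiftb addnA.
- by rewrite (c_hN cs4).
have cs5 : consts s5 by apply: consts_frame cs4 => x xc; apply: r5; apply: contraTneq xc => ->.
have [|||||||s6 [E6 r6 o6 a6 K6]] := @fill_frame w n O Lm w5 LmW rhN aBAD rs (Rd aYR ri) s5 d f.
- by [].
- by [].
- by [].
- by [].
- by [].
- move=> j; rewrite (c_hN cs5) => jh; split; first by rewrite -rs4 -(r5 rs).
  apply: (ev_rd (k := j)); first exact: (rg_setr s5 ri j 0).
  rewrite ar_setr a5; last exact: leq_trans jh hNL.
  by rewrite (c_hN cs4) add0n jh subn0.
- by rewrite (c_hN cs5); apply: leq_trans dL; rewrite leq_add2l Nh leq_addr.
have -> : den blockC s = s6 by rewrite E6 E5 -E4 -E3 -E2 -E1.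
split.
  move=> p pL; rewrite a6 // (c_hN cs5); case: ifP => [/andP[h1 h2]|_].
    by rewrite /f subnKC.
  by rewrite o5 // D4 // orbF.
move: K1 K2 K3 K4 K5 K6; rewrite (c_hN cs4) (c_hN cs5) /=.
have := Nh; have : 0 < N by rewrite expn_gt0.
move: N hN => M h; move: (ck s) (ck s1) (ck s2) (ck s3) (ck s4) (ck s5) (ck s6) (l); clear.
move=> k0 k1 k2 k3 k4 k5 k6 L M0 Mh K1 K2 K3 K4 K5 K6.
rewrite mulSn; have : L * (16 + M * 264) + L * (16 + M * 700) <= L * (M * 1500).
  by rewrite -mulnDr leq_mul2l; apply/orP; right; lia.
move: (L * (16 + M * 264)) (L * (16 + M * 700)) (L * (M * 1500)) K2 K4; lia.
Qed.

Definition conv_cost : nat := nb.+1 * (l.+1 * (N * 1600)).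

Lemma convC_spec s (a b bd : nat -> bool) : consts s -> parr s aUR aUI (tab X l) ->
  (forall q, b q -> q < m) ->
  (forall i, i < Lm -> ar s aA i = a i) -> (forall i, i < Lm -> ar s aB i = b i) ->
  (forall i, i < Lm -> ar s aBAD i = bd i) ->
  let s' := den convC s in
  (forall p, p < Lm -> ar s' aBAD p = bd p || ((p < nb * hN) && crossing m a b p)) /\
  ck s' <= ck s + conv_cost.
Proof.
move=> cs pU bm pA pB pD.
have NL' := N_le_Lm.
set c1 := (fill ri rN aBR (Cs 0) (rX [*] Rd aB ri) ;; fill ri rN aBI (Cs 0) (Cs 0))%ram.
have [|P1 K1] := @load_spec s aBR aBI aB ri b isT cs (or_intror (conj erefl erefl)).
  move=> j jN; exists j; split; last by rewrite pB //; apply: leq_trans NL'.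
  exact: (rg_setr s ri j 0).
move: P1 K1; rewrite -/c1; move E1 : (den c1 s) => s1 P1 K1.
have w1 : cwf c1 by [].
have cs1 : consts s1 by rewrite -E1; apply: consts_den.
have pU1 : parr s1 aUR aUI (tab X l) by rewrite -E1; apply: parr_den.
have [|P2 K2] := @fwdC_spec aBR aBI s1 (zbits X b) isT cs1 pU1 P1.
  by move=> k i kl iN; apply: fwd_small.
move: P2 K2; move E2 : (den (fwdC aBR aBI) s1) => s2 P2 K2.
have w2 : cwf (fwdC aBR aBI) by [].
have cs2 : consts s2 by rewrite -E2; apply: consts_den.
have pU2 : parr s2 aUR aUI (tab X l) by rewrite -E2; apply: parr_den.
pose c4 := (For rb rnb (blockC ;; rs <-- rs [+] rhN))%ram.
have -> : den convC s = den c4 (setr s2 rs 0 2).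
  have -> : setr s2 rs 0 2 = setr s2 rs (ev s2 (Cs 0)) 2 by rewrite ev0 wd0.
  by rewrite -E2 -E1.
set s3 := setr s2 rs 0 2.
have cs3 : consts s3 by apply: consts_setr.
have nb3 : rg s3 rnb = nb by apply: c_nb cs3.
have w4 : cwf c4 by [].
have A3 id i : id < 32 -> id \notin [:: aXR; aXI; aYR; aYI; aBR; aBI] -> ar s3 id i = ar s id i.
  move=> h1; rewrite !inE !negb_or => /and5P[h2 h3 h4 h5 /andP[h6 h7]].
  by rewrite /s3 ar_setr -E2 (den_ar n O w5) ?inE ?negb_or ?h4 ?h5 ?h6 ?h7 // -E1 (den_ar n O w5) //= !inE ?negb_or ?h6 ?h7.
pose I k t := [/\ rg t rs = k * hN,
   forall p, p < Lm -> ar t aBAD p = bd p || ((p < k * hN) && crossing m a b p)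
   & ck t <= ck s2 + 4 + k * (l.+1 * (N * 1500) + 8)].
have : I nb (den c4 s3).
  rewrite -{1}nb3; apply: (for_frame w5 w4) => [|k t kl tx fr fa' [I1 I2 I3]].
    split=> //=; last by rewrite mul0n addn0 -addnA.
    by move=> p pL; rewrite orbF -[LHS]/(ar s3 aBAD p) A3 // pD.
  rewrite nb3 in kl.
  have ct : consts t by apply: (cregs_frame _ fr cs3).
  have pUt : parr t aUR aUI (tab X l).
    by apply: parr_frame pU => i; rewrite fa' // A3.
  have pBt : parr t aBR aBI (zfwds X (tab X l) l l (zbits X b)).
    by apply: parr_frame P2 => i; rewrite fa'.
  have pAt i : i < Lm -> ar t aA i = a i by move=> iL; rewrite fa' // A3 // pA.
  have dL : k * hN + N <= Lm.
    by apply: leq_trans NL; rewrite leq_add2r leq_mul2r ltnW ?orbT.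
  have [B1 B2] := @blockC_spec t a b _ _ ct pUt bm pBt pAt I2 I1 dL.
  move: B1 B2; move E5 : (den blockC t) => t1 B1 B2.
  have e5 : rg t1 rs = k * hN by rewrite -E5 den_rg.
  have e6 : rg t1 rhN = hN by rewrite -E5 den_rg // (c_hN ct).
  have -> : den (blockC ;; rs <-- rs [+] rhN)%ram t = setr t1 rs (k.+1 * hN) 4.
    rewrite -[LHS]/(setr (den blockC t) rs (ev (den blockC t) (Vr rs [+] Vr rhN)%ram) 4) E5.
    congr setr; rewrite (ev_addn (x := k * hN) (y := hN)) // -?mulSnr //.
    apply: leq_trans LmW; have : k.+1 * hN <= nb * hN by rewrite leq_mul2r kl orbT.
    by have := NL; clear; move: (k.+1 * hN) (nb * hN) N => x y z; lia.
  split.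
  - by [].
  - move=> p pL; rewrite -[LHS]/(ar t1 aBAD p) B1 // -orbA -andb_orl; congr (nat_of_bool (_ || (_ && _))).
    rewrite mulSn [hN + _]addnC; move: (k * hN) hN; clear; lia.
  - rewrite [ck _]/=; move: I3 B2; rewrite mulSn; move: (l.+1 * (N * 1500)); clear; lia.
case=> _ J2 J3; split; first exact: J2.
have N0 : 0 < N by rewrite expn_gt0.
move: K1 K2 J3; rewrite /conv_cost; move: N N0 => M M0.
move: M0 (ck s) (ck s1) (ck s2) (ck _) (l) (nb); clear; move=> M0 k0 k1 k2 k3 L B K1 K2 K3.
have H1 : L * (16 + M * 264) <= L * (M * 280) by rewrite leq_mul2l; apply/orP; right; lia.
have H2 : B * (L.+1 * (M * 1500) + 8) <= B * (L.+1 * (M * 1600)).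
  rewrite leq_mul2l; apply/orP; right; rewrite !mulSn.
  have : L * (M * 1500) <= L * (M * 1600) by rewrite leq_mul2l; apply/orP; right; lia.
  by move: (L * (M * 1500)) (L * (M * 1600)); lia.
have H3 : L * (M * 280) + L * (M * 1300) <= L * (M * 1600).
  by rewrite -mulnDr leq_mul2l; apply/orP; right; lia.
rewrite mulSn; rewrite [in X in _ <= _ + (X + _)]mulSn.
move: (L * (16 + M * 264)) (L * (M * 280)) (L * (M * 1300)) (L * (M * 1600)) (B * (L.+1 * (M * 1500) + 8)) (B * (L.+1 * (M * 1600))) H1 H2 H3 K1 K2 K3.
by lia.
Qed.
End Conv.

(** * Light and heavy rounds *)

Section Rounds.
Variables (tx px : nat -> nat) (dg : nat -> nat) (nbr mt : nat -> nat -> nat).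
Variables (n m D K : nat).

(* Colour in [1, K] of the pattern character [b], drawn at its last occurrence;
   0 if [b] does not occur in the first [k] positions. *)
Fixpoint colour (r : nat -> nat) (k b : nat) : nat :=
  if k is k'.+1 then if px k' == b then (r k' %% K).+1 else colour r k' b else 0.

Definition light (i : nat) : bool := dg (tx i) <= D.
Definition seen_colour (h : nat -> nat) (i c : nat) : bool :=
  [exists q : 'I_(dg (tx i)), h (nbr (tx i) q) == c].
Definition textbits (h : nat -> nat) (r i : nat) : bool :=
  (i < n) && (light i && ~~ seen_colour h i r.+1).
Definition patbits (h : nat -> nat) (r q : nat) : bool :=
  (q < m) && (h (px (m.-1 - q)) == r.+1).
Definition light_cross (h : nat -> nat) (p : nat) : bool :=
  [exists r : 'I_K, crossing m (textbits h r) (patbits h r) p].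
Definition heavy_cross (a p : nat) : bool :=
  crossing m (fun i => (i < n) && (tx i == a))
             (fun q => (q < m) && (mt a (px (m.-1 - q)) == 0)) p.
End Rounds.

Section Main.
Variables (w n : nat) (O : oracle) (Lm : nat).
Local Notation W := (2 ^ w).
Hypothesis w5 : 5 <= w.
Hypothesis LmW : Lm * 32 + 32 + n + n <= W.
Local Notation ev := (ev w n O).
Local Notation den := (den w n O).
Local Notation ar := (ar w n).
Variable R : rcfType.
Variables (X l m nb : nat).
Local Notation N := (2 ^ l).
Local Notation hN := (2 ^ l.-1).
Hypothesis l0 : 0 < l.
Hypothesis XN : N ^ 40 <= X.
Hypothesis XW : 4 * (X * (X * X)) <= W.
Hypothesis NL : nb * hN + N <= Lm.
Hypothesis m0 : 0 < m.
Hypothesis mN : m <= hN.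
Let convS := @convC_spec w n O Lm w5 LmW R X l m nb l0 XN XW NL m0 mN.

Variables (tx px : nat -> nat) (fo : nat -> bool) (D K reps : nat).
Hypothesis mn : m <= n.
Hypothesis K0 : 0 < K.
Hypothesis KL : n.+1 * K.+1 <= Lm.
Hypothesis repsL : reps < Lm.
Hypothesis pxL : forall j, j < m -> px j < Lm.
Hypothesis dgW : forall a, degT_q O a < W.
Hypothesis nbrL : forall a q, nbr_q O a q < Lm.
Hypothesis mtW : forall a b, match_q O a b < W.
Local Notation dg := (degT_q O).
Local Notation nbr := (nbr_q O).
Local Notation mt := (match_q O).

Record menv (s : hst) : Prop := MEnv {
  e_c : consts X l m nb s;
  e_U : parr w n l s aUR aUI (tab X l);
  e_n : rg s rn = n; e_m : rg s rm = m; e_D : rg s rD = D; e_K : rg s rK = K;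
  e_K1 : rg s rK1 = K.+1; e_reps : rg s rreps = reps;
  e_T : forall i, i < n -> ar s aT i = tx i;
  e_P : forall j, j < m -> ar s aP j = px j;
  e_FO : forall i, i < n -> ar s aFO i = fo i }.

Definition mregs := [:: rn; rm; rD; rK; rK1; rreps] ++ cregs.
Definition marrs := [:: aT; aP; aFO; aUR; aUI].

Lemma menv_frame (xs ids : seq nat) s t : ~~ has (mem xs) mregs -> ~~ has (mem ids) marrs ->
  (forall z, z \notin xs -> rg t z = rg s z) ->
  (forall id i, id < 32 -> id \notin ids -> ar t id i = ar s id i) ->
  menv s -> menv t.
Proof.
move=> h1 h2 fr fa.
have hr z : z \in mregs -> rg t z = rg s z by move=> zm; apply: fr; apply: (hasPn h1).
have ha id i : id < 32 -> id \in marrs -> ar t id i = ar s id i.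
  by move=> idl zm; apply: fa => //; apply: (hasPn h2).
case=> *; split; rewrite ?hr //.
- by apply: consts_frame => [x xc|]; [apply: hr; rewrite mem_cat xc orbT | eassumption].
- by apply: parr_frame => [i|i|]; rewrite ?ha.
- by move=> i iN; rewrite ha //; auto.
- by move=> i iN; rewrite ha //; auto.
- by move=> i iN; rewrite ha //; auto.
Qed.

Lemma menv_den c s : cwf c -> ~~ has (mem (asg c)) mregs -> ~~ has (mem (wrs c)) marrs ->
  menv s -> menv (den c s).
Proof.
move=> wc h1 h2; apply: (menv_frame h1 h2) => [z zc|id i h3 h4]; first by rewrite den_rg.
by rewrite (den_ar n O w5).
Qed.

Lemma menv_setr s x v k : x \notin mregs -> menv s -> menv (setr s x v k).
Proof.
move=> xm; apply: (@menv_frame [:: x] [::]) => //; last by move=> z; rewrite inE /= /upd => /negbTE ->.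
by rewrite has_sym /= orbF.
Qed.

Lemma n_lt_W : n < W.
Proof. by apply: leq_trans LmW; clear; lia. Qed.

Lemma Lm_lt_W k : k <= Lm -> k < W.
Proof. by move=> kL; apply: leq_trans LmW; move: kL; clear; lia. Qed.

Lemma drawC_spec s old : menv s -> (forall b, b < Lm -> ar s aHC b = old b) ->
  (forall b, (forall j, j < m -> px j != b) -> old b = 0) ->
  let s' := den drawC s in
  [/\ forall b, b < Lm -> ar s' aHC b = colour px K (fun j => nth 0 (tp s) j %% W) m b,
      tp s' = drop m (tp s) & ck s' <= ck s + 2 + m * 40].
Proof.
move=> me Ho Hz; set r := fun j => nth 0 (tp s) j %% W.
pose I k t := [/\ forall b, b < Lm -> ar t aHC b =
     if colour px K r k b == 0 then old b else colour px K r k b,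
   tp t = drop k (tp s) & ck t <= ck s + 2 + k * 40].
have : I m (den drawC s).
  rewrite -{1}(e_m me); apply: (for_frame w5) => [//||k t kl tx' fr fa [I1 I2 I3]].
    by split; rewrite ?drop0 //= ?addn0.
  rewrite (e_m me) in kl.
  have mt' : menv t by apply: (menv_frame _ _ fr fa).
  have eP : ar t aP k = px k by rewrite (e_P mt').
  pose t1 := Hst (upd (rg t) rx (r k)) (mm t) (behead (tp t)) (ou t) (ck t + 1).
  have E1 : den (Rnd rx) t = t1 by rewrite /= /t1 I2 /r -nth0 nth_drop addn0.
  have me1 : menv t1 by rewrite -E1; apply: menv_den.
  have Ea : ev t1 (Rd aP rj) = px k by apply: (ev_rd (k := k)).
  have Ek : ev t1 rx = r k by rewrite /= /upd eqxx.
  have rW : r k < W by rewrite /r ltn_pmod // expn_gt0.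
  have KW : K < W by apply: Lm_lt_W; apply: leq_trans KL; rewrite mulSn; clear; lia.
  have h1 : ev t1 (rx [%] rK)%ram = r k %% K.
    by apply: ev_modn => //; exact: (e_K me1).
  have one : ev t1 (Cs 1) = 1 by apply: ev_cst; apply: W_gt1.
  have Ev : ev t1 (rx [%] rK [+] Cs 1)%ram = (r k %% K).+1.
    rewrite (ev_addn h1 one) ?addn1 //; apply: leq_ltn_trans KW.
    by rewrite ltn_pmod.
  have E2 : den (Rnd rx ;; Wr aHC (Rd aP rj) (rx [%] rK [+] Cs 1))%ram t =
    Hst (rg t1) (upd (mm t1) (adr w n aHC (px k)) (r k %% K).+1) (tp t1) (ou t1) (ck t1 + 20).
    by rewrite -[LHS]/(den (Wr aHC (Rd aP rj) (rx [%] rK [+] Cs 1))%ram (den (Rnd rx) t)) E1 -Ea -Ev.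
  rewrite E2; split.
  - move=> b bL; rewrite -[LHS]/(ar (Hst (rg t1) (upd (mm t1) (adr w n aHC (px k)) (r k %% K).+1) (tp t1) (ou t1) (ck t1 + 20)) aHC b).
    rewrite (ar_wr w5 LmW) ?pxL //= [px k == b]eq_sym; case: eqP => [//|_]; exact: I1.
  - by rewrite /= I2 -drop1 drop_drop add1n.
  - by rewrite /= -!addnA; move: I3; rewrite mulSn; clear; lia.
case=> J1 J2 J3; split=> // b bL; rewrite J1 //; case: eqP => [E|//].
rewrite E Hz // => j jm; apply/eqP => pj; move: E; clear - jm pj.
elim: m jm => [//|k IH]; rewrite ltnS leq_eqVlt => /predU1P[<-|jk] /=; first by rewrite pj eqxx.
by case: eqP => // _; apply: IH.
Qed.

Definition marked (h : nat -> nat) (p x : nat) : bool :=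
  [exists i : 'I_p, light tx dg D i &&
     [exists q : 'I_(dg (tx i)), x == i * K.+1 + h (nbr (tx i) q)]].

Lemma exists_ordS k (P : nat -> bool) :
  [exists i : 'I_k.+1, P i] = [exists i : 'I_k, P i] || P k.
Proof.
apply/existsP/orP => [[i Pi]|[/existsP[i Pi]|Pk]].
- case: (ltngtP i k) => [ik|ki|E]; last by right; rewrite -E.
    by left; apply/existsP; exists (Ordinal ik).
  by have := ltn_ord i; rewrite ltnS leqNgt ki.
- by exists (widen_ord (leqnSn k) i).
- by exists ord_max.
Qed.

Lemma F_index_lt i c : i < n -> c <= K -> i * K.+1 + c < Lm.
Proof.
move=> iN cK; apply: leq_trans KL; rewrite mulSn addnC.
by rewrite -addSn leq_add // leq_mul2r ltnW ?orbT.
Qed.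

Lemma marked_cell h i c : i < n -> c <= K -> (forall b, h b <= K) ->
  marked h n (i * K.+1 + c) = light tx dg D i && seen_colour tx dg nbr h i c.
Proof.
move=> iN cK hK; apply/existsP/andP.
  case=> j /andP[lj /existsP[q /eqP E]].
  have e1 : i = j :> nat.
    by have := congr1 (divn^~ K.+1) E; rewrite /= !divnMDl // !divn_small ?ltnS // ?addn0.
  have e2 : c = h (nbr (tx j) q).
    by have := congr1 (modn^~ K.+1) E; rewrite /= !modnMDl !modn_small ?ltnS // hK.
  by rewrite e1; split=> //; apply/existsP; exists q; rewrite e2.
case=> li /existsP[q /eqP E]; exists (Ordinal iN); rewrite li /=.
by apply/existsP; exists q; rewrite E.
Qed.

Lemma markC_spec s h rep : menv s -> rg s rrep = rep -> rep < reps ->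
  (forall b, b < Lm -> ar s aHC b = h b) -> (forall b, h b <= K) ->
  (forall x, x < Lm -> ar s aF x <= rep) ->
  let s' := den markC s in
  [/\ forall i c, i < n -> c <= K -> (ar s' aF (i * K.+1 + c) == rep.+1) =
         light tx dg D i && seen_colour tx dg nbr h i c,
      forall x, x < Lm -> ar s' aF x <= rep.+1 & ck s' <= ck s + 2 + n * (D * 40 + 40)].
Proof.
move=> me er repr Hh hK HF.
have one t : ev t (Cs 1) = 1 by apply: ev_cst; apply: W_gt1.
pose I k t := [/\ forall x, x < Lm -> ar t aF x <= rep.+1,
   forall x, x < Lm -> (ar t aF x == rep.+1) = marked h k x
   & ck t <= ck s + 2 + k * (D * 40 + 40)].
have wc : cwf markC by [].
have : I n (den markC s).
  rewrite -{1}(e_n me); apply: (for_frame w5) => [//||k t kl tk fr fa [I1 I2 I3]].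
    split; [|move=> x xL|by rewrite /= addn0].
    - by move=> x xL; apply: leq_trans (HF x xL) _.
    - rewrite -[ar _ _ _]/(ar s aF x) /marked; apply/eqP/existsP => [E|[[]]//].
      by have := HF x xL; rewrite E ltnn.
  rewrite (e_n me) in kl.
  have met : menv t by apply: (menv_frame _ _ fr fa).
  set a := tx k.
  have Ea : ev t (Rd aT rp) = a by apply: (ev_rd (k := k)) => //; apply: (e_T met).
  pose t1 := setr t rdeg (dg a) 10.
  have E1 : den (rdeg <-- QD (Rd aT rp))%ram t = t1.
    by rewrite -[LHS]/(setr t rdeg (dg (ev t (Rd aT rp)) %% W) 10) Ea modn_small.
  have me1 : menv t1 by apply: menv_setr.
  have Ec : ev t1 (notE (rD [<] rdeg))%ram = ~~ (D < dg a).
    rewrite (ev_eqn w5 (x := D < dg a) (y := 0)) ?eqb0 //.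
      by apply: (ev_ltn w5); [exact: (e_D me1)|exact: (rg_setr t rdeg (dg a))].
    by apply: ev_cst; rewrite expn_gt0.
  pose b := (Wr aF (rp [*] rK1 [+] Rd aHC (QN (Rd aT rp) rj)) (rrep [+] Cs 1))%ram.
  have E2 : den (rdeg <-- QD (Rd aT rp) ;; If (notE (rD [<] rdeg)) (For rj rdeg b))%ram t =
     if ~~ (D < dg a) then den (For rj rdeg b) (tick t1 6) else tick t1 6.
    rewrite -[LHS]/(let s' := tick (den (rdeg <-- QD (Rd aT rp))%ram t) 6 in
       if ev (den (rdeg <-- QD (Rd aT rp))%ram t) (notE (rD [<] rdeg))%ram == 0 then s'
       else den (For rj rdeg b) s') E1 Ec.
    by case: (D < dg a).
  rewrite -/b E2.
  have mS x : marked h k.+1 x = marked h k x || (light tx dg D k &&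
     [exists q : 'I_(dg a), x == k * K.+1 + h (nbr a q)]).
    by rewrite /marked (exists_ordS _ (fun i => light tx dg D i &&
     [exists q : 'I_(dg (tx i)), x == i * K.+1 + h (nbr (tx i) q)])).
  case: ifP => lk; last first.
    have nl : light tx dg D k = false by rewrite /light leqNgt lk.
    split; first exact: I1.
    - by move=> x xL; rewrite mS nl andFb orbF; apply: I2.
    - rewrite /= mulSn -!addnA; move: I3; clear; lia.
  have ll : light tx dg D k by rewrite /light leqNgt.
  pose J q u := [/\ forall x, x < Lm -> ar u aF x <= rep.+1,
     forall x, x < Lm -> (ar u aF x == rep.+1) = marked h k x || [exists q' : 'I_q, x == k * K.+1 + h (nbr a q')]
     & ck u <= ck t + 18 + q * 36].
  have et : rg (tick t1 6) rdeg = dg a by exact: (rg_setr t rdeg (dg a)).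
  have : J (dg a) (den (For rj rdeg b) (tick t1 6)).
    rewrite -{1}et; apply: (for_frame w5) => [//||q u ql uq fru fau [J1 J2 J3]].
      split; [exact: I1| |by rewrite /= -!addnA; clear; lia].
      move=> x xL; rewrite -[ar _ _ _]/(ar t aF x) I2 //.
      by rewrite (_ : [exists _, _] = false) ?orbF //; apply/existsP => -[[]].
    rewrite et in ql.
    have meu : menv u.
      by apply: (@menv_frame [:: rj] [:: aF] t1) => //; move=> z zc; rewrite fru.
    have up : rg u rp = k by rewrite fru // -tk.
    have ua : ev u (Rd aT rp) = a by apply: (ev_rd (k := k)) => //; apply: (e_T meu).
    have uh z : z < Lm -> ar u aHC z = h z by move=> zL; rewrite fau // -[LHS]/(ar t aHC z) fa // Hh.
    have En : ev u (QN (Rd aT rp) rj) = nbr a q.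
      rewrite -[LHS]/(nbr (ev u (Rd aT rp)) (rg u rj) %% W) ua uq modn_small //.
      by apply: Lm_lt_W; apply: ltnW.
    have Eh : ev u (Rd aHC (QN (Rd aT rp) rj)) = h (nbr a q) by apply: (ev_rd (k := nbr a q)) => //; apply: uh.
    have iL := F_index_lt kl (hK (nbr a q)).
    have Ei : ev u (rp [*] rK1 [+] Rd aHC (QN (Rd aT rp) rj))%ram = k * K.+1 + h (nbr a q).
      apply: ev_addn; [|exact: Eh|by apply: Lm_lt_W; apply: ltnW].
      apply: ev_muln; [exact: up|exact: (e_K1 meu)|].
      by apply: Lm_lt_W; apply: leq_trans (ltnW iL); apply: leq_addr.
    have Er : ev u (rrep [+] Cs 1)%ram = rep.+1.
      rewrite -(addn1 rep); apply: ev_addn; [|exact: one|].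
        by rewrite -[LHS]/(rg u rrep) fru // -[LHS]/(rg t rrep) fr.
      by rewrite addn1; apply: Lm_lt_W; apply: leq_trans repr _; apply: ltnW.
    set i := k * K.+1 + h (nbr a q) in iL Ei *.
    have Eb : den b u = Hst (rg u) (upd (mm u) (adr w n aF i) rep.+1) (tp u) (ou u) (ck u + 31).
      by rewrite -Er -Ei.
    rewrite Eb.
    have arE x : x < Lm -> ar (setr (Hst (rg u) (upd (mm u) (adr w n aF i) rep.+1) (tp u) (ou u) (ck u + 31)) rj q.+1 4) aF x =
      if x == i then rep.+1 else ar u aF x.
      move=> xL; rewrite ar_setr (ar_wr w5 LmW) //.
    split.
    - by move=> x xL; rewrite arE //; case: eqP => // _; apply: J1.
    - move=> x xL; rewrite arE // (exists_ordS _ (fun q' => x == k * K.+1 + h (nbr a q'))) -/i.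
      by case: (x == i); rewrite ?eqxx ?orbT // orbF J2.
    - rewrite /= mulSn -!addnA; move: J3; clear; lia.
  case=> J1 J2 J3; split.
  - exact: J1.
  - by move=> x xL; rewrite mS ll /=; apply: J2.
  - rewrite -[ck _]/(ck (den (For rj rdeg b) (tick t1 6)) + 4) mulSn.
    move: I3 J3 ll; rewrite /light -/a; move: (ck (den _ _)) => z I3 J3 ll.
    have := leq_mul ll (leqnn 36); move: (dg a * 36) I3 J3; clear; lia.
case=> J1 J2 J3; split=> // i c iN cK.
by rewrite J2 ?marked_cell // F_index_lt.
Qed.

Definition tails (s : hst) : Prop :=
  (forall i, n <= i -> i < Lm -> ar s aA i = 0) /\ (forall i, m <= i -> i < Lm -> ar s aB i = 0).

Definition round_cost : nat := n * 100 + conv_cost l nb.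

Lemma round_spec s (ea eb : expr) (a b bd : nat -> bool) :
  menv s -> tails s ->
  cwf (fill ri rn aA (Cs 0) ea) -> cwf (fill ri rm aB (Cs 0) eb) -> noraw ea -> noraw eb ->
  aA \notin earrs ea -> aB \notin earrs eb -> aA \notin earrs eb ->
  esz ea <= 40 -> esz eb <= 25 ->
  (forall i, i < n -> ev (setr s ri i 0) ea = a i) ->
  (forall q, q < m -> ev (setr s ri q 0) eb = b q) ->
  (forall i, a i -> i < n) -> (forall q, b q -> q < m) ->
  (forall p, p < Lm -> ar s aBAD p = bd p) ->
  let s' := den (roundC ea eb) s in
  [/\ forall p, p < Lm -> ar s' aBAD p = bd p || ((p < nb * hN) && crossing m a b p),
      tails s' & ck s' <= ck s + round_cost].
Proof.
move=> me [tA tB] w1 w2 n1 n2 i1 i2 i3 z1 z2 Ha Hb an bm HD.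
have nL : n <= Lm by apply: leq_trans KL; apply: leq_trans (leqnSn n) _; apply: leq_pmulr.
have mL : m <= Lm by apply: leq_trans mn nL.
have zero t : ev t (Cs 0) = 0 by apply: ev_cst; rewrite expn_gt0.
have [||s1 [E1 r1 o1 a1 k1]] := @fill_frame w n O Lm w5 LmW rn aA (Cs 0) ea s 0 (fun i => a i) w1 isT n1 isT i1.
- by move=> j; rewrite (e_n me) => jn; split; [exact: zero|exact: Ha].
- by rewrite (e_n me).
have m1 : rg s1 rm = m by rewrite r1 // (e_m me).
have [||s2 [E2 r2 o2 a2 k2]] := @fill_frame w n O Lm w5 LmW rm aB (Cs 0) eb s1 0 (fun q => b q) w2 isT n2 isT i2.
- move=> j; rewrite m1 => jm; split; first exact: zero.
  rewrite -Hb //; apply: ev_fr => // id k hid hin; apply: o1 => //.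
  by apply: contraNneq i3 => <-.
- by rewrite m1.
have me2 : menv s2.
  apply: (@menv_frame [:: ri] [:: aA; aB] s) => //.
    by move=> z; rewrite inE => zi; rewrite r2 ?r1.
  by move=> id k hid; rewrite !inE negb_or => /andP[h1 h2]; rewrite o2 ?o1.
have A2 i : i < Lm -> ar s2 aA i = a i.
  move=> iL; rewrite o2 // a1 // (e_n me) /= add0n subn0; case: ltnP => // ni.
  by rewrite tA //; case E: (a i) => //; have := an _ E; rewrite ltnNge ni.
have B2 i : i < Lm -> ar s2 aB i = b i.
  move=> iL; rewrite a2 // m1 /= add0n subn0; case: ltnP => // ni.
  by rewrite o1 // tB //; case E: (b i) => //; have := bm _ E; rewrite ltnNge ni.
have D2 i : i < Lm -> ar s2 aBAD i = bd i by move=> iL; rewrite o2 // o1 // HD.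
have [C1 C2] := convS (e_c me2) (e_U me2) bm A2 B2 D2.
have E3 : den (roundC ea eb) s = den convC s2.
  by rewrite E2 E1.
rewrite E3; split; first exact: C1.
- split=> i h1 h2; rewrite (den_ar n O w5) //.
    by rewrite A2 //; case E: (a i) => //; have := an _ E; rewrite ltnNge h1.
  by rewrite B2 //; case E: (b i) => //; have := bm _ E; rewrite ltnNge h1.
- apply: leq_trans C2 _; rewrite k2 k1 (e_n me) m1 /round_cost [esz (Cs 0)]/=.
  have q1 : n * (1 + esz ea + 13) <= n * 54 by rewrite leq_mul2l; apply/orP; right; move: z1; clear; lia.
  have q2 : m * (1 + esz eb + 13) <= n * 39 by apply: leq_mul => //; move: z2; clear; lia.
  move: q1 q2 m0 mn; move: (n * (1 + _ + 13)) (m * (1 + _ + 13)) (conv_cost l nb); clear; lia.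
Qed.

Lemma classC_spec s h rep (bd : nat -> bool) : menv s -> tails s -> rg s rrep = rep -> rep < reps ->
  (forall b, b < Lm -> ar s aHC b = h b) ->
  (forall i c, i < n -> c <= K -> (ar s aF (i * K.+1 + c) == rep.+1) =
         light tx dg D i && seen_colour tx dg nbr h i c) ->
  (forall p, p < Lm -> ar s aBAD p = bd p) ->
  let s' := den classC s in
  [/\ forall p, p < Lm -> ar s' aBAD p =
        bd p || ((p < nb * hN) && light_cross tx px dg nbr n m D K h p),
      tails s' & ck s' <= ck s + 2 + K * (round_cost + 4)].
Proof.
move=> me ts er repr Hh HF HD.
have one t : ev t (Cs 1) = 1 by apply: ev_cst; apply: W_gt1.
pose I k t := [/\ forall p, p < Lm -> ar t aBAD p = bd p || ((p < nb * hN) &&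
    [exists r : 'I_k, crossing m (textbits tx dg nbr n D h r) (patbits px m h r) p]),
  tails t & ck t <= ck s + 2 + k * (round_cost + 4)].
have : I K (den classC s).
  rewrite -{1}(e_K me); apply: (for_frame w5) => [//||k t kl tk fr fa [I1 I2 I3]].
    split; [|exact: ts|by rewrite /= addn0].
    move=> p pL; rewrite -[LHS]/(ar s aBAD p) HD // (_ : [exists _, _] = false) ?andbF ?orbF //.
    by apply/existsP => -[[]].
  rewrite (e_K me) in kl.
  have met : menv t by apply: (menv_frame _ _ fr fa).
  have tr : rg t rrep = rep by rewrite fr.
  have tK i : i <= K -> i < W by move=> iK; apply: Lm_lt_W; apply: leq_trans KL; rewrite mulSn; move: iK; clear; lia.
  have ek u : rg u rr = rg t rr -> ev u (rr [+] Cs 1)%ram = k.+1.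
    by move=> h0; rewrite -(addn1 k); apply: ev_addn; [rewrite -tk -h0|exact: one|rewrite addn1; apply: tK].
  have erep u : rg u rrep = rep -> ev u (rrep [+] Cs 1)%ram = rep.+1.
    move=> h0; rewrite -(addn1 rep); apply: ev_addn; [exact: h0|exact: one|].
    by rewrite addn1; apply: Lm_lt_W; apply: leq_trans repr _; apply: ltnW.
  have HA i : i < n -> ev (setr t ri i 0) lightA = textbits tx dg nbr n D h k i.
    move=> iN; set u := setr t ri i 0; have meu : menv u by apply: menv_setr.
    have uT : ev u (Rd aT ri) = tx i.
      by apply: (ev_rd (k := i)); [exact: (rg_setr t ri i 0)|apply: (e_T meu)].
    have uD : ev u (QD (Rd aT ri)) = dg (tx i).
      by rewrite -[LHS]/(dg (ev u (Rd aT ri)) %% W) uT modn_small.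
    have zero : ev u (Cs 0) = 0 by apply: ev_cst; rewrite expn_gt0.
    have iL := @F_index_lt i k.+1 iN kl.
    have uI : ev u (ri [*] rK1 [+] (rr [+] Cs 1))%ram = i * K.+1 + k.+1.
      apply: ev_addn; [|exact: ek|by apply: Lm_lt_W; apply: ltnW].
      apply: ev_muln; [exact: (rg_setr t ri i 0)|exact: (e_K1 meu)|].
      by apply: Lm_lt_W; apply: leq_trans (ltnW iL); apply: leq_addr.
    have uF : ev u (Rd aF (ri [*] rK1 [+] (rr [+] Cs 1)))%ram = ar s aF (i * K.+1 + k.+1).
      by apply: (ev_rd uI); rewrite ar_setr fa.
    have e1 := ev_eqn w5 (ev_ltn w5 (e_D meu : ev u (Vr rD) = D) uD) zero.
    have e2 := ev_eqn w5 (ev_eqn w5 uF (erep u tr)) zero.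
    rewrite /lightA (ev_muln e1 e2); last first.
      by apply: leq_trans (W_gt1 w5); rewrite mulnb; case: (_ && _).
    rewrite /textbits iN HF // !eqb0 mulnb /light (ltnNge D) negbK; congr nat_of_bool.
    by case: (dg (tx i) <= D); rewrite ?andbT ?andbF //.
  have HB q : q < m -> ev (setr t ri q 0) lightB = patbits px m h k q.
    move=> qm; set u := setr t ri q 0; have meu : menv u by apply: menv_setr.
    have u1 : ev u (rm1 [-] ri)%ram = m.-1 - q.
      apply: ev_subn; [exact: (c_m1 (e_c meu))|exact: (rg_setr t ri q 0)|].
      by have := n_lt_W; move: qm mn; clear; lia.
    have u2 : ev u (Rd aP (rm1 [-] ri))%ram = px (m.-1 - q).
      by apply: (ev_rd u1); apply: (e_P meu); move: qm; clear; lia.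
    have u3 : ev u (Rd aHC (Rd aP (rm1 [-] ri)))%ram = h (px (m.-1 - q)).
      apply: (ev_rd u2); rewrite ar_setr fa // Hh //; apply: pxL; move: qm; clear; lia.
    by rewrite /lightB (ev_eqn w5 u3 (ek u erefl)) /patbits qm.
  have := @round_spec t lightA lightB (textbits tx dg nbr n D h k) (patbits px m h k) _ met I2 isT isT isT isT isT isT isT isT isT HA HB _ _ I1.
  case=> [i /andP[]//|q /andP[]//|R1 R2 R3]; split.
  - move=> p pL; rewrite -[LHS]/(ar (den _ t) aBAD p) R1 //.
    by rewrite -orbA -andb_orr -(exists_ordS _ (fun r => crossing m (textbits tx dg nbr n D h r) (patbits px m h r) p)).
  - exact: R2.
  - rewrite -[ck _]/(ck (den (roundC lightA lightB) t) + 4) mulSn.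
    by move: R3 I3; move: (ck (den _ _)) => z; clear; lia.
by [].
Qed.

Lemma colour_le r k b : colour px K r k b <= K.
Proof. by elim: k => //= k IH; case: eqP => // _; rewrite ltn_pmod. Qed.

Lemma colour_notin r k b : (forall j, j < k -> px j != b) -> colour px K r k b = 0.
Proof.
elim: k => //= k IH H; rewrite (negbTE (H k (ltnSn k))).
by apply: IH => j jk; apply: H; apply: ltnW.
Qed.

Definition rep_cost : nat := 10 + m * 40 + n * (D * 40 + 40) + K * (round_cost + 4).
Definition hash (tape : seq nat) (rep : nat) : nat -> nat :=
  colour px K (fun j => nth 0 tape (rep * m + j) %% W) m.

Lemma lightC_spec s (bd : nat -> bool) : menv s -> tails s ->
  (forall b, b < Lm -> ar s aHC b = 0) -> (forall x, x < Lm -> ar s aF x = 0) ->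
  (forall p, p < Lm -> ar s aBAD p = bd p) ->
  let s' := den lightC s in
  [/\ forall p, p < Lm -> ar s' aBAD p = bd p || ((p < nb * hN) &&
         [exists rep : 'I_reps, light_cross tx px dg nbr n m D K (hash (tp s) rep) p]),
      tails s' & ck s' <= ck s + 2 + reps * rep_cost].
Proof.
move=> me ts HC0 F0 HD.
pose I k t := [/\ (forall p, p < Lm -> ar t aBAD p = bd p || ((p < nb * hN) &&
    [exists rep : 'I_k, light_cross tx px dg nbr n m D K (hash (tp s) rep) p])) /\ tails t,
  tp t = drop (k * m) (tp s), forall x, x < Lm -> ar t aF x <= k,
  exists2 old : nat -> nat, forall b, b < Lm -> ar t aHC b = old b &
    forall b, (forall j, j < m -> px j != b) -> old b = 0
  & ck t <= ck s + 2 + k * rep_cost].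
have : I reps (den lightC s).
  rewrite -{1}(e_reps me); apply: (for_frame w5) => [//||k t kl tk fr fa [[I1 I1'] I2 I3 [old I4 I4'] I5]].
    split; [split=> // p pL|by rewrite drop0| | |by rewrite /= addn0].
    - rewrite -[LHS]/(ar s aBAD p) HD // (_ : [exists _, _] = false) ?andbF ?orbF //.
      by apply/existsP => -[[]].
    - by move=> x xL; rewrite -[ar _ _ _]/(ar s aF x) F0.
    - by exists (fun=> 0) => // b bL; rewrite -[LHS]/(ar s aHC b) HC0.
  rewrite (e_reps me) in kl.
  have met : menv t by apply: (menv_frame _ _ fr fa).
  have [D1 D2 D3] := drawC_spec met I4 I4'.
  move: D1 D2 D3; move E1 : (den drawC t) => t1 D1 D2 D3.
  have w1 : cwf drawC by [].
  have me1 : menv t1 by rewrite -E1; apply: menv_den.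
  have D1' b : b < Lm -> ar t1 aHC b = hash (tp s) k b.
    move=> bL; rewrite D1 // /hash; congr (colour _ _ _ _ _).
    by apply: functional_extensionality => j; rewrite I2 nth_drop.
  have k1 : rg t1 rrep = k by rewrite -E1 den_rg.
  have F1 x : x < Lm -> ar t1 aF x <= k by move=> xL; rewrite -E1 (den_ar n O w5) // I3.
  have hK b : hash (tp s) k b <= K by apply: colour_le.
  have [M1 M2 M3] := markC_spec me1 k1 kl D1' hK F1.
  move: M1 M2 M3; move E2 : (den markC t1) => t2 M1 M2 M3.
  have w2 : cwf markC by [].
  have me2 : menv t2 by rewrite -E2; apply: menv_den.
  have ts2 : tails t2.
    case: I1' => q1 q2; split=> i h1 h2; rewrite -E2 (den_ar n O w5) // -E1 (den_ar n O w5) //.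
      exact: q1.
    exact: q2.
  have k2 : rg t2 rrep = k by rewrite -E2 den_rg.
  have H2 b : b < Lm -> ar t2 aHC b = hash (tp s) k b.
    by move=> bL; rewrite -E2 (den_ar n O w5) // D1'.
  have B2 p : p < Lm -> ar t2 aBAD p = bd p || ((p < nb * hN) &&
    [exists rep : 'I_k, light_cross tx px dg nbr n m D K (hash (tp s) rep) p]).
    by move=> pL; rewrite -E2 (den_ar n O w5) // -E1 (den_ar n O w5) // I1.
  have [C1 C2 C3] := classC_spec me2 ts2 k2 kl H2 M1 B2.
  move: C1 C2 C3; move E3 : (den classC t2) => t3 C1 C2 C3.
  have w3 : cwf classC by [].
  have -> : den (drawC ;; markC ;; classC)%ram t = t3 by rewrite -E3 -E2 -E1.
  split.
  - split; last exact: C2.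
    move=> p pL; rewrite -[LHS]/(ar t3 aBAD p) C1 // -orbA -andb_orr.
    by rewrite -(exists_ordS _ (fun rep => light_cross tx px dg nbr n m D K (hash (tp s) rep) p)).
  - rewrite -[tp _]/(tp t3) -E3 den_tp // -E2 den_tp // D2 I2 drop_drop mulSn.
    by rewrite addnC.
  - by move=> x xL; rewrite -[ar _ _ _]/(ar t3 aF x) -E3 (den_ar n O w5) // M2.
  - exists (hash (tp s) k) => [b bL|b Hb]; last exact: colour_notin.
    by rewrite -[LHS]/(ar t3 aHC b) -E3 (den_ar n O w5) // H2.
  - rewrite -[ck _]/(ck t3 + 4) mulSn /rep_cost; move: D3 M3 C3 I5.
    rewrite /rep_cost; move: (m * 40) (n * (D * 40 + 40)) (K * (round_cost + 4)) => a b c.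
    by move: (k * _); clear; lia.
by case=> -[J1 J1'] _ _ _ J5.
Qed.

Lemma setr_tick t a x v b : setr (tick t a) x v b = setr t x v (a + b).
Proof. by rewrite /setr /tick /= -addnA. Qed.

Definition heavy_first (i : nat) : bool := fo i && (D < dg (tx i)).

Lemma heavyC_spec s (bd : nat -> bool) : menv s -> tails s ->
  (forall p, p < Lm -> ar s aBAD p = bd p) ->
  let s' := den heavyC s in
  (forall p, p < Lm -> ar s' aBAD p = bd p || ((p < nb * hN) &&
         [exists i : 'I_n, heavy_first i && heavy_cross tx px mt n m (tx i) p])) /\
  ck s' <= ck s + 2 + n * 30 + (\sum_(i < n) heavy_first i) * (round_cost + 10).
Proof.
move=> me ts HD.
pose I k t := [/\ forall p, p < Lm -> ar t aBAD p = bd p || ((p < nb * hN) &&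
    [exists i : 'I_k, heavy_first i && heavy_cross tx px mt n m (tx i) p]), tails t &
  ck t <= ck s + 2 + k * 30 + (\sum_(i < k) heavy_first i) * (round_cost + 10)].
have : I n (den heavyC s).
  rewrite -{1}(e_n me); apply: (for_frame w5) => [//||k t kl tk fr fa [I1 I2 I3]].
    split; [|exact: ts|by rewrite /= big_ord0 !addn0].
    move=> p pL; rewrite -[LHS]/(ar s aBAD p) HD // (_ : [exists _, _] = false) ?andbF ?orbF //.
    by apply/existsP => -[[]].
  rewrite (e_n me) in kl.
  have met : menv t by apply: (menv_frame _ _ fr fa).
  set body := (ra <-- _ ;; _)%ram.
  have e1 : ev t (Rd aFO rp) = fo k by apply: (ev_rd (k := k)) => //; apply: (e_FO met).
  have aux u : menv u -> rg u rp = k ->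
     ev u (Rd aT rp) = tx k /\ ev u (rD [<] QD (Rd aT rp))%ram = (D < dg (tx k)).
    move=> meu up; have uT : ev u (Rd aT rp) = tx k by apply: (ev_rd (k := k)) => //; apply: (e_T meu).
    split=> //; apply: (ev_ltn w5); first exact: (e_D meu).
    by rewrite -[LHS]/(dg (ev u (Rd aT rp)) %% W) uT modn_small.
  have [e2 e3] := aux t met tk.
  have E0 : den (If (Rd aFO rp) (If (rD [<] QD (Rd aT rp)) body))%ram t =
    if fo k then if D < dg (tx k) then den body (tick t 21) else tick t 21 else tick t 9.
    rewrite -[LHS]/(if ev t (Rd aFO rp) == 0 then tick t 9 else
      if ev t (rD [<] QD (Rd aT rp))%ram == 0 then tick (tick t 9) 12 else den body (tick (tick t 9) 12)).
    rewrite e1 e3 (_ : tick (tick t 9) 12 = tick t 21); last by rewrite /tick /= -addnA.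
    by move: (den body _) => z; case: (fo k); case: (D < _).
  rewrite E0.
  have hS p : [exists i : 'I_k.+1, heavy_first i && heavy_cross tx px mt n m (tx i) p] =
     [exists i : 'I_k, heavy_first i && heavy_cross tx px mt n m (tx i) p] ||
     (heavy_first k && heavy_cross tx px mt n m (tx k) p).
    exact: (exists_ordS k (fun i => heavy_first i && heavy_cross tx px mt n m (tx i) p)).
  case hk : (heavy_first k); last first.
    have -> : (if fo k then if D < dg (tx k) then den body (tick t 21) else tick t 21 else tick t 9) =
       tick t (if fo k then 21 else 9).
      by move: hk (den body _); rewrite /heavy_first; case: (fo k) => /= [->|].
    split; [|exact: I2|].
    - by move=> p pL; rewrite hS hk andFb orbF; apply: I1.
    - rewrite big_ord_recr /= hk addn0; move: I3; move: (_ * (round_cost + 10)).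
      by case: (fo k); clear; lia.
  have sumS : \sum_(i < k.+1) heavy_first i = (\sum_(i < k) heavy_first i).+1.
    by rewrite big_ord_recr /= hk addn1.
  have -> : (if fo k then if D < dg (tx k) then den body (tick t 21) else tick t 21 else tick t 9) =
       den body (tick t 21).
    by move: hk (den body _); rewrite /heavy_first => /andP[-> ->].
  pose t1 := setr t ra (tx k) 30.
  have E1 : den body (tick t 21) = den (roundC heavyA heavyB) t1.
    rewrite -[LHS]/(den (roundC heavyA heavyB) (setr (tick t 21) ra (ev t (Rd aT rp)) 9)) e2.
    by rewrite setr_tick.
  have me1 : menv t1 by apply: menv_setr.
  have ra1 : rg t1 ra = tx k by exact: (rg_setr t ra (tx k)).
  have HA i : i < n -> ev (setr t1 ri i 0) heavyA = ((i < n) && (tx i == tx k)).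
    move=> iN; rewrite iN andTb /heavyA; apply: (ev_eqn w5).
      by apply: (ev_rd (k := i)); [exact: (rg_setr t1 ri i 0)|apply: (e_T met)].
    exact: ra1.
  have HB q : q < m -> ev (setr t1 ri q 0) heavyB = ((q < m) && (mt (tx k) (px (m.-1 - q)) == 0)).
    move=> qm; rewrite qm andTb /heavyB /notE; set u := setr t1 ri q 0; have meu : menv u by apply: menv_setr.
    have u1 : ev u (rm1 [-] ri)%ram = m.-1 - q.
      apply: ev_subn; [exact: (c_m1 (e_c meu))|exact: (rg_setr t1 ri q 0)|].
      by have := n_lt_W; move: qm mn; clear; lia.
    have u2 : ev u (Rd aP (rm1 [-] ri))%ram = px (m.-1 - q).
      by apply: (ev_rd u1); apply: (e_P meu); move: qm; clear; lia.
    apply: (ev_eqn w5); last by apply: ev_cst; rewrite expn_gt0.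
    rewrite -[LHS]/(mt (rg u ra) (ev u (Rd aP (rm1 [-] ri))%ram) %% W) u2 (ra1 : rg u ra = tx k).
    by rewrite modn_small.
  have [||R1 R2 R3] := @round_spec t1 heavyA heavyB (fun i => (i < n) && (tx i == tx k))
    (fun q => (q < m) && (mt (tx k) (px (m.-1 - q)) == 0)) _ me1 I2 isT isT isT isT isT isT isT isT isT HA HB _ _ I1.
  - by move=> i /andP[].
  - by move=> q /andP[].
  rewrite E1; split.
  - by move=> p pL; rewrite -[LHS]/(ar (den _ t1) aBAD p) R1 // hS hk andTb -orbA -andb_orr.
  - exact: R2.
  - rewrite -[ck _]/(ck (den (roundC heavyA heavyB) t1) + 4) sumS.
    move: R3 I3; rewrite !mulSn [ck t1]/=; move: (ck (den _ _)) (_ * (round_cost + 10)) => z y; clear; lia.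
by case.
Qed.

Lemma outC_spec s : menv s ->
  let s' := den outC s in
  ou s' = ou s ++ [seq i <- iota 0 (n - m + 1) | ar s aBAD i == 0] /\
  ck s' <= ck s + 20 + n * 20.
Proof.
move=> me.
have one t : ev t (Cs 1) = 1 by apply: ev_cst; apply: W_gt1.
have zero t : ev t (Cs 0) = 0 by apply: ev_cst; rewrite expn_gt0.
pose b := (If (notE (Rd aBAD rp)) (Ou rp))%ram.
pose s1 := setr s ru (n - m + 1) 6.
have nmW : n - m + 1 < W.
  by have := n_lt_W; move: m0 mn; clear; lia.
have E1 : den outC s = den (For rp ru b) s1.
  rewrite /s1 -[RHS]/(den (For rp ru b) (setr s ru (n - m + 1) 6)).
  have h : ev s (rn [-] rm [+] Cs 1)%ram = n - m + 1.
    apply: ev_addn; [|exact: one|exact: nmW].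
    by apply: ev_subn; [exact: (e_n me)|exact: (e_m me)|rewrite mn n_lt_W].
  by rewrite -h.
have r1 : rg s1 ru = n - m + 1 by exact: (rg_setr s ru).
pose I k t := ou t = ou s ++ [seq i <- iota 0 k | ar s aBAD i == 0] /\ ck t <= ck s + 8 + k * 20.
have : I (n - m + 1) (den (For rp ru b) s1).
  rewrite -{1}r1; apply: (for_frame w5) => [//||k t kl tk fr fa [I1 I2]].
    by split; rewrite /= ?cats0 // !addn0 -addnA.
  have e : ev t (notE (Rd aBAD rp)) = (ar s aBAD k == 0).
    by apply: (ev_eqn w5 _ (zero t)); apply: (ev_rd (k := k)) => //; rewrite fa.
  have -> : den b t = if ar s aBAD k == 0 then Hst (rg t) (mm t) (tp t) (rcons (ou t) k) (ck t + 11 + 2)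
       else tick t 11.
    rewrite -[LHS]/(if ev t (notE (Rd aBAD rp)) == 0 then tick t 11 else
       Hst (rg t) (mm t) (tp t) (rcons (ou t) (rg t rp)) (ck t + 11 + 2)) e tk.
    by case: (ar s aBAD k == 0).
  have kE : iota 0 k.+1 = iota 0 k ++ [:: k] by rewrite -addn1 iotaD.
  rewrite /I kE filter_cat /= mulSn; case: (ar s aBAD k == 0); split=> /=.
  - by rewrite I1 cats1 rcons_cat.
  - by move: I2; clear; lia.
  - by rewrite cats0.
  - by move: I2; clear; lia.
case=> J1 J2; rewrite E1; split=> //; apply: leq_trans J2 _.
by move: m0 mn; clear; lia.
Qed.
End Main.

(** * Preprocessing *)

Section Setup.
Variables (w n : nat) (O : oracle).
Local Notation W := (2 ^ w).
Hypothesis w5 : 5 <= w.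
Local Notation ev := (ev w n O).
Local Notation den := (den w n O).
Local Notation ar := (ar w n).
Hypothesis n0 : 0 < n.

Lemma ev_one t : ev t (Cs 1) = 1.
Proof. by apply: ev_cst; apply: W_gt1. Qed.

Lemma ev_zero t : ev t (Cs 0) = 0.
Proof. by apply: ev_cst; rewrite expn_gt0. Qed.

Lemma ev_two t : ev t (Cs 2) = 2.
Proof. by apply: ev_cst; apply: (leq_trans _ (W_ge32 w5)). Qed.

Lemma den_asg x e s v : ev s e = v -> den (x <-- e)%ram s = setr s x v (esz e + 1).
Proof. by move=> <-. Qed.

Lemma den_sq a b s : den (a ;; b)%ram s = den b (den a s).
Proof. by []. Qed.

Lemma up_log_le z : 0 < z -> z <= n -> up_log 2 (z + z) <= n.
Proof.
move=> z0 zn; apply: up_log_min => //.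
apply: leq_trans (_ : n + n <= _); first exact: leq_add.
rewrite addnn -mul2n; elim: n n0 => // k IH _.
case: (posnP k) => [-> //|k0]; rewrite expnS leq_mul2l /=.
apply: leq_trans (IH k0); rewrite mul2n -addnn -addn1 leq_add2l; exact: k0.
Qed.

(* The registers of the two calls are listed because frame conditions on
   concrete registers are decided by computation. *)
Lemma logC_spec x lx z s v :
  [|| [&& x == rN, lx == rl & z == rm] | [&& x == rY, lx == rLn & z == rn]] ->
  rg s rn = n -> rg s z = v -> 0 < v -> v <= n -> 4 * n < W ->
  let s' := den (logC x lx z) s in
  [/\ rg s' x = 2 ^ up_log 2 (v + v), rg s' lx = up_log 2 (v + v)
    & ck s' <= ck s + 6 + n * 30].
Proof.
move=> xyz en ez v0 vn nW; set L := up_log 2 (v + v).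
pose s1 := setr (setr s x 1 2) lx 0 2.
pose b := (If (x [<] (z [+] z)) (x <-- x [+] x ;; lx <-- lx [+] Cs 1))%ram.
have -> : den (logC x lx z) s = den (For riq rn b) s1.
  rewrite -[LHS]/(den (For riq rn b) (setr (setr s x (ev s (Cs 1)) 2) lx (ev (setr s x (ev s (Cs 1)) 2) (Cs 0)) 2)).
  by rewrite ev_one ev_zero.
have en1 : rg s1 rn = n by rewrite /s1; case/orP: xyz => /and3P[/eqP -> /eqP -> _].
have wc : cwf (For riq rn b) by rewrite /b; case/orP: xyz => /and3P[/eqP -> /eqP -> /eqP ->].
have xl : x != lx by case/orP: xyz => /and3P[/eqP -> /eqP -> _].
have zn : z \notin asg (For riq rn b).
  by rewrite /b; case/orP: xyz => /and3P[/eqP -> /eqP -> /eqP ->].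
have z1 : rg s1 z = v.
  by rewrite -ez /s1; case/orP: xyz => /and3P[/eqP -> /eqP -> /eqP ->].
pose I k t := exists j, [/\ rg t x = 2 ^ j, rg t lx = j, j <= L, (j == L) || (j == k) & ck t <= ck s + 6 + k * 30].
suff : I n (den (For riq rn b) s1).
  have Ln : L <= n by apply: up_log_le.
  case=> j [h1 h2 h3 h4 h5]; suff jL : j = L by rewrite jL in h1 h2; split.
  by apply/eqP; rewrite eqn_leq h3 /=; case/orP: h4 => /eqP ->.
have riqx : (x == riq) = false by case/orP: xyz => /and3P[/eqP -> _ _].
have riql : (lx == riq) = false by case/orP: xyz => /and3P[_ /eqP -> _].
rewrite -{1}en1; apply: (for_frame w5 wc) => [|k t kl tk fr fa [j [h1 h2 h3 h4 h5]]].
  exists 0; split; rewrite /= /upd ?riqx ?riql ?(negbTE xl) ?eqxx ?orbT //.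
  by rewrite addn0 -!addnA.
have tz : rg t z = v by rewrite fr.
have vW : v + v < W by apply: leq_ltn_trans nW; move: vn; clear; lia.
have e1 : ev t (x [<] (z [+] z))%ram = (2 ^ j < v + v).
  by apply: (ev_ltn w5); [exact: h1|apply: ev_addn; [exact: tz|exact: tz|exact: vW]].
have e2 : (2 ^ j < v + v) = (j < L).
  apply/idP/idP => [h|h]; last by rewrite ltnNge; apply: contraL h => h; rewrite -leqNgt; apply: up_log_min.
  rewrite ltnNge; apply: contraL h => h; rewrite -leqNgt; have := up_logP (v + v) (isT : 1 < 2).
  by move/leq_trans; apply; rewrite leq_exp2l.
have -> : den b t = if j < L then den (x <-- x [+] x ;; lx <-- lx [+] Cs 1)%ram (tick t 6) else tick t 6.
  rewrite -[LHS]/(if ev t (x [<] (z [+] z))%ram == 0 then tick t 6 else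
     den (x <-- x [+] x ;; lx <-- lx [+] Cs 1)%ram (tick t 6)) e1 e2.
  by case: (j < L).
case: ifP => jL; last first.
  exists j; split=> //=.
  - by rewrite /upd riqx.
  - by rewrite /upd riql.
  - by apply/orP; left; rewrite eqn_leq h3 leqNgt jL.
  - by move: h5; rewrite mulSn; clear; lia.
have j1W : 2 ^ j + 2 ^ j < W.
  have : 2 ^ j < v + v by rewrite e2.
  by move: vn nW; clear; lia.
have jW : j + 1 < W.
  rewrite addn1; apply: leq_ltn_trans j1W; apply: leq_trans (_ : 2 ^ j <= _); [exact: ltn_expl|exact: leq_addr].
have d1 : den (x <-- x [+] x)%ram (tick t 6) = setr (tick t 6) x (2 ^ j + 2 ^ j) 4.
  by apply: den_asg; apply: ev_addn; [exact: h1|exact: h1|exact: j1W].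
have d2 : den (lx <-- lx [+] Cs 1)%ram (setr (tick t 6) x (2 ^ j + 2 ^ j) 4) =
   setr (setr (tick t 6) x (2 ^ j + 2 ^ j) 4) lx (j + 1) 4.
  apply: den_asg; apply: ev_addn; [|exact: ev_one|exact: jW].
  by rewrite /= /upd eq_sym (negbTE xl).
rewrite den_sq d1 d2; exists j.+1; split=> //=.
- by rewrite /upd riqx (negbTE xl) eqxx expnS mul2n addnn.
- by rewrite /upd riql eqxx addn1.
- case/orP: h4 => /eqP E; first by rewrite E ltnn in jL.
  by rewrite E eqxx orbT.
- by move: h5; rewrite mulSn; clear; lia.
Qed.

Lemma isqrtC_spec s X Bt a : rg s rX = X -> rg s rBt = Bt -> X = 2 ^ Bt -> rg s rarg = a ->
  a < X * X -> 4 * (X * X) < W ->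
  let s' := den isqrtC s in
  rg s' rq = Nat.sqrt a /\ ck s' <= ck s + 6 + Bt * 40.
Proof.
move=> eX eB XB ea aX XW.
pose s1 := setr (setr s rq 0 2) rbit X 2.
pose b := (rbit <-- rbit [/] Cs 2 ;; ru <-- rq [+] rbit ;;
     If (notE (rarg [<] (ru [*] ru))) (rq <-- ru))%ram.
have -> : den isqrtC s = den (For riq rBt b) s1.
  rewrite -[LHS]/(den (For riq rBt b) (setr (setr s rq (ev s (Cs 0)) 2) rbit (rg s rX) 2)).
  by rewrite ev_zero eX.
have eB1 : rg s1 rBt = Bt by rewrite -eB.
pose I k t := exists q, [/\ rg t rq = q, rg t rbit = 2 ^ (Bt - k), q * q <= a, a < (q + 2 ^ (Bt - k)) * (q + 2 ^ (Bt - k)) &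
  ck t <= ck s + 6 + k * 40].
have : I Bt (den (For riq rBt b) s1).
  rewrite -{1}eB1; apply: (for_frame w5) => [//||k t kl tk fr fa [q [h1 h2 h3 h4 h5]]].
    exists 0; rewrite subn0 -XB; split=> //.
    by rewrite /= addn0 -!addnA.
  rewrite eB1 in kl.
  have E : Bt - k = (Bt - k.+1).+1 by move: kl; clear; lia.
  set h := 2 ^ (Bt - k.+1); have Eh : 2 ^ (Bt - k) = h + h by rewrite E expnS mul2n addnn.
  rewrite Eh in h2 h4.
  have hX : h + h <= X by rewrite -Eh XB leq_exp2l // leq_subr.
  have qX : q < X by rewrite ltnNge; apply/negP => H; move: aX h3 (leq_mul H H); clear; lia.
  have ta : rg t rarg = a by rewrite fr // -ea.
  have smallW y : y <= 4 * (X * X) -> y < W by move=> yX; apply: leq_ltn_trans XW.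
  have X1 : 0 < X by apply: leq_ltn_trans qX.
  have XX : X <= X * X by apply: leq_pmulr.
  have d1 : den (rbit <-- rbit [/] Cs 2)%ram t = setr t rbit h 4.
    apply: den_asg; have -> : h = (h + h) %/ 2 by rewrite addnn -muln2 mulnK.
    by apply: ev_divn; [exact: h2|exact: ev_two|apply: smallW; move: hX XX; clear; lia].
  set t1 := setr t rbit h 4 in d1.
  have d2 : den (ru <-- rq [+] rbit)%ram t1 = setr t1 ru (q + h) 4.
    apply: den_asg; apply: ev_addn; [exact: h1|exact: (rg_setr t rbit h)|].
    by apply: smallW; move: hX XX qX; clear; lia.
  set t2 := setr t1 ru (q + h) 4 in d2.
  have sqW : (q + h) * (q + h) < W.
    apply: smallW; have : q + h <= X + X by move: qX hX; clear; lia.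
    by move=> H; have := leq_mul H H; rewrite mulnDl mulnDr; clear; lia.
  have e3 : ev t2 (notE (rarg [<] (ru [*] ru)))%ram = ((q + h) * (q + h) <= a).
    have u : rg t2 ru = q + h by exact: (rg_setr t1 ru).
    rewrite leqNgt -eqb0; apply: (ev_eqn w5); last exact: ev_zero.
    by apply: (ev_ltn w5); [exact: ta|apply: ev_muln; [exact: u|exact: u|exact: sqW]].
  have d3 : den b t = if (q + h) * (q + h) <= a then setr (tick t2 8) rq (q + h) 2 else tick t2 8.
    rewrite -[LHS]/(den (If (notE (rarg [<] (ru [*] ru))) (rq <-- ru))%ram
       (den (ru <-- rq [+] rbit)%ram (den (rbit <-- rbit [/] Cs 2)%ram t))) d1 d2.
    rewrite -[LHS]/(if ev t2 (notE (rarg [<] (ru [*] ru)))%ram == 0 then tick t2 8 else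
       setr (tick t2 8) rq (rg t2 ru) 2) e3 (rg_setr t1 ru).
    by case: (_ <= a).
  rewrite d3; case: leqP => H.
    exists (q + h); split=> //.
    - by rewrite -addnA.
    - by rewrite /= mulSn; move: h5; clear; lia.
  exists q; split=> //.
  by rewrite /= mulSn; move: h5; clear; lia.
case=> q [h1 _ h3 h4 h5]; split=> //; rewrite h1.
rewrite subnn expn0 addn1 in h4.
by apply/esym/PeanoNat.Nat.sqrt_unique; move: h3 h4; clear; lia.
Qed.

Variables (Lm m : nat).
Hypothesis LmW : Lm * 32 + 32 + n + n <= W.
Hypothesis nL : n < Lm.
Hypothesis m0 : 0 < m.
Hypothesis mn : m <= n.

Lemma copyC_spec s raw : rg s rn = n -> rg s rm = m ->
  (forall a, a < n + m -> mm s a = raw a) ->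
  let s' := den copyC s in
  [/\ forall i, i < n -> ar s' aT i = raw i, forall j, j < m -> ar s' aP j = raw (n + j)
    & ck s' <= ck s + 4 + n * 40].
Proof.
move=> en em Hr.
pose b1 := (Wr aT ri (Rw ri))%ram; pose b2 := (Wr aP ri (Rw (rn [+] ri)))%ram.
have low id i h v a : id < 32 -> i < Lm -> a < n + m -> upd h (adr w n id i) v a = h a.
  move=> idl iL am; rewrite /upd (adr_val w5 LmW) //; case: eqP => // E.
  by move: E am mn; clear; lia.
pose I1 k t := [/\ forall a, a < n + m -> mm t a = raw a, forall i, i < k -> ar t aT i = raw i
   & ck t <= ck s + 2 + k * 15].
have : I1 n (den (For ri rn b1) s).
  rewrite -{1}en; apply: (for_frame w5) => [//||k t kl tk fr fa [h1 h2 h3]].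
    by split=> //; rewrite /= addn0.
  rewrite en in kl; have kL := ltn_trans kl nL.
  have E : den b1 t = Hst (rg t) (upd (mm t) (adr w n aT k) (raw k)) (tp t) (ou t) (ck t + 10).
    by rewrite -[LHS]/(Hst (rg t) (upd (mm t) (adr w n aT (rg t ri)) (mm t (rg t ri))) (tp t) (ou t) (ck t + 10)) tk h1 // ltn_addr.
  rewrite E; split.
  - by move=> a am; rewrite /= low // h1.
  - move=> i; rewrite ltnS => ik; rewrite ar_setr (ar_wr w5 LmW) ?(leq_ltn_trans ik) //=.
    case: eqP => [-> //|/eqP ne]; apply: h2; by rewrite ltn_neqAle ne.
  - by rewrite /= mulSn; move: h3; clear; lia.
move E1 : (den (For ri rn b1) s) => s1 [h1 h2 h3].
have em1 : rg s1 rm = m by rewrite -E1 den_rg.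
have en1 : rg s1 rn = n by rewrite -E1 den_rg.
pose I2 k t := [/\ forall a, a < n + m -> mm t a = raw a, forall j, j < k -> ar t aP j = raw (n + j)
   & ck t <= ck s1 + 2 + k * 17].
have : I2 m (den (For ri rm b2) s1).
  rewrite -{1}em1; apply: (for_frame w5) => [//||k t kl tk fr fa [g1 g2 g3]].
    by split=> //; rewrite /= addn0.
  rewrite em1 in kl; have kL : k < Lm by apply: leq_trans (ltnW nL); apply: leq_trans mn.
  have E2 : ev t (rn [+] ri)%ram = n + k.
    apply: ev_addn; [by rewrite -[LHS]/(rg t rn) fr|exact: tk|].
    by apply: leq_trans LmW; move: kl mn nL; clear; lia.
  have E : den b2 t = Hst (rg t) (upd (mm t) (adr w n aP k) (raw (n + k))) (tp t) (ou t) (ck t + 12).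
    rewrite -[LHS]/(Hst (rg t) (upd (mm t) (adr w n aP (rg t ri)) (mm t (ev t (rn [+] ri)%ram))) (tp t) (ou t) (ck t + 12)).
    by rewrite tk E2 g1 // ltn_add2l.
  rewrite E; split.
  - by move=> a am; rewrite /= low // g1.
  - move=> i; rewrite ltnS => ik; rewrite ar_setr (ar_wr w5 LmW) ?(leq_ltn_trans ik) //=.
    case: eqP => [-> //|/eqP ne]; apply: g2; by rewrite ltn_neqAle ne.
  - by rewrite /= mulSn; move: g3; clear; lia.
have -> : den copyC s = den (For ri rm b2) s1 by rewrite -E1.
move=> [g1 g2 g3]; split=> //; first by move=> i iN; rewrite (den_ar n O w5) // h2.
by move: h3 g3 mn; clear; lia.
Qed.

Local Notation dg := (degT_q O).
Variable tx : nat -> nat.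
Hypothesis txL : forall i, i < n -> tx i < Lm.
Definition first (i : nat) : bool := ~~ [exists j : 'I_i, tx j == tx i].
Definition degsum (k : nat) : nat := \sum_(i < k) first i * dg (tx i).
Hypothesis degW : degsum n < W.
Hypothesis dgW : forall a, dg a < W.

Lemma firstC_spec s : rg s rn = n -> rg s rS = 0 ->
  (forall i, i < n -> ar s aT i = tx i) ->
  (forall a, a < Lm -> ar s aSEEN a = 0) -> (forall a, a < Lm -> ar s aFO a = 0) ->
  let s' := den firstC s in
  [/\ forall i, i < n -> ar s' aFO i = first i, rg s' rS = degsum n
    & ck s' <= ck s + 2 + n * 80].
Proof.
move=> en eS eT S0 F0.
pose I k t := [/\ forall a, a < Lm -> ar t aSEEN a = [exists j : 'I_k, tx j == a],
  forall i, i < Lm -> ar t aFO i = (i < k) && first i, rg t rS = degsum k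
  & ck t <= ck s + 2 + k * 80].
pose b := (Wr aSEEN (Rd aT rp) (Cs 1) ;; Wr aFO rp (Cs 1) ;; rS <-- rS [+] QD (Rd aT rp))%ram.
have : I n (den firstC s).
  rewrite -{1}en; apply: (for_frame w5) => [//||k t kl tk fr fa [h1 h2 h3 h4]].
    split; [| |by rewrite -[LHS]/(rg s rS) eS /degsum big_ord0|by rewrite /= addn0].
    - move=> a aL; rewrite -[LHS]/(ar s aSEEN a) S0 // (_ : [exists _, _] = false) //.
      by apply/existsP => -[[]].
    - by move=> a aL; rewrite -[LHS]/(ar s aFO a) F0.
  rewrite en in kl; have kL := ltn_trans kl nL.
  have eTt u : rg u rp = k -> (forall i, ar u aT i = ar s aT i) -> ev u (Rd aT rp) = tx k.
    by move=> u1 u2; apply: (ev_rd (k := k)) => //; rewrite u2 eT.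
  have eTk := eTt t tk (fun i => fa aT i isT isT).
  have xL := txL kl.
  have e1 : ev t (notE (Rd aSEEN (Rd aT rp))) = first k.
    apply: etrans (ev_eqn w5 (ev_rd eTk (h1 _ xL)) (ev_zero t)) _.
    by rewrite /first eqb0.
  have E : den (If (notE (Rd aSEEN (Rd aT rp))) b) t = if first k then den b (tick t 18) else tick t 18.
    rewrite -[LHS]/(if ev t (notE (Rd aSEEN (Rd aT rp))) == 0 then tick t 18 else den b (tick t 18)) e1.
    by move: (den b _) => z; case: (first k).
  rewrite -/b.
  have sS a : [exists j : 'I_k.+1, tx j == a] = [exists j : 'I_k, tx j == a] || (tx k == a).
    exact: (exists_ordS k (fun j => tx j == a)).
  have dS : degsum k.+1 = degsum k + first k * dg (tx k) by rewrite /degsum big_ord_recr.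
  case fk : (first k) E => E; rewrite E; last first.
    split.
    - move=> a aL; rewrite -[LHS]/(ar t aSEEN a) h1 // sS; case: eqP => [<-|_]; last by rewrite orbF.
      by move: fk; rewrite /first orbT => /negbFE ->.
    - move=> i iL; rewrite -[LHS]/(ar t aFO i) h2 // ltnS [i <= k]leq_eqVlt; case: eqP => [->|//].
      by rewrite fk andbF.
    - by rewrite -[LHS]/(rg t rS) h3 dS fk mul0n addn0.
    - by rewrite /= mulSn; move: h4; clear; lia.
  pose u0 := tick t 18.
  pose u1 := Hst (rg t) (upd (mm t) (adr w n aSEEN (tx k)) 1) (tp t) (ou t) (ck t + 18 + 16).
  pose u2 := Hst (rg t) (upd (mm u1) (adr w n aFO k) 1) (tp t) (ou t) (ck t + 18 + 16 + 9).
  have a1 id i : id < 32 -> i < Lm -> ar u1 id i = if (id == aSEEN) && (i == tx k) then 1 else ar t id i.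
    by move=> idl iL; rewrite /u1 (ar_wr w5 LmW).
  have a2 id i : id < 32 -> i < Lm -> ar u2 id i = if (id == aFO) && (i == k) then 1 else ar u1 id i.
    by move=> idl iL; rewrite /u2 (ar_wr w5 LmW).
  have d1 : den (Wr aSEEN (Rd aT rp) (Cs 1)) u0 = u1.
    rewrite -[LHS]/(Hst (rg t) (upd (mm t) (adr w n aSEEN (ev t (Rd aT rp))) (ev t (Cs 1))) (tp t) (ou t) (ck t + 18 + 16)).
    by rewrite eTk ev_one.
  have d2 : den (Wr aFO rp (Cs 1)) u1 = u2.
    rewrite -[LHS]/(Hst (rg t) (upd (mm u1) (adr w n aFO (rg t rp)) (ev u1 (Cs 1))) (tp t) (ou t) (ck t + 18 + 16 + 9)).
    by rewrite tk ev_one.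
  have eT2 : ev u2 (Rd aT rp) = tx k.
    by apply: (ev_rd (k := k)); [exact: tk|rewrite a2 // a1 //= fa // eT].
  have degk : degsum k.+1 < W.
    apply: leq_ltn_trans degW; rewrite /degsum -(subnKC kl) big_split_ord /=.
    exact: leq_addr.
  have d3 : den (rS <-- rS [+] QD (Rd aT rp))%ram u2 = setr u2 rS (degsum k.+1) 12.
    apply: den_asg; rewrite dS fk mul1n; apply: ev_addn; [exact: h3| |].
      by rewrite -[LHS]/(dg (ev u2 (Rd aT rp)) %% W) eT2 modn_small.
    by move: degk; rewrite dS fk mul1n.
  have -> : den b u0 = setr u2 rS (degsum k.+1) 12.
    by rewrite -[LHS]/(den (rS <-- rS [+] QD (Rd aT rp))%ram (den (Wr aFO rp (Cs 1)) (den (Wr aSEEN (Rd aT rp) (Cs 1)) u0))) d1 d2 d3.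
  split.
  - move=> a aL; rewrite -[LHS]/(ar u2 aSEEN a) sS [tx k == a]eq_sym.
    have -> : ar u2 aSEEN a = ar u1 aSEEN a := a2 aSEEN a isT aL.
    have -> : ar u1 aSEEN a = if a == tx k then 1 else ar t aSEEN a := a1 aSEEN a isT aL.
    by case: eqP => [_|_]; rewrite ?orbT // orbF h1.
  - move=> i iL; rewrite -[LHS]/(ar u2 aFO i) ltnS [i <= k]leq_eqVlt.
    have -> : ar u2 aFO i = if i == k then 1 else ar u1 aFO i := a2 aFO i isT iL.
    have -> : ar u1 aFO i = ar t aFO i := a1 aFO i isT iL.
    by case: eqP => [->|_]; rewrite ?fk // h2.
  - by rewrite -[LHS]/(degsum k.+1).
  - by rewrite -[ck _]/(ck t + 18 + 16 + 9 + 12 + 4) mulSn; move: h4; clear; lia.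
by case=> h1 h2 h3 h4; split=> // i iN; rewrite h2 ?iN // (ltn_trans iN).
Qed.
End Setup.

Definition ell (m : nat) : nat := up_log 2 (m + m).
Definition scale (e n : nat) : nat := (2 ^ ell n) ^ e.
Definition blocks (n m : nat) : nat := n %/ 2 ^ (ell m).-1 + 1.

Section Numbers.
Variables (n m e : nat).
Hypothesis m0 : 0 < m.
Hypothesis mn : m <= n.
Hypothesis e40 : 40 <= e.
Local Notation l := (ell m).
Local Notation Y := (2 ^ ell n).
Local Notation X := (scale e n).
Local Notation N := (2 ^ l).
Local Notation hN := (2 ^ l.-1).

Lemma ell_gt0 k : 0 < k -> 0 < ell k.
Proof. by move=> k0; rewrite /ell up_log_gt0 /= -addn1; apply: leq_add. Qed.

Lemma ell_le : ell m <= ell n.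
Proof. by rewrite /ell leq_up_log // leq_add. Qed.

Lemma two_le_pow k : k + k <= 2 ^ ell k.
Proof. exact: up_logP. Qed.

Lemma Y_ge2 : 2 <= Y.
Proof. by rewrite -{1}(expn1 2) leq_exp2l // ell_gt0 // (leq_trans m0). Qed.

Lemma N_le_Y : N <= Y. Proof. by rewrite leq_exp2l // ell_le. Qed.

Lemma Y_pow_X k : k <= e -> Y ^ k <= X.
Proof. by move=> ke; rewrite /scale leq_pexp2l // expn_gt0. Qed.

Lemma N40_X : N ^ 40 <= X.
Proof. by apply: leq_trans (Y_pow_X e40); rewrite leq_exp2r // N_le_Y. Qed.

Lemma Y3_X : Y * 1000 <= X.
Proof.
apply: leq_trans (Y_pow_X e40); rewrite (expnD Y 1 39) expn1 leq_mul2l; apply/orP; right.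
apply: leq_trans (_ : 2 ^ 39 <= _); last by rewrite leq_exp2r // Y_ge2.
by apply: leq_trans (_ : 2 ^ 10 <= _) => //; rewrite leq_exp2l.
Qed.

Lemma n_le_Y : n + n <= Y. Proof. exact: two_le_pow. Qed.

Lemma m_le_hN : m <= hN.
Proof.
have := two_le_pow m; rewrite (N_half (ell_gt0 m0)) !addnn leq_double.
by [].
Qed.

Lemma hN_le_Y : hN + hN <= Y. Proof. by rewrite -(N_half (ell_gt0 m0)) N_le_Y. Qed.

Lemma blocks_gt : n < blocks n m * hN.
Proof. by rewrite /blocks addn1 -ltn_divLR ?expn_gt0. Qed.

Lemma blocks_le : blocks n m * hN + N <= X * X.
Proof.
rewrite /blocks mulnDl mul1n; have := leq_trunc_div n hN; have := hN_le_Y; have := N_le_Y.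
have := n_le_Y; have := Y3_X; have := Y_ge2; move: (n %/ hN * hN) => q.
move: Y N hN => y a b; have : X <= X * X by apply: leq_pmulr; rewrite expn_gt0 expn_gt0.
by move: X => x; clear; lia.
Qed.
End Numbers.

Section Prelude.
Variables (w n m e cc : nat) (O : oracle).
Local Notation W := (2 ^ w).
Local Notation ev := (ev w n O).
Local Notation den := (den w n O).
Local Notation ar := (ar w n).
Local Notation wd := (wd w).
Variable R : rcfType.
Local Notation l := (ell m).
Local Notation Ln := (ell n).
Local Notation Y := (2 ^ ell n).
Local Notation X := (scale e n).
Local Notation N := (2 ^ l).
Local Notation hN := (2 ^ l.-1).
Local Notation nb := (blocks n m).
Local Notation Lm := (X * X).
Hypothesis m0 : 0 < m.
Hypothesis mn : m <= n.
Hypothesis e40 : 40 <= e.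
Hypothesis cce : cc <= e.
Hypothesis XW : 4 * (X * (X * X)) <= W.
Let n0 : 0 < n := leq_trans m0 mn.
Let l0 : 0 < l := ell_gt0 m0.
Let XN := N40_X mn e40.
Let X1000 : 1000 <= X := X_big l0 XN.

Lemma XX_W : 1000 * (X * X) <= W.
Proof. by apply: leq_trans XW; move: X1000; move: X => x; clear; nia. Qed.

Lemma w_ge5 : 5 <= w.
Proof.
rewrite -(@leq_exp2l 2) //; apply: leq_trans XX_W.
have : 0 < X * X by rewrite muln_gt0 (leq_trans _ X1000).
by move: (X * X); clear; lia.
Qed.

Let w5 := w_ge5.

Lemma XX_X : 1000 * X <= X * X.
Proof. by rewrite leq_mul2r X1000 orbT. Qed.

Lemma Lm_W : Lm * 32 + 32 + n + n <= W.
Proof.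
apply: leq_trans XX_W; have := n_le_Y n; have := Y3_X m0 mn e40; have := XX_X; have := X1000.
by move: (X * X) X Y => a b c; clear; lia.
Qed.

Let LmW := Lm_W.

Lemma lt_W k : k <= 4 * (X * X) -> k < W.
Proof.
move=> h; apply: leq_ltn_trans h _; apply: leq_trans XX_W; have := XX_X; have := X1000.
by move: (X * X) X => a b; clear; lia.
Qed.

Lemma powE_ev s k : rg s rY = Y -> k <= e -> ev s (powE k) = Y ^ k.
Proof.
move=> eY; elim: k => [|k IH] ke; first exact: ev_one.
rewrite expnSr; apply: ev_muln; [exact: IH (ltnW ke)|exact: eY|].
rewrite -expnSr; apply: lt_W; apply: leq_trans (Y_pow_X n ke) _.
by move: XX_X; move: (X * X) X => a b; clear; lia.
Qed.

Lemma esz_powE k : esz (powE k) = 1 + k * 2.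
Proof. by elim: k => //= k ->; clear; lia. Qed.

Lemma constC_spec s : rg s rn = n -> rg s rm = m ->
  let s' := den (constC e) s in
  [/\ consts X l m nb s', rg s' rLn = Ln, rg s' rBt = e * Ln & ck s' <= ck s + n * 60 + e * 2 + 100].
Proof.
move=> en em.
have nW : 4 * n < W.
  apply: lt_W; have := n_le_Y n; have := Y3_X m0 mn e40; have := XX_X; move: (X * X) X Y => a b c; clear; lia.
have [a1 a2 a3] := logC_spec O w5 n0 (isT : [|| [&& rN == rN, rl == rl & rm == rm] | [&& rN == rY, rl == rLn & rm == rn]]) en em m0 mn nW.
move: a1 a2 a3; move E1 : (den (logC rN rl rm) s) => s1 a1 a2 a3.
have en1 : rg s1 rn = n by rewrite -E1 den_rg.
have [b1 b2 b3] := logC_spec O w5 n0 (isT : [|| [&& rY == rN, rLn == rl & rn == rm] | [&& rY == rY, rLn == rLn & rn == rn]]) en1 en1 n0 (leqnn n) nW.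
move: b1 b2 b3; move E2 : (den (logC rY rLn rn) s1) => s2 b1 b2 b3.
have en2 : rg s2 rn = n by rewrite -E2 den_rg.
have em2 : rg s2 rm = m by rewrite -E2 den_rg // -E1 den_rg.
have eN2 : rg s2 rN = N by rewrite -E2 den_rg.
have el2 : rg s2 rl = l by rewrite -E2 den_rg.
have XXX := XX_X; have YX := Y3_X m0 mn e40; have Ye2 := Y_ge2 m0 mn; have nY := n_le_Y n; have NY := N_le_Y mn.
have hY := hN_le_Y m0 mn.
have LnY : Ln <= Y by apply: ltnW; apply: ltn_expl.
have eX2 : e <= X by rewrite /scale -expnM; apply: ltnW; apply: leq_ltn_trans (ltn_expl _ (isT : 1 < 2)); rewrite leq_pmull // ell_gt0.
have d1 := den_asg rX (powE_ev b1 (leqnn e)).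
set s3 := setr s2 rX _ _ in d1.
have d2 : den (rBt <-- Cs e [*] rLn)%ram s3 = setr s3 rBt (e * Ln) 4.
  apply: den_asg; apply: ev_muln; [apply: ev_cst; apply: lt_W; move: eX2 XXX; move: (X * X) X => a b; clear; lia|exact: b2|].
  apply: lt_W; apply: leq_trans (leq_mul eX2 LnY) _.
  apply: (@leq_trans (X * X)); last by clear; lia.
  by rewrite leq_mul2l; apply/orP; right; move: YX; move: X Y => b c; clear; lia.
set s4 := setr s3 rBt _ _ in d2.
have vX : ev s4 rX = X by [].
have d3 : den (rOFF <-- rX [*] rX)%ram s4 = setr s4 rOFF (X * X) 4.
  by apply: den_asg; apply: ev_muln => //; apply: lt_W; move: (X * X) => a; clear; lia.
set s5 := setr s4 rOFF _ _ in d3.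
have d4 : den (rXO <-- rX [*] rOFF)%ram s5 = setr s5 rXO (X * (X * X)) 4.
  apply: den_asg; apply: ev_muln => //; apply: leq_trans XW.
  have : 0 < X * (X * X) by rewrite !muln_gt0 (leq_trans _ X1000).
  by move: (X * (X * X)) => a; clear; lia.
set s6 := setr s5 rXO _ _ in d4.
have d5 : den (rhN <-- rN [/] Cs 2)%ram s6 = setr s6 rhN hN 4.
  apply: den_asg; have -> : hN = N %/ 2 by rewrite (N_half l0) addnn -muln2 mulnK.
  apply: ev_divn; [exact: eN2|exact: ev_two|apply: lt_W].
  by move: NY YX XXX; move: (X * X) X Y N => a b c d; clear; lia.
set s7 := setr s6 rhN _ _ in d5.
have d6 : den (rnb <-- rn [/] rhN [+] Cs 1)%ram s7 = setr s7 rnb nb 6.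
  apply: den_asg; apply: ev_addn; [apply: ev_divn; [exact: en2|reflexivity|]|exact: ev_one|].
    by apply: leq_ltn_trans nW; clear; lia.
  by apply: leq_ltn_trans nW; have := leq_div n hN; move: n0; move: (n %/ hN) => q; clear; lia.
set s8 := setr s7 rnb _ _ in d6.
have d7 : den (rHALF <-- rhN [*] rX)%ram s8 = setr s8 rHALF (hN * X) 4.
  apply: den_asg; apply: ev_muln => //; apply: lt_W; apply: (@leq_trans (X * X)); last by clear; lia.
  by rewrite leq_mul2r; apply/orP; right; move: hY YX; move: X Y hN => b c d; clear; lia.
set s9 := setr s8 rHALF _ _ in d7.
have d8 : den (rNX <-- rN [*] rX)%ram s9 = setr s9 rNX (N * X) 4.
  apply: den_asg; apply: ev_muln; [exact: eN2|reflexivity|apply: lt_W; apply: (@leq_trans (X * X)); last by clear; lia].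
  by rewrite leq_mul2r; apply/orP; right; move: NY YX; move: X Y N => b c d; clear; lia.
set s10 := setr s9 rNX _ _ in d8.
have d9 : den (rm1 <-- rm [-] Cs 1)%ram s10 = setr s10 rm1 m.-1 4.
  apply: den_asg; rewrite -subn1; apply: ev_subn; [exact: em2|exact: ev_one|].
  by rewrite m0 (leq_ltn_trans _ nW) //; move: mn; clear; lia.
have -> : den (constC e) s = setr s10 rm1 m.-1 4.
  rewrite /constC den_sq E1 den_sq E2 den_sq d1 den_sq d2 den_sq d3 den_sq d4 den_sq d5 den_sq d6.
  by rewrite den_sq d7 den_sq d8 d9.
have ec : ck (setr s10 rm1 m.-1 4) = ck s2 + (esz (powE e) + 1) + 34.
  by rewrite /= -!addnA.
have g1 : consts X l m nb (setr s10 rm1 m.-1 4) by split.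
have g2 : rg (setr s10 rm1 m.-1 4) rBt = e * Ln by [].
split=> //.
by rewrite ec esz_powE; move: a3 b3; clear; lia.
Qed.

Variable tx : nat -> nat.
Hypothesis txL : forall i, i < n -> tx i < Lm.
Hypothesis degX : degsum O tx n < X.
Hypothesis dgW : forall a, degT_q O a < W.
Local Notation D := (Nat.sqrt (degsum O tx n %/ Ln)).

Lemma paramC_spec s : rg s rn = n -> rg s rLn = Ln -> rg s rX = X -> rg s rBt = e * Ln ->
  (forall i, i < n -> ar s aT i = tx i) ->
  (forall a, a < Lm -> ar s aSEEN a = 0) -> (forall a, a < Lm -> ar s aFO a = 0) ->
  let s' := den (paramC cc) s in
  [/\ rg s' rD = D /\ rg s' rK = 4 * D + 1, rg s' rK1 = (4 * D + 1).+1,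
      rg s' rreps = (if D == 0 then 1 else cc * Ln),
      forall i, i < n -> ar s' aFO i = first tx i
    & ck s' <= ck s + n * 80 + e * Ln * 40 + 60].
Proof.
move=> en eL eX eB eT hS hF.
have XXX := XX_X; have YX := Y3_X m0 mn e40; have nY := n_le_Y n; have x1000 := X1000.
have LnY : Ln <= Y by apply: ltnW; apply: ltn_expl.
have eX2 : e <= X by rewrite /scale -expnM; apply: ltnW; apply: leq_ltn_trans (ltn_expl _ (isT : 1 < 2)); rewrite leq_pmull // ell_gt0.
have nLm : n < Lm by move: nY YX XXX x1000; move: (X * X) X Y => a b c; clear; lia.
have dW : degsum O tx n < W.
  by apply: lt_W; apply: leq_trans (ltnW degX) _; move: XXX; move: (X * X) X => a b; clear; lia.
have d0 : den (rS <-- Cs 0)%ram s = setr s rS 0 2 by apply: den_asg; apply: ev_zero.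
set s0 := setr s rS 0 2 in d0.
have [a1 a2 a3] := @firstC_spec w n O w5 Lm LmW nLm tx txL dW dgW s0 en erefl eT hS hF.
move: a1 a2 a3; move E1 : (den firstC s0) => s1 a1 a2 a3.
have f1 x : x \notin [:: rS; rp] -> rg s1 x = rg s x.
  rewrite !inE negb_or => /andP[h1 h2]; rewrite -E1 den_rg; last by rewrite /= !inE negb_or h1 h2.
  by rewrite /s0 /= /upd (negbTE h1).
have d2 : den (rarg <-- rS [/] rLn)%ram s1 = setr s1 rarg (degsum O tx n %/ Ln) 4.
  by apply: den_asg; apply: ev_divn; [exact: a2|rewrite -[LHS]/(rg s1 rLn) f1|].
set s2 := setr s1 rarg _ _ in d2.
have gX : degsum O tx n %/ Ln < X by apply: leq_ltn_trans degX; apply: leq_div.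
have gXX : degsum O tx n %/ Ln < X * X.
  by apply: leq_trans gX _; move: XXX; move: (X * X) X => a b; clear; lia.
have XW4 : 4 * (X * X) < W by apply: lt_W.
have eX3 : rg s2 rX = X by rewrite -[LHS]/(rg s1 rX) f1.
have eB3 : rg s2 rBt = e * Ln by rewrite -[LHS]/(rg s1 rBt) f1.
have XB : X = 2 ^ (e * Ln) by rewrite mulnC expnM.
have [b1 b2] := isqrtC_spec n O w5 eX3 eB3 XB (rg_setr s1 rarg _ _) gXX XW4.
move: b1 b2; move E3 : (den isqrtC s2) => s3 b1 b2.
have DX : D < X.
  have /andP[+ _] := sqrt_bounds (degsum O tx n %/ Ln).
  move: (degsum O tx n %/ Ln) (Nat.sqrt _) (X) gX => g s0' x; clear; case: s0' => [|q]; nia.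
have smallW y : y <= 4 * X + 4 -> y < W.
  by move=> h; apply: lt_W; move: h XXX x1000; move: (X * X) X => a b; clear; lia.
have d4 : den (rD <-- rq)%ram s3 = setr s3 rD D 2 by apply: den_asg.
set s4 := setr s3 rD D 2 in d4.
have d5 : den (rK <-- Cs 4 [*] rD [+] Cs 1)%ram s4 = setr s4 rK (4 * D + 1) 6.
  apply: den_asg; apply: ev_addn; [apply: ev_muln; [apply: ev_cst; apply: smallW; clear; lia|reflexivity|]|exact: ev_one|].
    by apply: smallW; move: DX; move: X D => a b; clear; lia.
  by apply: smallW; move: DX; move: X D => a b; clear; lia.
set s5 := setr s4 rK _ _ in d5.
have d6 : den (rK1 <-- rK [+] Cs 1)%ram s5 = setr s5 rK1 (4 * D + 1).+1 4.
  apply: den_asg; have -> : (4 * D + 1).+1 = 4 * D + 1 + 1 by rewrite [RHS]addn1.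
  apply: ev_addn; [reflexivity|exact: ev_one|].
  by apply: smallW; move: DX; move: X D => a b; clear; lia.
set s6 := setr s5 rK1 _ _ in d6.
have d7 : den (rreps <-- Cs 1)%ram s6 = setr s6 rreps 1 2 by apply: den_asg; apply: ev_one.
set s7 := setr s6 rreps _ _ in d7.
have d8 : den (If rD (rreps <-- Cs cc [*] rLn))%ram s7 =
   if D == 0 then tick s7 2 else setr (tick s7 2) rreps (cc * Ln) 4.
  rewrite -[LHS]/(if D == 0 then tick s7 2 else den (rreps <-- Cs cc [*] rLn)%ram (tick s7 2)).
  case: (D == 0) => //; apply: den_asg; apply: ev_muln.
  - apply: ev_cst; apply: smallW; move: eX2 cce; move: X => a; clear; lia.
  - rewrite -[LHS]/(rg s3 rLn) -E3 den_rg // -[LHS]/(rg s1 rLn) f1 //.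
  - apply: lt_W; apply: leq_trans (leq_mul (leq_trans cce eX2) LnY) _.
    apply: (@leq_trans (X * X)); last by clear; lia.
    by rewrite leq_mul2l; apply/orP; right; move: YX; move: X Y => b c; clear; lia.
have -> : den (paramC cc) s = if D == 0 then tick s7 2 else setr (tick s7 2) rreps (cc * Ln) 4.
  by rewrite /paramC den_sq d0 den_sq E1 den_sq d2 den_sq E3 den_sq d4 den_sq d5 den_sq d6 den_sq d7 d8.
have c7 : ck s7 = ck s3 + 14 by rewrite /= -!addnA.
have c2 : ck s2 = ck s1 + 4 by [].
have c0 : ck s0 = ck s + 2 by [].
have hFO i : i < n -> ar s3 aFO i = first tx i by move=> iN; rewrite -E3 (den_ar n O w5) // -a1.
have ckb : ck s7 + 6 <= ck s + n * 80 + e * Ln * 40 + 60.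
  by rewrite c7; move: b2; rewrite c2; move: a3; rewrite c0; move: (ck s3) (ck s1) (e * Ln); clear; lia.
have ck2 : ck s7 + 2 <= ck s + n * 80 + e * Ln * 40 + 60 by apply: leq_trans ckb; rewrite leq_add2l.
case: (D == 0); split=> //.
by apply: leq_trans ckb; rewrite -[ck _]/(ck s7 + 2 + 4) -addnA.
Qed.

Lemma tab_stable j v : j <= l -> v < 2 ^ j -> tab X l v = tab X j v.
Proof.
move=> + vj; elim: (l) => [|L IH]; first by rewrite leqn0 => /eqP ->.
rewrite leq_eqVlt => /predU1P[-> //|]; rewrite ltnS => jL /=.
by rewrite leqNgt (leq_trans vj) ?leq_exp2l //= IH.
Qed.

Lemma seed_le j : (seed X j).1 <= 2 * X /\ (seed X j).2 <= 2 * X.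
Proof.
have X0 : 0 < X by apply: leq_trans X1000.
have bz : bounded (1 : R) (zeta R j).
  have := zeta_csP R j; rewrite /zeta; case: (zeta_cs R j) => a b [a0 b0 ab].
  by split; rewrite /= ler_norml; apply/andP; split; nra.
have X60 : (60 <= X%:R :> R)%R by rewrite ler_nat (leq_trans _ X1000).
have [h1 h2] := near_small X0 (seed_near R X1000 j) bz X60.
have E2 : ((1 : R) + 1 = 2%:R)%R by [].
rewrite E2 -natrM -pmulrn normr_nat ler_nat mulnC in h1.
by rewrite E2 -natrM -pmulrn normr_nat ler_nat mulnC in h2.
Qed.

Let N0 : 0 < N := expn_gt0 2 l.
Let NLm : nb * hN + N <= Lm := blocks_le m0 mn e40.
Let mhN : m <= hN := m_le_hN m0.

Lemma tableC_spec s : consts X l m nb s -> rg s rBt = e * Ln ->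
  let s' := den tableC s in
  parr w n l s' aUR aUI (tab X l) /\ ck s' <= ck s + 50 + N * 130 + l * (e * Ln * 40 + 60).
Proof.
move=> cs eB.
have XXX := XX_X; have x1000 := X1000.
have XW4 : 4 * (X * X) < W by apply: lt_W.
have NLm' : N <= Lm by apply: leq_trans NLm; apply: leq_addl.
have XB : X = 2 ^ (e * Ln) by rewrite mulnC expnM.
have d1 : den (rzc <-- Cs 0)%ram s = setr s rzc 0 2 by apply: den_asg; apply: ev_zero.
set s1 := setr s rzc 0 2 in d1.
have d2 : den (rzs <-- rX)%ram s1 = setr s1 rzs X 2 by apply: den_asg; exact: c_X cs.
set s2 := setr s1 rzs X 2 in d2.
have d3 : den (rpw <-- Cs 1)%ram s2 = setr s2 rpw 1 2 by apply: den_asg; exact: ev_one.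
set s3 := setr s2 rpw 1 2 in d3.
pose s4 := Hst (rg s3) (upd (mm s3) (adr w n aUR 0) X) (tp s3) (ou s3) (ck s3 + 9).
have d4 : den (Wr aUR (Cs 0) rX) s3 = s4.
  rewrite -[LHS]/(Hst (rg s3) (upd (mm s3) (adr w n aUR (ev s3 (Cs 0))) (rg s rX)) (tp s3) (ou s3) (ck s3 + 9)).
  by rewrite ev_zero (c_X cs).
pose s5 := Hst (rg s3) (upd (mm s4) (adr w n aUI 0) 0) (tp s3) (ou s3) (ck s4 + 9).
have d5 : den (Wr aUI (Cs 0) (Cs 0)) s4 = s5.
  rewrite -[LHS]/(Hst (rg s3) (upd (mm s4) (adr w n aUI (ev s4 (Cs 0))) (ev s4 (Cs 0))) (tp s3) (ou s3) (ck s4 + 9)).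
  by rewrite !ev_zero.
have L0 : 0 < Lm by apply: leq_trans NLm'.
have u5 : ar s5 aUR 0 = X.
  by rewrite /s5 (ar_wr w5 LmW) //= -[LHS]/(ar s4 aUR 0) /s4 (ar_wr w5 LmW).
have v5 : ar s5 aUI 0 = 0 by rewrite /s5 (ar_wr w5 LmW).
have cs5 : consts X l m nb s5 by apply: consts_frame cs => x; rewrite !inE; do ![case/predU1P=> [-> //|]] => /eqP ->.
have k5 : ck s5 = ck s + 24 by rewrite /= -!addnA.
pose fb := fill2 rpw rpw aUR aUI (mulre (Rd aUR ri) (Rd aUI ri) rzc rzs)
                           (mulim (Rd aUR ri) (Rd aUI ri) rzc rzs).
pose Bt40 := e * Ln * 40.
pose I j t := [/\ rg t rpw = 2 ^ j, rg t rzc = (seed X j).1 /\ rg t rzs = (seed X j).2,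
  forall v, v < 2 ^ j -> ar t aUR v = wd (tab X j v).1 /\ ar t aUI v = wd (tab X j v).2
  & ck t <= ck s + 26 + 2 ^ j * 130 + j * (Bt40 + 60)].
have : I l (den (For rt rl (fb ;; seedC)%ram) s5).
  rewrite -{1}(c_l cs5); apply: (for_frame w5) => [//||k t kl tk fr fa [h1 [h2 h3] h4 h5]].
    split=> //; last by rewrite -[ck _]/(ck s5 + 2) k5 -addnA mul0n addn0; apply: leq_addr.
    move=> v; rewrite expn0 ltnS leqn0 => /eqP ->; split=> /=; last first.
      by rewrite -[LHS]/(ar s5 aUI 0) v5 -[RHS]/(wd (Posz 0)) wd_nat ?expn_gt0.
    by rewrite -[LHS]/(ar s5 aUR 0) u5 wd_nat //; apply: lt_W; move: XXX; move: (X * X) X => a b; clear; lia.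
  rewrite (c_l cs5) in kl.
  have frc x : x \in cregs ++ [:: rBt] -> rg t x = rg s5 x.
    by move=> xc; apply: fr; move: x xc; apply/allP.
  have ct : consts X l m nb t.
    by apply: (consts_frame _ cs5) => x xc; apply: frc; rewrite mem_cat xc.
  have kk : 2 ^ k + 2 ^ k = 2 ^ k.+1 by rewrite addnn -mul2n -expnS.
  have kN : 2 ^ k.+1 <= N by rewrite leq_exp2l.
  have [sd1 sd2] := seed_le k.
  have sX y : y <= 2 * X -> y < W.
    by move=> h; apply: lt_W; move: h XXX; move: (X * X) X => a b; clear; lia.
  have sm2 : small2 X l (zseed X k).
    have : 2 * X <= 2 * (X * N ^ 8) by rewrite leq_mul2l /= leq_pmulr // expn_gt0 N0.
    by split; rewrite /= lez_nat; [apply: leq_trans sd1 _|apply: leq_trans sd2 _].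
  have [|||b1 b2 b3] := @fill2_spec w n O Lm w5 LmW rpw rpw aUR aUI
     (mulre (Rd aUR ri) (Rd aUI ri) rzc rzs) (mulim (Rd aUR ri) (Rd aUI ri) rzc rzs) t
     (2 ^ k) (2 ^ k) (fun j => wd (pmul X (tab X k j) (zseed X k)).1)
     (fun j => wd (pmul X (tab X k j) (zseed X k)).2) isT isT isT isT erefl isT isT h1.
  - apply: leq_trans NLm'; apply: leq_trans kN; by rewrite -kk leq_addl.
  - by rewrite kk; apply: leq_trans NLm'.
  - move=> j jk; have ct' : consts X l m nb (setr t ri j 0) by apply: consts_setr.
    have [q1 q2] := h4 _ jk.
    have e1 : ev (setr t ri j 0) (Rd aUR ri) = wd (tab X k j).1 by apply: (ev_rd (k := j)) => //=.
    have e2 : ev (setr t ri j 0) (Rd aUI ri) = wd (tab X k j).2 by apply: (ev_rd (k := j)) => //=.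
    have e3 : ev (setr t ri j 0) rzc = wd (zseed X k).1.
      by rewrite -[LHS]/(rg t rzc) h2 /= wd_nat // sX.
    have e4 : ev (setr t ri j 0) rzs = wd (zseed X k).2.
      by rewrite -[LHS]/(rg t rzs) h3 /= wd_nat // sX.
    have jN : j < N by apply: leq_trans jk _; apply: leq_trans kN; rewrite -kk leq_addl.
    have sm : small_int X l (tab X k j).
      by rewrite -(tab_stable (ltnW kl) jk); apply: tab_small_int.
    split; [exact: h1|exact: (ev_mulre w5 LmW l0 XN XW ct' e1 e2 e3 e4 sm sm2)|exact: (ev_mulim w5 LmW l0 XN XW ct' e1 e2 e3 e4 sm sm2)].
  move: b1 b2 b3; rewrite -/fb; move Et : (den fb t) => t1 b1 b2 b3.
  have f1 x : x != ri -> rg t1 x = rg t x by move=> xi; rewrite -Et den_rg //= !inE !negb_or !xi.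
  have eX1 : rg t1 rX = X by rewrite f1 // (c_X ct).
  set a := (X * X + X * (seed X k).1) %/ 2.
  have aXX : a < X * X.
    have := seed1_lt k (leq_trans (isT : 0 < 1000) x1000); rewrite /a ltn_divLR //.
    move: (X) ((seed X k).1) x1000 => x y; clear; nia.
  have D1 : den (rarg <-- (rX [*] rX [+] rX [*] rzc) [/] Cs 2)%ram t1 = setr t1 rarg a 10.
    have XX2 : X * (seed X k).1 <= 2 * (X * X) by rewrite mulnCA leq_mul2l sd1 orbT.
    apply: den_asg; apply: ev_divn; [apply: ev_addn|exact: ev_two|].
    - by apply: ev_muln; [exact: eX1|exact: eX1|apply: lt_W; move: (X * X) => b; clear; lia].
    - apply: ev_muln; [exact: eX1|by rewrite -[LHS]/(rg t1 rzc) f1|].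
      by apply: lt_W; apply: leq_trans XX2 _; move: (X * X) => b; clear; lia.
    - by apply: lt_W; move: XX2; move: (X * X) (X * _) => b c; clear; lia.
    - by apply: lt_W; move: XX2; move: (X * X) (X * _) => b c; clear; lia.
  set t2 := setr t1 rarg a 10 in D1.
  have eB2 : rg t2 rBt = e * Ln by rewrite -[LHS]/(rg t1 rBt) f1 // frc // -eB.
  have [g1 g2] := isqrtC_spec n O w5 (eX1 : rg t2 rX = X) eB2 XB (rg_setr t1 rarg a 10) aXX XW4.
  move: g1 g2; move E3 : (den isqrtC t2) => t3 g1 g2.
  have f3 x : x \notin [:: rq; rbit; riq; ru] -> rg t3 x = rg t2 x.
    by rewrite !inE !negb_or => /and4P[p1 p2 p3 p4]; rewrite -E3 den_rg //= !inE !negb_or p1 p2 p3 p4.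
  have sq1 : (seed X k.+1).1 = Nat.sqrt a by [].
  have [nd1 nd2] := seed_le k.+1.
  have D4 : den (rzs <-- (rzs [*] rX) [/] (rq [+] rq))%ram t3 = setr t3 rzs (seed X k.+1).2 8.
    apply: den_asg; have -> : (seed X k.+1).2 = ((seed X k).2 * X) %/ (Nat.sqrt a + Nat.sqrt a) by [].
    have zX : (seed X k).2 * X < W.
      apply: lt_W; apply: (@leq_trans (2 * X * X)); first by rewrite leq_mul2r sd2 orbT.
      by rewrite -mulnA; move: (X * X) => b; clear; lia.
    apply: ev_divn; [apply: ev_muln|apply: ev_addn; [exact: g1|exact: g1|]|exact: zX].
    - by rewrite -[LHS]/(rg t3 rzs) f3 // -[LHS]/(rg t1 rzs) f1.
    - by rewrite -[LHS]/(rg t3 rX) f3.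
    - exact: zX.
    - by rewrite -sq1; apply: lt_W; move: nd1 XXX; move: (X * X) X ((seed _ _).1) => b c d; clear; lia.
  set t4 := setr t3 rzs _ _ in D4.
  have D5 : den (rzc <-- rq)%ram t4 = setr t4 rzc (seed X k.+1).1 2 by apply: den_asg.
  set t5 := setr t4 rzc _ _ in D5.
  have D6 : den (rpw <-- rpw [+] rpw)%ram t5 = setr t5 rpw (2 ^ k.+1) 4.
    have e6 : ev t5 rpw = 2 ^ k by rewrite -[LHS]/(rg t3 rpw) f3 // -[LHS]/(rg t1 rpw) f1.
    apply: den_asg; rewrite -kk; apply: ev_addn => //; rewrite kk.
    apply: lt_W; apply: leq_trans kN _; apply: leq_trans NLm' _; by clear; lia.
  have -> : den (fb ;; seedC)%ram t = setr t5 rpw (2 ^ k.+1) 4.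
    by rewrite den_sq Et /seedC den_sq D1 den_sq E3 den_sq D4 den_sq D5 D6.
  have ar5 id i : id < 32 -> ar (setr (setr t5 rpw (2 ^ k.+1) 4) rt k.+1 4) id i = ar t1 id i.
    move=> idl; rewrite -[LHS]/(ar t3 id i) -E3 (den_ar n O w5) //.
  split=> //.
  - move=> v vk; rewrite !ar5 //.
    have vL : v < Lm by apply: leq_trans vk _; apply: leq_trans NLm'.
    rewrite b1 // b2 // kk vk andbT /=; case: (leqP (2 ^ k) v) => kv //; exact: h4.
  - rewrite -[ck _]/(ck t3 + 8 + 2 + 4 + 4) mulSn.
    have := g2; rewrite -[ck t2]/(ck t1 + 10) b3.
    rewrite -[esz (mulre _ _ _ _)]/27 -[esz (mulim _ _ _ _)]/27 -[esz (Vr _)]/1.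
    have : Bt40 = e * Ln * 40 by [].
    move: h5 kk; move: (2 ^ k) (2 ^ k.+1) (ck t3) (e * Ln) (Bt40) => x1 x2 x3 x4 x5; clear; lia.
move Ef : (den (For rt rl (fb ;; seedC)%ram) s5) => s6 [_ _ h4 h5].
have -> : den tableC s = s6.
  by rewrite /tableC den_sq d1 den_sq d2 den_sq d3 den_sq d4 den_sq d5 -Ef.
split; first exact: h4.
by move: h5; rewrite /Bt40; clear; lia.
Qed.
End Prelude.

Definition threshold (O : oracle) (tx : nat -> nat) (n : nat) : nat :=
  Nat.sqrt (degsum O tx n %/ ell n).
Definition colours (O : oracle) tx n : nat := 4 * threshold O tx n + 1.
Definition repeats (cc : nat) (O : oracle) tx n : nat :=
  if threshold O tx n == 0 then 1 else cc * ell n.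

Section Program.
Variables (w n m e cc : nat) (O : oracle).
Local Notation W := (2 ^ w).
Local Notation ev := (ev w n O).
Local Notation den := (den w n O).
Local Notation ar := (ar w n).
Local Notation wd := (wd w).
Variable R : rcfType.
Local Notation l := (ell m).
Local Notation Ln := (ell n).
Local Notation Y := (2 ^ ell n).
Local Notation X := (scale e n).
Local Notation N := (2 ^ l).
Local Notation hN := (2 ^ l.-1).
Local Notation nb := (blocks n m).
Local Notation Lm := (X * X).
Hypothesis m0 : 0 < m.
Hypothesis mn : m <= n.
Hypothesis e40 : 40 <= e.
Hypothesis cce : cc <= e.
Hypothesis XW : 4 * (X * (X * X)) <= W.
Variables tx px : nat -> nat.
Hypothesis txL : forall i, i < n -> tx i < Lm.
Hypothesis pxL : forall j, j < m -> px j < Lm.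
Hypothesis degX : degsum O tx n < X.
Hypothesis dgW : forall a, degT_q O a < W.
Hypothesis nbrL : forall a q, nbr_q O a q < Lm.
Hypothesis mtW : forall a b, match_q O a b < W.
Local Notation D := (threshold O tx n).
Local Notation K := (colours O tx n).
Local Notation reps := (repeats cc O tx n).

Definition light_miss (tape : seq nat) (p : nat) : bool :=
  [exists rep : 'I_reps,
     light_cross tx px (degT_q O) (nbr_q O) n m D K (hash w m px K tape rep) p].
Definition heavy_miss (p : nat) : bool :=
  [exists i : 'I_n, heavy_first O tx (first tx) D i && heavy_cross tx px (match_q O) n m (tx i) p].
Definition heavy_count : nat := \sum_(i < n) heavy_first O tx (first tx) D i.
Definition total_cost : nat :=
  300 + n * 230 + e * 2 + e * Ln * 40 + N * 130 + l * (e * Ln * 40 + 60) +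
  reps * rep_cost n l m nb D K + heavy_count * (round_cost n l nb + 10).

Let n0 : 0 < n := leq_trans m0 mn.
Let l0 : 0 < l := ell_gt0 m0.
Let XN := N40_X mn e40.
Let X1000 : 1000 <= X := X_big l0 XN.
Let w5 := w_ge5 m0 mn e40 XW.
Let LmW := Lm_W m0 mn e40 XW.
Let NLm : nb * hN + N <= Lm := blocks_le m0 mn e40.
Let mhN : m <= hN := m_le_hN m0.
Let XXX := XX_X m0 mn e40.

Lemma threshold_lt : D < X.
Proof.
rewrite /threshold.
have /andP[+ _] := sqrt_bounds (degsum O tx n %/ Ln).
have := leq_ltn_trans (leq_div _ Ln) degX.
move: (degsum O tx n %/ Ln) (Nat.sqrt _) (X) => g s x; clear; case: s => [|q]; nia.
Qed.

Lemma colours_fit : n.+1 * K.+1 <= Lm.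
Proof.
have := threshold_lt; have := n_le_Y n; have := Y3_X m0 mn e40; have := X1000; rewrite /colours.
move: X Y (D) => x y d h1 h2 h3 h4.
apply: (@leq_trans (n.+1 * (4 * x))); first by rewrite leq_mul2l /= ; move: h4; clear; lia.
by rewrite mulnA leq_mul2r; apply/orP; right; move: h1 h2 h3 n0; clear; lia.
Qed.

Lemma repeats_fit : reps < Lm.
Proof.
have := XXX; have := X1000; have := Y3_X m0 mn e40.
have LnY : Ln <= Y by apply: ltnW; apply: ltn_expl.
have eX : e <= X by rewrite /scale -expnM; apply: ltnW; apply: leq_ltn_trans (ltn_expl _ (isT : 1 < 2)); rewrite leq_pmull // ell_gt0.
rewrite /repeats; case: ifP => _; first by move: (X * X) X Y => x y d; clear; lia.
move=> h1 h2 h3; apply: leq_ltn_trans (leq_mul (leq_trans cce eX) LnY) _.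
rewrite ltn_pmul2l; last exact: leq_trans h2.
have Y0 : 0 < Y by rewrite expn_gt0.
by move: h1 Y0; move: X Y => x y; clear; lia.
Qed.

Lemma gpmC_spec s : rg s rn = n -> rg s rm = m ->
  (forall i, i < n -> mm s i = tx i) -> (forall j, j < m -> mm s (n + j) = px j) ->
  (forall id i, id < 32 -> i < Lm -> ar s id i = 0) -> ou s = [::] ->
  let s' := den (gpmC e cc) s in
  ou s' = [seq p <- iota 0 (n - m + 1) | ~~ (light_miss (tp s) p || heavy_miss p)]
  /\ ck s' <= ck s + total_cost.
Proof.
move=> en em eT eP z0 eO.
have nLm : n < Lm.
  have := n_le_Y n; have := Y3_X m0 mn e40; have := XXX; have := X1000.
  by move: (X * X) X Y => a b c; clear; lia.
pose raw a := mm s a.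
have [a1 a2 a3] := copyC_spec O w5 LmW nLm mn en em (fun a _ => erefl (raw a)).
move: a1 a2 a3; move E1 : (den copyC s) => s1 a1 a2 a3.
have en1 : rg s1 rn = n by rewrite -E1 den_rg.
have em1 : rg s1 rm = m by rewrite -E1 den_rg.
have [b1 b2 b3 b4] := constC_spec O m0 mn e40 XW en1 em1.
move: b1 b2 b3 b4; move E2 : (den (constC e) s1) => s2 b1 b2 b3 b4.
have fr2 x : x \in [:: rn; rm] -> rg s2 x = rg s1 x.
  by move=> xc; rewrite -E2 den_rg //; move: x xc; apply/allP.
have wp : ewf (powE e) by move: (e) => k; elim: k => //= k ->.
have wc2 : cwf (constC e) by rewrite /= wp.
have fa2 id i : id < 32 -> ar s2 id i = ar s1 id i.
  by move=> idl; rewrite -E2 (den_ar n O w5).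
have fa1 id i : id < 32 -> i < Lm -> id \notin [:: aT; aP] -> ar s1 id i = 0.
  by move=> idl iL ne; rewrite -E1 (den_ar n O w5) // z0.
have T2 i : i < n -> ar s2 aT i = tx i by move=> iN; rewrite fa2 // a1 // /raw eT.
have P2 j : j < m -> ar s2 aP j = px j by move=> jm; rewrite fa2 // a2 // /raw eP.
have en2 : rg s2 rn = n by rewrite fr2.
have [[c1 c2] c3 c4 c5 c6] := paramC_spec m0 mn e40 cce XW txL degX dgW en2 b2 (c_X b1) b3 T2
   (fun a aL => etrans (fa2 aSEEN a isT) (fa1 aSEEN a isT aL isT))
   (fun a aL => etrans (fa2 aFO a isT) (fa1 aFO a isT aL isT)).
move: c1 c2 c3 c4 c5 c6; move E3 : (den (paramC cc) s2) => s3 c1 c2 c3 c4 c5 c6.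
have cs3 : consts X l m nb s3 by rewrite -E3; apply: consts_den.
have fr3 x : x \in [:: rn; rm; rBt] -> rg s3 x = rg s2 x.
  by move=> xc; rewrite -E3 den_rg //; move: x xc; apply/allP.
have fa3 id i : id < 32 -> id \notin [:: aSEEN; aFO] -> ar s3 id i = ar s2 id i.
  by move=> idl ne; rewrite -E3 (den_ar n O w5).
have [d1 d2] := tableC_spec O R m0 mn e40 XW cs3 (etrans (fr3 rBt isT) b3).
move: d1 d2; move E4 : (den tableC s3) => s4 d1 d2.
have cs4 : consts X l m nb s4 by rewrite -E4; apply: consts_den.
have fr4 x : x \in [:: rn; rm; rD; rK; rK1; rreps] -> rg s4 x = rg s3 x.
  by move=> xc; rewrite -E4 den_rg //; move: x xc; apply/allP.
have fa4 id i : id < 32 -> id \notin [:: aUR; aUI; aYR; aYI] -> ar s4 id i = ar s3 id i.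
  move=> idl ne; rewrite -E4 (den_ar n O w5) //; apply/negP => h; case/negP: ne.
  by move: id h {idl}; apply/allP.
have K0 : 0 < K by rewrite /colours addn1.
have me4 : menv w n X l m nb tx px (first tx) D K reps s4.
  split=> //.
  - by rewrite fr4 // fr3 // fr2.
  - by rewrite fr4 // fr3 // fr2.
  - by rewrite fr4.
  - by rewrite fr4.
  - by rewrite fr4.
  - by rewrite fr4.
  - by move=> i iN; rewrite fa4 // fa3 // T2.
  - by move=> i iN; rewrite fa4 // fa3 // P2.
  - by move=> i iN; rewrite fa4 // c5.
have zero4 id i : id < 32 -> i < Lm -> id \in [:: aA; aB; aHC; aF; aBAD] -> ar s4 id i = 0.
  move=> idl iL idm; have ne : id \notin [:: aT; aP; aUR; aUI; aYR; aYI; aSEEN; aFO] by move: id idm {idl}; apply/allP.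
  have sub ids : all (mem [:: aT; aP; aUR; aUI; aYR; aYI; aSEEN; aFO]) ids -> id \notin ids.
    by move/allP => h; apply: contra ne => /h.
  by rewrite fa4 ?sub // fa3 ?sub // fa2 // fa1 ?sub.
have ts4 : tails w n Lm m s4 by split=> i _ iL; rewrite zero4.
have tp4 : tp s4 = tp s.
  rewrite -E4 den_tp // -E3 den_tp // -E2 den_tp; last by [].
  by rewrite -E1 den_tp.
have ou4 : ou s4 = [::].
  rewrite -E4 den_ou // -E3 den_ou // -E2 den_ou; last by [].
  by rewrite -E1 den_ou.
have [f1 f2 f3] := lightC_spec w5 LmW R l0 XN XW NLm m0 mhN mn K0 colours_fit repeats_fit pxL dgW nbrL
   me4 ts4 (fun b bL => zero4 aHC b isT bL isT) (fun b bL => zero4 aF b isT bL isT)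
   (fun b bL => zero4 aBAD b isT bL isT : _ = (false : nat)).
move: f1 f2 f3; move E5 : (den lightC s4) => s5 f1 f2 f3.
have me5 : menv w n X l m nb tx px (first tx) D K reps s5 by rewrite -E5; apply: menv_den.
have [g1 g2] := heavyC_spec w5 LmW R l0 XN XW NLm m0 mhN mn colours_fit dgW mtW me5 f2 f1.
move: g1 g2; move E6 : (den heavyC s5) => s6 g1 g2.
have me6 : menv w n X l m nb tx px (first tx) D K reps s6 by rewrite -E6; apply: menv_den.
have ou6 : ou s6 = [::] by rewrite -E6 den_ou // -E5 den_ou.
have [h1 h2] := outC_spec O w5 LmW m0 mn me6.
move: h1 h2; move E7 : (den outC s6) => s7 h1 h2.
have -> : den (gpmC e cc) s = s7.
  by rewrite /gpmC den_sq E1 den_sq E2 den_sq E3 den_sq E4 den_sq E5 den_sq E6 E7.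
split; last first.
  move: a3 b4 c6 d2 f3 g2 h2; rewrite /total_cost /heavy_count.
  move: (ck s) (ck s1) (ck s2) (ck s3) (ck s4) (ck s5) (ck s6) (ck s7) => k0 k1 k2 k3 k4 k5 k6 k7.
  move: (e * Ln * 40) (l * (e * Ln * 40 + 60)) N (reps * rep_cost n l m nb D K) => q4 q3 q5 q1.
  move: (_ * (round_cost n l nb + 10)) => q2; clear; lia.
rewrite h1 ou6 cat0s; apply: eq_in_filter => p; rewrite mem_iota add0n => pn.
have pn' : p < n by move: pn mn m0; clear; lia.
have pL : p < Lm by apply: ltn_trans nLm.
have pb : p < nb * hN by apply: ltn_trans pn' (blocks_gt n m).
by rewrite g1 // pb tp4 /light_miss /heavy_miss eqb0 /=.
Qed.
End Program.

(** * Probability *)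

Section Resample.
Variables (V : finType) (t : nat).
Implicit Types x : t.-tuple V.

Definition resample (c : 'I_t) x (v : V) : t.-tuple V :=
  [tuple if i == c then v else tnth x i | i < t].

Lemma resampleK c x v : resample c (resample c x v) (tnth x c) = x.
Proof.
apply: eq_from_tnth => i; rewrite !tnth_mktuple.
by case: eqP => [->|//]; rewrite ?eqxx.
Qed.

(* [(x, v) |-> (resample c x v, x_c)] is an involution, so that resampling the
   letter [c] of a uniform word leaves it uniform. *)
Lemma resample_half c (A B : pred (t.-tuple V)) :
  (forall x v, A (resample c x v) = A x) ->
  (forall x, 2 * #|[pred v | B (resample c x v)]| <= #|V|) ->
  2 * #|[pred x | A x && B x]| <= #|A|.
Proof.
move=> hA hB; case: (posnP #|V|) => [V0|V0].
  have E : #|{: t.-tuple V}| = 0 by rewrite card_tuple V0 exp0n // (leq_ltn_trans _ (ltn_ord c)).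
  by rewrite (eq_card0 (_ : _ =i pred0)) ?muln0 // => x; have := max_card (pred1 x); rewrite E card1.
rewrite -(leq_pmul2r V0) -mulnA.
pose f (u : t.-tuple V * V) := (resample c u.1 u.2, tnth u.1 c).
have fK : cancel f f.
  by case=> x v; rewrite /f /= resampleK tnth_mktuple eqxx.
have -> : #|[pred x | A x && B x]| * #|V| = \sum_x \sum_v ((A x && B (resample c x v)) : nat).
  rewrite -sum1_card big_mkcond /= big_distrl /=.
  rewrite (eq_bigr (fun x => \sum_(v : V) (A x && B x : nat))); last first.
    by move=> x _; rewrite sum_nat_const [RHS]mulnC -[x \in _]/(A x && B x); case: (A x && B x).
  rewrite !pair_big /= (reindex_inj (can_inj fK)) /=.
  by apply: eq_bigr => u _; rewrite hA.
rewrite big_distrr /= -[#|A|]sum1_card big_distrl /= [leqRHS]big_mkcond /=.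
apply: leq_sum => x _; rewrite -[x \in _]/(A x); case: (A x) => /=; last by rewrite big1 // muln0.
rewrite mul1n; apply: leq_trans (hB x); rewrite -sum1_card [in leqRHS]big_mkcond /=.
by rewrite leq_mul2l /=; apply: leq_sum => v _; rewrite inE; case: (B _).
Qed.
End Resample.

Lemma card_modn W K c : 0 < K -> #|[pred v : 'I_W | v %% K == c]| <= W %/ K + 1.
Proof.
move=> K0; pose f (v : 'I_W) : 'I_(W %/ K).+1 := inord (v %/ K).
have fE v : f v = v %/ K :> nat by rewrite inordK // ltnS leq_div2r // ltnW.
have fI : {in [pred v : 'I_W | v %% K == c] &, injective f}.
  move=> u v; rewrite !inE => /eqP uc /eqP vc /(congr1 val) /=; rewrite !fE => E.
  by apply: val_inj; rewrite /= (divn_eq u K) (divn_eq v K) uc vc E.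
by rewrite -(card_in_imset fI) addn1 -[leqRHS]card_ord max_card.
Qed.

Section Colour.
Variables (px : nat -> nat) (K m : nat).

Lemma colour_eq r r' b : (forall j, j < m -> px j = b -> r j = r' j) ->
  colour px K r m b = colour px K r' m b.
Proof.
elim: m => //= k IH H; case: eqP => [E|_]; first by rewrite H.
by apply: IH => j jk; apply: H; apply: ltnW.
Qed.

Lemma colour_last b : (exists2 j, j < m & px j = b) ->
  exists2 J, J < m /\ px J = b & forall r, colour px K r m b = (r J %% K).+1.
Proof.
elim: m => [[]//|k IH] [j jk E] /=; case: eqP => [Ek|Ek]; first by exists k.
have [|J [h1 h2] h3] := IH; last by exists J => //; split=> //; apply: ltnW.
by exists j => //; move: jk; rewrite ltnS leq_eqVlt => /predU1P[jk|//]; rewrite jk in E.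
Qed.
End Colour.

Section Collisions.
Variables (w m t K D : nat) (px : nat -> nat) (b : nat) (ns : seq nat).
Local Notation W := (2 ^ w).
Hypothesis K4 : K = 4 * D + 1.
Hypothesis DW : 4 * D <= W.
Hypothesis nsD : size ns <= D.
Hypothesis bns : b \notin ns.
Hypothesis bP : exists2 j, j < m & px j = b.
Local Notation tape := (t.-tuple 'I_W).
Local Notation words x := [seq val v | v <- tval x].

Definition collides (rep : nat) (x : tape) : bool :=
  has (fun b' => hash w m px K (words x) rep b' == hash w m px K (words x) rep b) ns.

Lemma nth_words (x : tape) (i : 'I_t) : nth 0 (words x) i = tnth x i.
Proof.
have v0 : 'I_W by apply: Ordinal (_ : 0 < W); rewrite expn_gt0.
by rewrite (nth_map v0) ?size_tuple // (tnth_nth v0).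
Qed.

Lemma nth_resample (c : 'I_t) (x : tape) (v : 'I_W) i :
  nth 0 (words (resample c x v)) i = if i == c then val v else nth 0 (words x) i.
Proof.
case: (ltnP i t) => it; last first.
  have ne : (i == c) = false by apply/negbTE/eqP => E; move: (ltn_ord c); rewrite -E ltnNge it.
  by rewrite ne !nth_default // size_map size_tuple.
have e1 : nth 0 (words (resample c x v)) i = tnth (resample c x v) (Ordinal it) := nth_words _ (Ordinal it).
have e2 : nth 0 (words x) i = tnth x (Ordinal it) := nth_words x (Ordinal it).
by rewrite e1 e2 tnth_mktuple -val_eqE /=; case: ifP.
Qed.

Lemma collides_half rep : rep.+1 * m <= t ->
  2 * #|[pred x : tape | [forall k : 'I_rep, collides k x] && collides rep x]|
  <= #|[pred x : tape | [forall k : 'I_rep, collides k x]]|.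
Proof.
move=> mt; have [J [Jm EJ] cJ] := colour_last K bP.
have ct : rep * m + J < t by apply: leq_trans mt; rewrite mulSn addnC ltn_add2r.
pose c := Ordinal ct.
have K0 : 0 < K by rewrite K4 addn1.
apply: (resample_half (c := c)) => [x v|x].
  apply: eq_forallb => k; apply: eq_has => b'.
  have E b0 : hash w m px K (words (resample c x v)) k b0 = hash w m px K (words x) k b0.
    apply: colour_eq => j jm _; rewrite nth_resample; case: eqP => //= E; exfalso.
    have : k.+1 * m <= rep * m by rewrite leq_mul2r ltn_ord orbT.
    by move: E jm; rewrite mulSn; clear; lia.
  by rewrite !E.
rewrite card_ord.
pose col b' := hash w m px K (words x) rep b'.
have sub : {subset [pred v : 'I_W | collides rep (resample c x v)] <=
    [pred v : 'I_W | has (fun b' => v %% K == (col b').-1) ns]}.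
  move=> v; rewrite !inE => /hasP[b' b'n /eqP E]; apply/hasP; exists b' => //.
  have E1 : hash w m px K (words (resample c x v)) rep b' = col b'.
    apply: colour_eq => j jm Ej; rewrite nth_resample; case: eqP => //= Ec; exfalso.
    have Ej' : j = J by move: Ec; clear; lia.
    by move: bns; rewrite -EJ -Ej' Ej b'n.
  by rewrite -E1 E /hash cJ nth_resample eqxx /= [v %% W]modn_small.
apply: leq_trans (_ : 2 * (D * (W %/ K + 1)) <= _); last first.
  have := leq_trunc_div W K; rewrite {2}K4; move: (W %/ K) W DW => q W' h1 h2.
  by move: h1 h2; rewrite mulnDr; clear; nia.
rewrite leq_mul2l /=.
apply: leq_trans (_ : size ns * (W %/ K + 1) <= _); last by rewrite leq_mul2r nsD orbT.
apply: leq_trans (subset_leq_card (introT subsetP sub)) _.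
elim: (ns) => [|b' s IH]; first by rewrite eq_card0 // => v; rewrite !inE.
rewrite mulSn; apply: leq_trans (_ : #|[predU [pred v : 'I_W | v %% K == (col b').-1] &
    [pred v : 'I_W | has (fun b' => v %% K == (col b').-1) s]]| <= _).
  by apply: subset_leq_card; apply/subsetP => v; rewrite !inE.
apply: leq_trans _ (leq_add (@card_modn W K (col b').-1 K0) IH).
set A := [pred v : 'I_W | v %% K == _]; set B := [pred v : 'I_W | has _ s].
by rewrite -(cardUI A B) leq_addr.
Qed.

Lemma collides_all reps : reps * m <= t ->
  2 ^ reps * #|[pred x : tape | [forall k : 'I_reps, collides k x]]| <= W ^ t.
Proof.
elim: reps => [|r IH] mt.
  by rewrite mul1n -[X in _ <= X ^ _]card_ord -card_tuple max_card.
apply: leq_trans (IH (leq_trans _ mt)); last by rewrite leq_mul2r leqnSn orbT.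
rewrite expnSr -mulnA leq_mul2l; apply/orP; right.
apply: leq_trans (collides_half mt); rewrite leq_mul2l /=.
apply: subset_leq_card; apply/subsetP => x; rewrite !inE => /forallP h.
apply/andP; split; last exact: (h ord_max).
by apply/forallP => k; exact: (h (widen_ord (leqnSn r) k)).
Qed.
End Collisions.

Definition symbols (s k : nat) (u : k.-tuple 'I_s) (i : nat) : nat := nth 0 [seq val c | c <- u] i.

Lemma symbolsE s k (u : k.-tuple 'I_s) (i : 'I_k) : symbols u i = val (tnth u i).
Proof. by rewrite /symbols (nth_map (tnth u i)) ?size_tuple // -tnth_nth. Qed.

Lemma symbols_lt s k (u : k.-tuple 'I_s) i : i < k -> symbols u i < s.
Proof. by move=> ik; have -> := symbolsE u (Ordinal ik); apply: ltn_ord. Qed.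

Section Instance.
Variables (sT sP n m w cc t : nat) (T : n.-tuple 'I_sT) (P : m.-tuple 'I_sP).
Variables (MG : {set 'I_sT * 'I_sP}) (nb : 'I_sT -> seq 'I_sP).
Hypothesis nbP : neighbour_order MG nb.
Hypothesis m0 : 0 < m.
Hypothesis mn : m <= n.
Local Notation W := (2 ^ w).
Local Notation O := (gpm_oracle MG nb).
Local Notation tx := (symbols T).
Local Notation px := (symbols P).
Local Notation D := (threshold O tx n).
Local Notation K := (colours O tx n).
Local Notation reps := (repeats cc O tx n).
Local Notation words x := [seq val v | v <- tval x].
Local Notation lmiss := (light_miss w n m cc O tx px).
Local Notation hmiss := (heavy_miss n m O tx px).

Lemma oracle_deg a : degT_q O (val a) = #|nbrs MG a|.
Proof. by rewrite /= valK. Qed.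

Lemma oracle_nbr a q : nbr_q O (val a) q = nth 0 [seq val b | b <- nb a] q.
Proof. by rewrite /= valK. Qed.

Lemma oracle_match a b : match_q O (val a) (val b) = ((a, b) \in MG).
Proof. by rewrite /= !valK. Qed.

Lemma size_nb a : size (nb a) = #|nbrs MG a|.
Proof. by rewrite (perm_size (nbP a)) -cardE. Qed.

Lemma mem_nb a b : (b \in nb a) = ((a, b) \in MG).
Proof. by rewrite (perm_mem (nbP a)) mem_enum inE. Qed.

Lemma matchPn p : p + m <= n ->
  reflect (exists i : 'I_n, exists2 j : 'I_m, i = p + j :> nat & (tnth T i, tnth P j) \notin MG)
          (~~ gpm_match_at T P MG p).
Proof.
move=> pm; apply: (iffP idP).
  move=> /forallPn[i /forallPn[j]].
  by rewrite negb_imply => /andP[/eqP E h]; exists i, j.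
case=> i [j E h]; apply/forallPn; exists i.
by apply/forallPn; exists j; rewrite E eqxx.
Qed.

Lemma miss_sound tape p : p + m <= n -> lmiss tape p || hmiss p -> ~~ gpm_match_at T P MG p.
Proof.
move=> pm H; apply/(matchPn pm); case/orP: H.
  case/existsP=> rep /existsP[r /existsP[j]].
  set h := hash _ _ _ _ _ _.
  case/andP=> /andP[pn /andP[_ ns]] /andP[_ /eqP]; rewrite subKn; last by have := ltn_ord j; lia.
  move=> E; exists (Ordinal pn), j => //; apply: contra ns => h1.
  have b1 : tnth P j \in nb (tnth T (Ordinal pn)) by rewrite mem_nb.
  rewrite /seen_colour -[p + j]/(val (Ordinal pn)) symbolsE oracle_deg -size_nb.
  have qs : index (tnth P j) (nb (tnth T (Ordinal pn))) < size (nb (tnth T (Ordinal pn))) by rewrite index_mem.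
  apply/existsP; exists (Ordinal qs).
  by rewrite oracle_nbr (nth_map (tnth P j)) //= nth_index // -symbolsE E.
case/existsP=> i /andP[_ /existsP[j]] /andP[/andP[pn /eqP Ea] /andP[_]].
rewrite subKn; last by have := ltn_ord j; lia.
rewrite -[p + j]/(val (Ordinal pn)) in Ea.
by rewrite -Ea !symbolsE oracle_match eqb0 => h; exists (Ordinal pn), j.
Qed.

Definition unnoticed (p : nat) (x : t.-tuple 'I_W) : bool :=
  ~~ gpm_match_at T P MG p && ~~ (lmiss (words x) p || hmiss p).

Lemma first_occurrence i : i < n -> exists2 i0 : 'I_n, first tx i0 & tx i0 = tx i.
Proof.
move=> iN; pose Q k := (k < n) && (tx k == tx i).
have ex : exists k, Q k by exists i; rewrite /Q iN eqxx.
case: (ex_minnP ex) => k /andP[kn /eqP kE] kmin; exists (Ordinal kn) => //=.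
rewrite /first; apply/existsP => -[[j jk] /= /eqP E].
have : k <= j by apply: kmin; rewrite /Q E kE eqxx andbT (ltn_trans jk).
by rewrite leqNgt jk.
Qed.

Lemma unnoticed_card p : p + m <= n -> reps * m <= t -> 4 * D <= W ->
  n ^ cc * #|[pred x | unnoticed p x]| <= W ^ t.
Proof.
move=> pm tm DW.
have zero : (forall x, ~~ unnoticed p x) -> n ^ cc * #|[pred x | unnoticed p x]| <= W ^ t.
  by move=> h; rewrite eq_card0 ?muln0 // => x; rewrite inE; apply: negbTE.
case mt : (gpm_match_at T P MG p); first by apply: zero => x; rewrite /unnoticed mt.
case hm : (hmiss p); first by apply: zero => x; rewrite /unnoticed hm orbT andbF.
have /(matchPn pm)[i [j Ei nM]] := negbT mt.
pose ns := [seq val b | b <- nb (tnth T i)].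
have szns : size ns = degT_q O (tx i) by rewrite symbolsE oracle_deg size_map size_nb.
have En q : nbr_q O (tx i) q = nth 0 ns q by rewrite symbolsE oracle_nbr.
have lt : degT_q O (tx i) <= D.
  rewrite leqNgt; apply/negP => heavy.
  have [i0 f0 E0] := first_occurrence (ltn_ord i).
  move/negbT/existsP: hm; apply; exists i0; rewrite /heavy_first E0 f0 heavy andTb.
  apply/existsP; exists j; rewrite -Ei ltn_ord eqxx !andTb.
  have jm := ltn_ord j; rewrite subKn; last by lia.
  by rewrite !symbolsE oracle_match (negbTE nM) eqxx andbT; lia.
have bns : px j \notin ns.
  by rewrite symbolsE mem_map ?mem_nb //; apply: val_inj.
have sub : {subset [pred x | unnoticed p x] <=
    [pred x : t.-tuple 'I_W | [forall k : 'I_reps, collides m K px (px j) ns k x]]}.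
  move=> x; rewrite !inE /unnoticed mt hm orbF /= => nl; apply/forallP => k.
  set h := hash w m px K (words x) k.
  have [J _ cJ] := colour_last K (ex_intro2 _ _ (val j) (ltn_ord j) (erefl (px j))).
  have hb : h (px j) = (nth 0 (words x) (k * m + J) %% W %% K).+1 by rewrite /h /hash cJ.
  have rK : nth 0 (words x) (k * m + J) %% W %% K < K by rewrite ltn_pmod // /colours addn1.
  apply: contraR nl => nc; apply/existsP; exists k; apply/existsP; exists (Ordinal rK).
  apply/existsP; exists j; have jm := ltn_ord j.
  rewrite -/h /textbits /patbits -Ei ltn_ord /light lt /= -hb subKn; last by lia.
  rewrite eqxx andbT; apply/andP; split; last by lia.
  apply: contra nc => /existsP[q /eqP E]; apply/hasP.
  have qs : q < size ns by rewrite szns.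
  exists (nth 0 ns q); first exact: mem_nth.
  by rewrite -/h -En; apply/eqP.
case: (posnP D) => D0.
  apply: zero => x; apply/negP => ux; have := sub x; rewrite !inE => /(_ ux) /forallP.
  have r0 : 0 < reps by rewrite /repeats D0.
  move/(_ (Ordinal r0)); have -> : ns = [::] by apply: size0nil; move: lt; rewrite -szns D0; case: size.
  by [].
apply: leq_trans (collides_all (erefl : K = 4 * D + 1) DW (_ : size ns <= D) bns _ tm).
- apply: leq_mul; last exact: subset_leq_card (introT subsetP sub).
  rewrite /repeats eqn0Ngt D0 /= mulnC expnM; case: (posnP cc) => [-> //|c0]; rewrite leq_exp2r //.
  by apply: leq_trans (two_le_pow n); apply: leq_addl.
- by rewrite szns.
- by exists j.
Qed.

End Instance.

(** * Running time *)

Lemma pow_ell_lt k : 0 < k -> 2 ^ ell k < 4 * k.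
Proof.
move=> k0; have h : 1 < k + k by lia.
have /andP[+ _] := up_log_bounds (isT : 1 < 2) h; rewrite -/(ell k) => h1.
by rewrite -(prednK (ell_gt0 k0)) expnS; lia.
Qed.

Lemma sqr_le_pow k : k * k <= 2 ^ k.+1.
Proof.
elim: k => // k IH; case: (ltnP k 3) => [|k3]; first by case: k IH => [|[|[|]]].
by rewrite expnS; apply: leq_trans (_ : 2 * (k * k) <= _); [nia | lia].
Qed.

Lemma ell_sqr_le n : 0 < n -> ell n * ell n <= 8 * n.
Proof.
move=> n0; apply: leq_trans (sqr_le_pow _) _; have := pow_ell_lt n0.
by rewrite expnS; lia.
Qed.

Section Cost.
Variables (n m e cc : nat) (O : oracle) (tx : nat -> nat).
Hypothesis m0 : 0 < m.
Hypothesis mn : m <= n.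
Local Notation l := (ell m).
Local Notation Ln := (ell n).
Local Notation N := (2 ^ l).
Local Notation hN := (2 ^ l.-1).
Local Notation nb := (blocks n m).
Local Notation D := (threshold O tx n).
Local Notation K := (colours O tx n).
Local Notation reps := (repeats cc O tx n).
Local Notation H := (heavy_count n O tx).
Let n0 : 0 < n := leq_trans m0 mn.
Let l0 : 0 < l := ell_gt0 m0.

Definition round_const : nat := 33 * 1000.

Lemma round_const_ge : 100 <= round_const.
Proof. by rewrite /round_const; lia. Qed.

Lemma round_cost_le : round_cost n l nb + 10 <= round_const * (n * l).
Proof.
have Nh := N_half l0; have N4 := pow_ell_lt m0.
have hb : nb.+1 * N <= 10 * n.
  rewrite /blocks Nh; have := leq_trunc_div n hN; move: (n %/ hN) hN Nh => q h Nh hq; nia.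
rewrite /round_cost /conv_cost.
have -> : nb.+1 * (l.+1 * (N * 1600)) = (nb.+1 * N) * (l.+1 * 1600) by ring.
have : nb.+1 * N * (l.+1 * 1600) <= 10 * n * (l.+1 * 1600) by rewrite leq_mul2r hb orbT.
have -> : 10 * n * (l.+1 * 1600) = 16 * 1000 * (n * l) + 16 * 1000 * n by ring.
have : n <= n * l by rewrite leq_pmulr.
by rewrite /round_const; move: (n * l) (nb.+1 * N * _) => z q; move: n0; clear; lia.
Qed.

Definition cost_const : nat := 2000 + 700 * e + 10 * round_const * (cc + 1).

Lemma total_cost_le :
  total_cost n m e cc O tx <= cost_const * (n * l * (1 + D * Ln + H)).
Proof.
have rc := round_cost_le; have N4 := pow_ell_lt m0; have Ls := ell_sqr_le n0.
rewrite /cost_const; move: round_const round_const_ge rc => A A100 rc.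
have lL : l <= Ln := ell_le mn.
have nl : n <= n * l by rewrite leq_pmulr.
have Ln0 : 0 < Ln by apply: ell_gt0.
set z := n * l in rc nl *.
have b1 : l * (e * Ln * 40 + 60) <= (8 * e * 40 + 60 * 8) * n.
  apply: leq_trans (_ : Ln * (e * Ln * 40 + 60) <= _); first by rewrite leq_mul2r lL orbT.
  have : Ln <= Ln * Ln by rewrite leq_pmulr.
  have -> : Ln * (e * Ln * 40 + 60) = 40 * e * (Ln * Ln) + 60 * Ln by ring.
  have : 40 * e * (Ln * Ln) <= 40 * e * (8 * n) by rewrite leq_mul2l Ls orbT.
  move: (40 * e * (Ln * Ln)) (Ln * Ln) Ls => u v; clear; nia.
have b2 : e * Ln * 40 <= 8 * e * 40 * n.
  have : Ln <= 8 * n by apply: leq_trans Ls; rewrite leq_pmulr.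
  by move=> h; apply: leq_trans (_ : e * (8 * n) * 40 <= _); [rewrite leq_mul2r leq_mul2l h !orbT | apply/eq_leq; ring].
have b3 : rep_cost n l m nb D K <= 5 * A * (z * (D + 1)).
  rewrite /rep_cost /colours.
  apply: leq_trans (_ : 10 + m * 40 + n * (D * 40 + 40) + (4 * D + 1) * (A * z) <= _).
    rewrite leq_add2l leq_mul2l; apply/orP; right; apply: leq_trans rc; lia.
  have nD : n * D <= z * D by rewrite leq_mul2r nl orbT.
  have -> : (4 * D + 1) * (A * z) = 4 * (A * (z * D)) + A * z by ring.
  have -> : 5 * A * (z * (D + 1)) = 5 * (A * (z * D)) + 5 * (A * z) by ring.
  have -> : n * (D * 40 + 40) = 40 * (n * D) + 40 * n by ring.
  have : 100 * (z * D) <= A * (z * D) by rewrite leq_mul2r A100 orbT.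
  have : 100 * z <= A * z by rewrite leq_mul2r A100 orbT.
  by move: (A * (z * D)) (z * D) (n * D) (A * z) nD => u1 u2 u3 u4; move: mn n0 nl; clear; lia.
have b4 : reps * rep_cost n l m nb D K <= 10 * (A * ((cc + 1) * (z * (1 + D * Ln)))).
  apply: leq_trans (_ : reps * (5 * A * (z * (D + 1))) <= _); first by rewrite leq_mul2l b3 orbT.
  rewrite /repeats; case: (posnP D) => [->|D0].
    have -> : 10 * (A * ((cc + 1) * (z * (1 + 0 * Ln)))) = 10 * (A * z) + 10 * (A * (cc * z)) by ring.
    by rewrite mul1n add0n muln1 -mulnA; move: (A * z) (A * (cc * z)) => u v; clear; lia.
  rewrite /=.
  have -> : cc * Ln * (5 * A * (z * (D + 1))) = 5 * (A * (cc * (z * (Ln * D + Ln)))) by ring.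
  have -> : 10 * (A * ((cc + 1) * (z * (1 + D * Ln)))) = 5 * (A * ((cc + 1) * (z * (2 * (1 + D * Ln))))) by ring.
  rewrite leq_mul2l /= leq_mul2l; apply/orP; right; apply: leq_mul; first by rewrite leq_addr.
  rewrite leq_mul2l; apply/orP; right; have : Ln <= D * Ln by rewrite leq_pmull.
  by rewrite [Ln * D]mulnC; move: (D * Ln); clear; lia.
have b5 : H * (round_cost n l nb + 10) <= A * (z * H).
  apply: leq_trans (_ : H * (A * z) <= _); first by rewrite leq_mul2l rc orbT.
  by apply/eq_leq; ring.
rewrite /total_cost.
move: b1 b2 b4 b5; move: (e * Ln * 40) (l * (e * Ln * 40 + 60)) (reps * rep_cost n l m nb D K) => t2 t1 t3.
move: (H * (round_cost n l nb + 10)) => t4 b1 b2 b4 b5.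
have -> : z * (1 + D * Ln + H) = z * (1 + D * Ln) + z * H by ring.
have zz : z <= z * (1 + D * Ln) by rewrite leq_pmulr.
move: b4 b5 zz; move: (z * H) (z * (1 + D * Ln)) => h1 h2 b4 b5 zz.
have e1 : e * n <= e * h2 by rewrite leq_mul2l (leq_trans nl zz) orbT.
have e0 : e <= e * n by rewrite leq_pmulr.
have -> : (2000 + 700 * e + 10 * A * (cc + 1)) * (h2 + h1) =
   2000 * h2 + 700 * (e * h2) + 10 * (A * ((cc + 1) * h2)) + 2000 * h1 + 700 * (e * h1) + 10 * (A * (cc * h1)) + 10 * (A * h1).
  by ring.
move: b4 b5; move: (A * ((cc + 1) * h2)) (A * (cc * h1)) (A * h1) => u1 u2 u3 b4 b5.
move: b1 b2 b4 b5 e1 e0 mn N4 nl zz n0.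
have -> : (8 * e * 40 + 60 * 8) * n = 320 * (e * n) + 480 * n by ring.
have -> : 8 * e * 40 * n = 320 * (e * n) by ring.
by move: (2 ^ l) (e * n) (e * h2) (e * h1) => N' u4 u5 u6; clear; lia.
Qed.
End Cost.

Section Threshold.
Variables (O : oracle) (tx : nat -> nat) (n : nat).
Hypothesis n0 : 0 < n.
Local Notation S := (degsum O tx n).
Local Notation D := (threshold O tx n).
Local Notation H := (heavy_count n O tx).
Let L0 : 0 < ell n := ell_gt0 n0.

Lemma threshold_sqr : (D * ell n) * (D * ell n) <= S * ell n.
Proof.
have /andP[+ _] := sqrt_bounds (S %/ ell n); rewrite -/D leq_divRL // => h.
by have := leq_mul h (leqnn (ell n)); apply: leq_trans; apply/eq_leq; ring.
Qed.

Lemma heavy_count_threshold : H * D.+1 <= S.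
Proof.
rewrite /heavy_count big_distrl /=; apply: leq_sum => i _; rewrite /heavy_first.
by case: (first tx i); case: ltnP => //= h; rewrite mul1n mul1n.
Qed.

Lemma heavy_count_sqr : H * H <= S * ell n.
Proof.
have /andP[_ +] := sqrt_bounds (S %/ ell n); rewrite -/D ltn_divLR // => h.
have := heavy_count_threshold; case: (posnP S) => [->|S0 hs].
  by rewrite leqn0 muln_eq0 orbF => /eqP ->.
rewrite -(@leq_pmul2r (D.+1 * D.+1)) //; apply: leq_trans (_ : S * S <= _).
  by have := leq_mul hs hs; apply: leq_trans; apply/eq_leq; ring.
by rewrite -mulnA leq_pmul2l // mulnC ltnW.
Qed.
End Threshold.

Lemma card_edges sT sP (MG : {set 'I_sT * 'I_sP}) : \sum_a #|nbrs MG a| = #|MG|.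
Proof.
rewrite -[RHS]sum1_card (eq_bigl (fun u => (u.1, u.2) \in MG)); last by case.
rewrite -(pair_big_dep predT (fun a b => (a, b) \in MG) (fun _ _ => 1)) /=.
apply: eq_bigr => a _; rewrite -sum1_card; apply: eq_bigl => b; by rewrite inE.
Qed.

Lemma degsum_le sT sP n (T : n.-tuple 'I_sT) (MG : {set 'I_sT * 'I_sP}) nb :
  degsum (gpm_oracle MG nb) (symbols T) n <= #|MG|.
Proof.
rewrite -card_edges /degsum.
pose A := [set i : 'I_n | first (symbols T) i].
have inj : {in A &, injective (tnth T)}.
  move=> i j; rewrite !inE => fi fj E; apply: val_inj; wlog ij : i j fi fj E / i <= j.
    by case: (leqP i j) => [h|/ltnW h]; [apply | move=> H; apply/esym; apply: H].
  apply/eqP; rewrite eqn_leq ij /= leqNgt; apply/negP => lt; case/negP: fj.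
  by apply/existsP; exists (Ordinal lt); rewrite /= !symbolsE E.
apply: leq_trans (_ : \sum_(a in [set tnth T i | i in A]) #|nbrs MG a| <= _); last first.
  by rewrite [leqRHS](bigID (fun a => a \in [set tnth T i | i in A])) /= leq_addr.
rewrite big_imset // [leqRHS]big_mkcond; apply: leq_sum => i _.
by rewrite inE symbolsE oracle_deg; case: (first _ _); rewrite ?mul1n.
Qed.

Local Open Scope ring_scope.

Section RealTime.
Variable R : realType.

Lemma log1_ge1 k : 1 <= log1 R k.
Proof. by rewrite /log1 le_max lexx. Qed.

Lemma ln2_ge : 1 <= 2 * ln (2 : R).
Proof.
have h : -1 < (- 2^-1 : R) by lra.
have := le_ln1Dx h; have -> : 1 + - 2^-1 = 2^-1 :> R by field.
by rewrite lnV ?posrE //; lra.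
Qed.

Lemma ell_log1 k : (0 < k)%N -> (ell k)%:R <= 4 * log1 R k.
Proof.
move=> k0; have kR : 0 < k%:R :> R by rewrite ltr0n.
have : ln ((2 ^ ell k)%N%:R : R) <= ln ((4 * k)%N%:R : R).
  by rewrite ler_ln ?posrE ?ltr0n ?muln_gt0 ?k0 ?expn_gt0 // ler_nat ltnW // pow_ell_lt.
have two : 0 < 2 :> R by [].
have e4 : ln (4%:R : R) = ln 2 + ln 2.
  by rewrite -lnM ?posrE // -natrM.
rewrite natrX lnXn // natrM lnM ?posrE // e4 -(mulr_natl (ln 2)); have := ln2_ge.
have : ln k%:R <= log1 R k by rewrite /log1 le_max lexx orbT.
have := log1_ge1 k; have : 0 <= (ell k)%:R :> R by [].
move: ((ell k)%:R) (ln 2) (ln k%:R) (log1 R k) => a b c d ha hd hc hb h.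
rewrite leNgt; apply/negP => h1.
have : (a - 2) * 1 <= (a - 2) * (2 * b) by rewrite ler_wpM2l //; lra.
have -> : (a - 2) * (2 * b) = 2 * (a * b) - 4 * b by ring.
by lra.
Qed.

Lemma sqr_le_time S n x : (0 < n)%N -> (x * x <= S * ell n)%N ->
  x%:R <= 2 * (Num.sqrt (maxn 1 S)%:R * Num.sqrt (log1 R n)).
Proof.
move=> n0 h; set s := Num.sqrt _ * _.
have s0 : 0 <= s by rewrite mulr_ge0 // sqrtr_ge0.
have s2 : s ^+ 2 = (maxn 1 S)%:R * log1 R n.
  by rewrite exprMn !sqr_sqrtr // (le_trans ler01) // log1_ge1.
rewrite -(@ler_pXn2r _ 2) ?nnegrE ?(mulr_ge0 _ s0) //.
rewrite exprMn s2 -natrX -mulnn; apply: le_trans (_ : (S * ell n)%N%:R <= _); first by rewrite ler_nat.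
apply: le_trans (_ : (maxn 1 S)%:R * (4 * log1 R n) <= _).
  by rewrite natrM; apply: ler_pM => //; [rewrite ler_nat leq_maxr | apply: ell_log1].
by rewrite le_eqVlt; apply/orP; left; apply/eqP; ring.
Qed.

Lemma time_bound S n m A x y cost : (0 < m <= n)%N ->
  (x * x <= S * ell n)%N -> (y * y <= S * ell n)%N ->
  (cost <= A * (n * ell m * (1 + x + y)))%N ->
  cost%:R <= (20 * A%:R) * gpm_time R S n m.
Proof.
case/andP=> m0 mn hx hy hc; have n0 := leq_trans m0 mn.
have := sqr_le_time n0 hx; have := sqr_le_time n0 hy; have := ell_log1 m0.
rewrite /gpm_time; set s1 := Num.sqrt _; set s2 := Num.sqrt _ => h1 h2 h3.
have s11 : 1 <= s1 by rewrite -[leLHS]sqrtr1 ler_wsqrtr // (ler_nat _ 1) leq_maxl.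
have s21 : 1 <= s2 by rewrite -[leLHS]sqrtr1 ler_wsqrtr // log1_ge1.
have s12 : 1 <= s1 * s2 by rewrite -[leLHS]mulr1 ler_pM.
apply: le_trans (_ : (A * (n * ell m * (1 + x + y)))%N%:R <= _); first by rewrite ler_nat.
rewrite !natrM !natrD.
have -> : 20 * A%:R * (s1 * n%:R * log1 R m * s2) =
   A%:R * (n%:R * (4 * log1 R m) * (5 * (s1 * s2))) by ring.
apply: ler_wpM2l => //; apply: ler_pM; rewrite ?mulr_ge0 ?addr_ge0 //.
  by apply: ler_wpM2l.
by lra.
Qed.
End RealTime.

(** * Running the compiled program *)

Local Open Scope nat_scope.

Lemma alphabet_lt n k e : 0 < n -> 2 * k + 2 <= e -> (n ^ k + k) * (n ^ k + k) < scale e n.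
Proof.
move=> n0 ke; have nY := n_le_Y n; set Y := 2 ^ ell n in nY.
have Y0 : 0 < Y by rewrite expn_gt0.
apply: leq_trans (_ : Y ^ (k + 1) * Y ^ (k + 1) <= _); last first.
  by rewrite -expnD /scale leq_pexp2l //; lia.
have h : n ^ k + k < Y ^ (k + 1).
  have a1 : n ^ k <= Y ^ k by case: (k) => // j; rewrite leq_exp2r //; lia.
  have a2 : k < Y ^ k by apply: leq_trans (ltn_expl k (isT : 1 < 2)) _; case: (k) => // j; rewrite leq_exp2r //; lia.
  by rewrite expnD expn1; apply: leq_trans (_ : Y ^ k * 2 <= _); [lia | rewrite leq_mul2l orbC; apply/orP; left; lia].
by apply: ltn_mul.
Qed.

Lemma scale_le n e : 0 < n -> 4 * (scale e n * (scale e n * scale e n)) <= (n + 2) ^ (6 * e + 2).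
Proof.
move=> n0; have n2 : 0 < (n + 2) ^ 2 by rewrite expn_gt0 addn2.
have h : scale e n <= ((n + 2) ^ 2) ^ e.
  rewrite /scale; case: (e) => // j; rewrite leq_exp2r //.
  by apply: leq_trans (ltnW (pow_ell_lt n0)) _; rewrite expnS expn1; nia.
have -> : (n + 2) ^ (6 * e + 2) = (n + 2) ^ 2 * (((n + 2) ^ 2) ^ e * (((n + 2) ^ 2) ^ e * ((n + 2) ^ 2) ^ e)).
  by rewrite -!expnM -!expnD; congr (_ ^ _); lia.
apply: leq_mul; last by do !apply: leq_mul.
by rewrite expnS expn1; nia.
Qed.

Section Execution.
Variables (sT sP n m w e cc k : nat) (T : n.-tuple 'I_sT) (P : m.-tuple 'I_sP).
Variables (MG : {set 'I_sT * 'I_sP}) (nb : 'I_sT -> seq 'I_sP).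
Hypothesis nbP : neighbour_order MG nb.
Hypothesis m0 : 0 < m.
Hypothesis mn : m <= n.
Hypothesis e40 : 40 <= e.
Hypothesis cce : cc <= e.
Hypothesis ke : 2 * k + 2 <= e.
Hypothesis sTk : sT <= n ^ k + k.
Hypothesis sPk : sP <= n ^ k + k.
Hypothesis XW : 4 * (scale e n * (scale e n * scale e n)) <= 2 ^ w.
Variable R : rcfType.
Local Notation W := (2 ^ w).
Local Notation X := (scale e n).
Local Notation O := (gpm_oracle MG nb).
Local Notation tx := (symbols T).
Local Notation px := (symbols P).
Local Notation D := (threshold O tx n).
Local Notation lmiss := (light_miss w n m cc O tx px).
Local Notation hmiss := (heavy_miss n m O tx px).
Let n0 : 0 < n := leq_trans m0 mn.
Let XX := alphabet_lt n0 ke.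
Let x1000 : 1000 <= X := X_big (ell_gt0 m0) (N40_X mn e40).

Lemma size_lt_X : n ^ k + k < X.
Proof. by apply: leq_ltn_trans XX; rewrite leq_pmulr // ltn_addr // expn_gt0 n0. Qed.

Lemma X_lt_XX : X < X * X. Proof. by rewrite -{1}(muln1 X) ltn_pmul2l; move: x1000; lia. Qed.

Lemma XX_lt_W : X * X < W.
Proof.
have x0 : 0 < X by apply: leq_trans x1000.
have h1 : X * X <= X * (X * X) by apply: leq_pmull.
have h2 : 0 < X * X by rewrite muln_gt0 x0.
by apply: leq_trans XW; move: h1 h2; move: (X * (X * X)) (X * X) => u v; clear; lia.
Qed.

Lemma symbol_fit s j (u : j.-tuple 'I_s) i : s <= n ^ k + k -> i < j -> symbols u i < X * X.
Proof.
move=> sk ij; apply: ltn_trans X_lt_XX; apply: leq_ltn_trans size_lt_X.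
exact: leq_trans (ltnW (symbols_lt u ij)) sk.
Qed.

Lemma degsum_lt : degsum O tx n < X.
Proof.
apply: leq_ltn_trans (degsum_le T MG nb) _; apply: leq_ltn_trans (max_card _) _.
by rewrite card_prod !card_ord; apply: leq_ltn_trans XX; apply: leq_mul.
Qed.

Lemma oracle_deg_lt a : degT_q O a < W.
Proof.
apply: ltn_trans XX_lt_W; apply: ltn_trans X_lt_XX; apply: leq_ltn_trans size_lt_X.
rewrite /=; case: insubP => // a' _ _; apply: leq_trans sPk.
by apply: leq_trans (max_card _) _; rewrite card_ord.
Qed.

Lemma oracle_nbr_lt a q : nbr_q O a q < X * X.
Proof.
have x0 : 0 < X * X by apply: leq_ltn_trans X_lt_XX.
rewrite /=; case: insubP => // a' _ _; case: (ltnP q (size [seq val b | b <- nb a'])) => h.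
  have /mapP[b _ ->] := mem_nth 0 h.
  by apply: ltn_trans X_lt_XX; apply: leq_ltn_trans size_lt_X; apply: leq_trans sPk; apply: ltnW (ltn_ord b).
by rewrite nth_default.
Qed.

Lemma oracle_match_lt a b : match_q O a b < W.
Proof.
have W1 : 1 < W by apply: leq_ltn_trans XX_lt_W; move: x1000; nia.
have W0 := ltnW W1.
rewrite /=; case: insubP => // a' _ _; case: insubP => // b' _ _.
by case: (_ \in _).
Qed.

Lemma threshold_fit : 4 * D <= W.
Proof.
have := threshold_lt degsum_lt => h; apply: leq_trans XW.
by rewrite leq_mul2l /=; apply: leq_trans (ltnW h) _; rewrite leq_pmulr // muln_gt0 (leq_trans _ x1000).
Qed.

Lemma gpm_run_spec t (r : t.-tuple 'I_W) : total_cost n m e cc O tx <= t ->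
  let s := gpm_run T P MG nb (code_cmd 0 (gpmC e cc)) r in
  halted (code_cmd 0 (gpmC e cc)) s /\
  out s = [seq p <- positions n m | ~~ (lmiss [seq val v | v <- r] p || hmiss p)].
Proof.
move=> ct; set p := code_cmd 0 (gpmC e cc); set tape := [seq val v | v <- r].
pose s0 := gpm_init T P w tape.
pose t0 := Hst (reg s0) (Defs.mem s0) tape [::] 0.
have W0 : 0 < W by rewrite expn_gt0.
have nW : n < W.
  apply: leq_ltn_trans XX_lt_W; apply: leq_trans (ltnW X_lt_XX).
  apply: leq_trans (Y_pow_X n (_ : 1 <= e)); last by lia.
  by rewrite expn1; apply: leq_trans (n_le_Y n); apply: leq_addr.
have mW : m < W by apply: leq_ltn_trans nW.
have w5 := w_ge5 m0 mn e40 XW; have LmW := Lm_W m0 mn e40 XW.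
have ok0 : okst w t0 by split=> x; rewrite /= ltn_pmod.
have sim0 : sim w n s0 t0 by split=> //=; rewrite modn_small.
have wp : ewf (powE e) by move: (e) => j; elim: j => //= j ->.
have wc : cwf (gpmC e cc) by rewrite /= wp.
have ca : codeat p (pc s0) (code_cmd (pc s0) (gpmC e cc)) by move=> i.
have [q [h1 h2 h3]] := code_cmd_ok O wc ok0 sim0 ca.
have rn0 : rg t0 0 = n by rewrite /= modn_small.
have rm0 : rg t0 1 = m by rewrite /= modn_small.
have tW i : i < n -> tx i < W by move=> iN; apply: ltn_trans XX_lt_W; apply: symbol_fit.
have pW i : i < m -> px i < W by move=> iN; apply: ltn_trans XX_lt_W; apply: symbol_fit.
have mT i : i < n -> mm t0 i = tx i.
  by move=> iN; rewrite /= nth_cat size_map size_tuple iN modn_small // tW.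
have mP i : i < m -> mm t0 (n + i) = px i.
  move=> iN; rewrite /= nth_cat size_map size_tuple ltnNge leq_addr /= addKn.
  by rewrite modn_small // pW.
have z0 id i : id < 32 -> i < X * X -> ar w n t0 id i = 0.
  move=> idl iL; rewrite /ar /= (adr_val w5 LmW) // nth_default ?mod0n //.
  by rewrite size_cat !size_map !size_tuple; move: mn; clear; lia.
have [g1 g2] := gpmC_spec R m0 mn e40 cce XW (fun i => symbol_fit T sTk (i := i))
   (fun i => symbol_fit P sPk (i := i)) degsum_lt oracle_deg_lt oracle_nbr_lt oracle_match_lt rn0 rm0 mT mP z0 erefl.
have E : gpm_run T P MG nb p r = iter q (step w O p) s0.
  have qt : q <= t by apply: leq_trans ct; rewrite -(add0n q) -[0]/(ck t0) -h1.
  rewrite /gpm_run -/tape -/s0 -(subnK qt) iterD; elim: (t - q) => //= j ->.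
  rewrite /step; case: (iter q _ s0) h3 => l rr h tp o /= hl.
  by rewrite /fetch /= nth_default // hl size_code_cmd.
rewrite E; split.
  by rewrite /halted /fetch nth_default // h3 size_code_cmd.
by case: h2 => _ _ _ -> _; rewrite g1.
Qed.
End Execution.

Local Open Scope ring_scope.

Lemma natr_powR_bound (R : realType) (c : R) (n : nat) (x y : R) :
  let cc := (Num.bound `|c|).+1 in
  (0 < n)%N -> n%:R ^+ cc * x <= n%:R * y -> 0 < y -> x / y <= n%:R `^ (- c).
Proof.
move=> cc n0 h y0; have n1 : 1 <= n%:R :> R by rewrite ler1n.
have nR : 0 < n%:R :> R by rewrite ltr0n.
have cb : c <= (Num.bound `|c|)%:R by apply: le_trans (ler_norm c) (ltW (archi_boundP _)).
apply: le_trans (_ : n%:R `^ (- (Num.bound `|c|)%:R) <= _); last first.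
  by apply: ler_powR => //; rewrite lerN2.
rewrite powR_invn ?ler0n // ler_pdivrMr // mulrC ler_pdivlMr ?exprn_gt0 //.
by move: h; rewrite exprS -mulrA ler_pM2l // mulrC.
Qed.

Theorem theorem3p2 (R : realType) (c : R) (k : nat) :
  exists (p : program) (d : nat) (C : R),
  forall (sT sP n m w : nat)
    (T : n.-tuple 'I_sT) (P : m.-tuple 'I_sP)
    (M : {set 'I_sT * 'I_sP}) (nb : 'I_sT -> seq 'I_sP),
    (0 < m <= n)%N ->
    (sT <= n ^ k + k)%N -> (sP <= n ^ k + k)%N ->
    neighbour_order M nb ->
    ((n + 2) ^ d <= 2 ^ w)%N ->
    exists t : nat,
      [/\ t%:R <= C * gpm_time R #|M| n m,
          forall r : t.-tuple 'I_(2 ^ w),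
            let s := gpm_run T P M nb p r in
            [/\ halted p s, uniq (out s),
                {subset out s <= positions n m} &
                {subset occurrences T P M <= out s}] &
          uniform_prob R [pred r : t.-tuple 'I_(2 ^ w) |
              ~~ perm_eq (out (gpm_run T P M nb p r)) (occurrences T P M)]
            <= n%:R `^ (- c)].
Proof.
pose cc := (Num.bound `|c|).+1; pose e := (40 + cc + (2 * k + 2))%N.
exists (code_cmd 0 (gpmC e cc)), (6 * e + 2)%N, (20 * (cost_const e cc)%:R).
move=> sT sP n m w T P M nb mn' sTk sPk nbP dW; have /andP[m0 mn] := mn'.
have n0 := leq_trans m0 mn.
have e40 : (40 <= e)%N by rewrite /e -addnA leq_addr.
have cce : (cc <= e)%N by rewrite /e addnAC leq_addl.
have ke : (2 * k + 2 <= e)%N by rewrite /e leq_addl.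
have XW := leq_trans (scale_le e n0) dW.
set O := gpm_oracle M nb; set tx := symbols T.
pose t := total_cost n m e cc O tx; exists t.
have run (r : t.-tuple 'I_(2 ^ w)) := gpm_run_spec P m0 mn e40 cce ke sTk sPk XW R r (leqnn t).
pose miss (r : t.-tuple 'I_(2 ^ w)) i :=
  light_miss w n m cc O tx (symbols P) [seq val v | v <- r] i || heavy_miss n m O tx (symbols P) i.
have pos i : (i \in positions n m) = (i + m <= n)%N by rewrite mem_iota; lia.
have sound r i : i \in positions n m -> gpm_match_at T P M i -> ~~ miss r i.
  by rewrite pos => im; apply: contraL => /(miss_sound nbP m0 mn im).
split.
- have S1 := degsum_le T M nb.
  apply: (time_bound R mn' _ _ (total_cost_le e cc O tx m0 mn)).
    by apply: leq_trans (threshold_sqr _ _ n0) _; rewrite leq_mul2r S1 orbT.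
  by apply: leq_trans (heavy_count_sqr _ _ n0) _; rewrite leq_mul2r S1 orbT.
- move=> r; have [h1 h2] := run r; cbv zeta; split=> //.
  + by rewrite h2 filter_uniq // iota_uniq.
  + by rewrite h2 => i; rewrite mem_filter => /andP[].
  + by rewrite h2 => i; rewrite !mem_filter => /andP[mi ip]; rewrite ip andbT; apply: sound.
rewrite /uniform_prob; apply: natr_powR_bound n0 _ _; last by rewrite ltr0n card_tuple card_ord !expn_gt0.
rewrite -natrX -!natrM ler_nat card_tuple card_ord.
pose bad := [pred r : t.-tuple 'I_(2 ^ w) | has (fun i => unnoticed cc T P M nb i r) (positions n m)].
apply: (@leq_trans (n ^ cc * #|bad|)%N).
  rewrite leq_mul2l; apply/orP; right.
  apply: subset_leq_card; apply/subsetP => r; rewrite !inE; apply: contraNT => /hasPn nb_.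
  have [_ ->] := run r; rewrite (_ : [seq _ <- _ | _] = occurrences T P M) //.
  apply: eq_in_filter => i ip; have := nb_ i ip; rewrite /unnoticed -/O -/tx -/(miss r i).
  case mi : (gpm_match_at _ _ _ _) => /=; first by rewrite sound.
  by rewrite negbK => ->.
have rt : (repeats cc O tx n * m <= t)%N.
  rewrite /t /total_cost; apply: leq_trans (leq_addr _ _); apply: leq_trans (leq_addl _ _).
  rewrite leq_mul2l; apply/orP; right.
  by rewrite /rep_cost; lia.
have DW := threshold_fit T M nb m0 mn e40 ke sTk sPk XW.
apply: leq_trans (_ : size (positions n m) * (2 ^ w) ^ t <= _)%N; last by rewrite leq_mul2r size_iota; apply/orP; right; lia.
have : {subset positions n m <= positions n m} by [].
rewrite /bad; move: {1 3 4}(positions n m) => s; elim: s => [|i s IH] si.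
  by rewrite eq_card0 ?muln0 // => r; rewrite !inE.
rewrite mulSn; apply: leq_trans (leq_add (unnoticed_card P nbP m0 mn _ rt DW) (IH _)); last first.
- by move=> j js; apply: si; rewrite inE js orbT.
- by rewrite -pos; apply: si; apply: mem_head.
rewrite -mulnDr leq_mul2l; apply/orP; right.
set A := [pred r | unnoticed _ _ _ _ _ i _]; set B := [pred r | has _ s].
rewrite -(cardUI A B); apply: leq_trans (leq_addr _ _).
by apply: subset_leq_card; apply/subsetP => r; rewrite !inE.
Qed.
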